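(* Let $f \in \mathcal{S}'(\mathbb{T}) \setminus \mathcal{S}(\mathbb{T})$. (1) For any $\gamma \in\mathbb{R}$ and all $0<p \leq \infty$, $s_{\mathrm{L}_\gamma f}(p)= s_f(p) - \gamma$. (2) The function $\frac{1}{p} \mapsto s_f(p)$ (that is, $u\mapsto s_f(1/u)$ on $[0,\infty)$) is left and right differentiable at any point (only right differentiable at $u=0$). Denote by $\partial_+s_f(p_0)$, for $p_0\in(0,\infty]$ (resp. $\partial_-s_f(p_0)$, for $p_0\in(0,\infty)$), its right (resp. left) derivative at $u = 1/p_0$. (3) For any $0 <p<\infty$, $\partial_-s_f(p) \geq \partial_+ s_f(p)$. (4) There are at most countably many points where the function $\frac{1}{p} \mapsto s_f(p)$ is not differentiable. (5) Let $p_0\in(0,\infty)$. If $\partial_-s_f(p_0)= 1$, then for any $p \geq p_0$, $s_f(p) = s_f(p_0) + \frac{1}{p} - \frac{1}{p_0}$. (6) Let $p_0\in(0,\infty]$. If $\partial_+s_f(p_0)= 0$, then for any $p \leq p_0$, $s_f(p) = s_f(p_0)$. (7) Let $p_0\in(0,\infty)$. If $\partial_-s_f(p_0)= 1$ and $\partial_+s_f(p_0)= 0$, then for all $0< p \leq \infty$, $$s_f(p) = s_f(p_0) - \frac{1}{p_0} + \frac{1}{\max(p,p_0)} = s_f(\infty) + \frac{1}{\max(p,p_0)}.$$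
   Context: Convention: $1/\infty = 0$ and $1/0=\infty$. $\mathbb{T} = \mathbb{R}/\mathbb{Z}$ is the one-dimensional torus, $\mathcal{S}(\mathbb{T})$ is the space of infinitely smooth periodic functions with its usual Fréchet topology, and $\mathcal{S}'(\mathbb{T})$ is its topological dual. $(\widehat{f}_k)_{k\in\mathbb{Z}}$ denotes the Fourier coefficients of $f \in \mathcal{S}'(\mathbb{T})$ with respect to $e_k=e^{2 i\pi k\cdot}$. Besov spaces: fix non-negative $\varphi_0,\varphi_1$ in the Schwartz class $\mathcal{S}(\mathbb{R})$ with $\mathrm{Supp}\,\varphi_0 \subset \{|x|\le 2\}$, $\mathrm{Supp}\,\varphi_1\subset\{1\le |x|\le 4\}$, and $\sum_{j\ge 0}\varphi_j = 1$, where $\varphi_j = \varphi_1(2^{-(j-1)}\cdot)$ for $j\ge 2$. For $0<p,q\le\infty$ and $s\in\mathbb{R}$, $B_{p,q}^s(\mathbb{T})$ is the space of $f\in\mathcal{S}'(\mathbb{T})$ such that $$\|f\|_{B^s_{p,q}} = \Big(\sum_{j\ge 0} 2^{jsq} \Big\| \sum_{k\in\mathbb{Z}} \varphi_j(k)\widehat{f}_k e^{2 i\pi k\cdot}\Big\|_{L_p}^q\Big)^{1/q}<\infty$$ (with a supremum over $j$ of $2^{js}\|\cdot\|_{L_p}$ if $q=\infty$). The space does not depend on the choice of $(\varphi_j)$. Critical smoothness: $s_f(p)=\sup\{s\in\mathbb{R} : f\in B^s_{p,q}(\mathbb{T})\}\in(-\infty,\infty]$, which does not depend on $q\in(0,\infty]$.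 It is finite for every $p\in(0,\infty]$ when $f\notin\mathcal{S}(\mathbb{T})$. Sobolev operator: for $\gamma\in\mathbb{R}$, $\mathrm{L}_\gamma=(\mathrm{Id}-\Delta)^{\gamma/2}$ acts on $f\in\mathcal{S}'(\mathbb{T})$ by $\mathrm{L}_\gamma f=\sum_{k\in\mathbb{Z}}(1+k^2)^{\gamma/2}\widehat{f}_k\,e_k$. *)

(* Defs.v *)
From HB Require Import structures.
From mathcomp Require Import all_boot all_order all_algebra.
From mathcomp Require Import complex.
From mathcomp Require Import all_classical all_reals all_analysis.

Set Implicit Arguments.
Unset Strict Implicit.
Unset Printing Implicit Defensive.
Import Order.TTheory GRing.Theory Num.Theory.
Import numFieldNormedType.Exports.

Local Open Scope classical_set_scope.
Local Open Scope ring_scope.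
Local Open Scope complex_scope.

Section complex_valued.
Context {R : realType}.

(* R[i] carries no topology in the library, so limits, integrals and
   derivatives of complex-valued functions are taken componentwise. *)
Definition cmodulus (z : R[i]) : R := ComplexField.Normc.normc z.

Definition cintegral01 (g : R -> R[i]) : R[i] :=
  (\int[lebesgue_measure]_(x in `[0, 1]) complex.Re (g x)) +i*
  (\int[lebesgue_measure]_(x in `[0, 1]) complex.Im (g x)).

Definition clim (u : nat -> R[i]) : R[i] :=
  lim ((fun n => complex.Re (u n)) @ \oo) +i*
  lim ((fun n => complex.Im (u n)) @ \oo).

Definition csmooth (g : R -> R[i]) : Prop :=
  forall (n : nat) (x : R),
    derivable (derive1n n (fun y => complex.Re (g y))) x 1 /\
    derivable (derive1n n (fun y => complex.Im (g y))) x 1.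

Definition cderiven (n : nat) (g : R -> R[i]) (x : R) : R[i] :=
  derive1n n (fun y => complex.Re (g y)) x +i*
  derive1n n (fun y => complex.Im (g y)) x.

End complex_valued.

Section periodic_distributions.
Context {R : realType}.

(* S(T): functions on the torus are 1-periodic functions on R. *)
Definition test_function (g : R -> R[i]) : Prop :=
  csmooth g /\ forall x : R, g (x + 1) = g x.

Definition test_seminorm (n : nat) (g : R -> R[i]) : \bar R :=
  ereal_sup (range (fun x : R => (cmodulus (cderiven n g x))%:E)).

(* S'(T): a linear functional on S(T), continuous for the topology generated by
   the seminorms above. Only its values on S(T) are meaningful. *)
Definition distribution_T (f : (R -> R[i]) -> R[i]) : Prop :=
  (forall (a : R[i]) (g h : R -> R[i]), test_function g -> test_function h ->
     f (fun x => a * g x + h x) = a * f g + f h) /\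
  (forall g : R -> R[i], test_function g ->
   forall eps : R, 0 < eps ->
   exists (N : nat) (delta : R), 0 < delta /\
   forall h : R -> R[i], test_function h ->
     (forall n : nat, (n <= N)%N ->
        (test_seminorm n (fun x => (h x - g x)%R) < delta%:E)%E) ->
     cmodulus (f h - f g) < eps).

(* f belongs to S(T), seen inside S'(T) through g |-> (h |-> int_T g h). *)
Definition is_smooth_distribution (f : (R -> R[i]) -> R[i]) : Prop :=
  exists2 g : R -> R[i], test_function g &
    forall h : R -> R[i], test_function h ->
      f h = cintegral01 (fun x => g x * h x).

Definition expk (k : int) (x : R) : R[i] :=
  cos (2 * pi * k%:~R * x) +i* sin (2 * pi * k%:~R * x).

Definition fourier_coef (f : (R -> R[i]) -> R[i]) (k : int) : R[i] :=
  f (expk (- k)).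

(* The Fourier series is summed in S'(T), i.e. tested against each h. *)
Definition sobolev_op (gamma : R) (f : (R -> R[i]) -> R[i]) :
    (R -> R[i]) -> R[i] :=
  fun h => clim (fun n : nat =>
    \sum_(k \in [set k : int | `|k| <= n%:Z])
      ((1 + k%:~R ^+ 2) `^ (gamma / 2))%:C * fourier_coef f k *
      cintegral01 (fun x => expk k x * h x)).

End periodic_distributions.

Section besov.
Context {R : realType}.

Definition schwartz (g : R -> R) : Prop :=
  (forall (n : nat) (x : R), derivable (derive1n n g) x 1) /\
  (forall m n : nat, exists C : R, forall x : R,
     `|x ^+ m * derive1n n g x| <= C).

(* For j = 1 the dilation factor is 1, so this is phi1. *)
Definition dyadic (phi0 phi1 : R -> R) (j : nat) : R -> R :=
  if j is j'.+1 then fun x => phi1 (2 ^- j' * x) else phi0.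

Definition littlewood_paley (phi0 phi1 : R -> R) : Prop :=
  [/\ schwartz phi0 /\ schwartz phi1,
      (forall x, 0 <= phi0 x) /\ (forall x, 0 <= phi1 x),
      closure [set x | phi0 x != 0] `<=` [set x | `|x| <= 2],
      closure [set x | phi1 x != 0] `<=` [set x | 1 <= `|x| <= 4] &
      forall x : R, series (fun j => dyadic phi0 phi1 j x) @ \oo --> (1 : R)].

(* A finitely supported sum when (phi0, phi1) is a Littlewood-Paley pair. *)
Definition lp_block (phi0 phi1 : R -> R) (f : (R -> R[i]) -> R[i]) (j : nat)
    (x : R) : R[i] :=
  \sum_(k \in [set: int])
    (dyadic phi0 phi1 j k%:~R)%:C * fourier_coef f k * expk k x.

Definition Lp_torus (p : \bar R) (g : R -> R[i]) : \bar R :=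
  Lnorm (mrestr (@lebesgue_measure R) (measurable_itv `[0, 1])) p
    (fun x => (cmodulus (g x))%:E).

(* Only meaningful for p, q > 0; the wildcard branch is q = +oo. *)
Definition besov_norm (phi0 phi1 : R -> R) (p q : \bar R) (s : R)
    (f : (R -> R[i]) -> R[i]) : \bar R :=
  (match q with
   | r%:E =>
     (\sum_(0 <= j <oo) (2 `^ (j%:R * s * r))%:E *
        Lp_torus p (lp_block phi0 phi1 f j) `^ r) `^ r^-1
   | _ =>
     ereal_sup (range (fun j : nat => (2 `^ (j%:R * s))%:E *
        Lp_torus p (lp_block phi0 phi1 f j)))
   end)%E.

Definition in_besov (phi0 phi1 : R -> R) (p q : \bar R) (s : R)
    (f : (R -> R[i]) -> R[i]) : Prop :=
  distribution_T f /\ (besov_norm phi0 phi1 p q s f < +oo)%E.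

Definition critical_smoothness (phi0 phi1 : R -> R) (q : \bar R)
    (f : (R -> R[i]) -> R[i]) (p : \bar R) : \bar R :=
  ereal_sup [set s%:E | s in [set s : R | in_besov phi0 phi1 p q s f]].

(* u |-> s_f (1 / u); the library's inverse on \bar R has 1/0 = +oo, 1/oo = 0 *)
Definition smoothness_of_inv (phi0 phi1 : R -> R) (q : \bar R)
    (f : (R -> R[i]) -> R[i]) (u : R) : \bar R :=
  critical_smoothness phi0 phi1 q f (u%:E^-1)%E.

End besov.

Section one_sided_derivatives.
Context {R : realType}.
Implicit Types (g : R -> \bar R) (u : R).

(* A finite limit of these quotients forces g to be finite at u and, on the side
   considered, near u. *)
Definition diff_quotient g u (h : R) : \bar R :=
  ((g (u + h)%R - g u) * (h^-1)%:E)%E.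

Definition right_differentiable g u : Prop :=
  exists d : R, diff_quotient g u h @[h --> 0^'+] --> d%:E.

Definition left_differentiable g u : Prop :=
  exists d : R, diff_quotient g u h @[h --> 0^'-] --> d%:E.

Definition differentiable_at g u : Prop :=
  exists d : R, diff_quotient g u h @[h --> 0^'] --> d%:E.

Definition right_derivative g u : \bar R :=
  lim (diff_quotient g u h @[h --> 0^'+]).

Definition left_derivative g u : \bar R :=
  lim (diff_quotient g u h @[h --> 0^'-]).

End one_sided_derivatives.

Section smoothness_derivatives.
Context {R : realType}.

(* The derivatives are in the variable u = 1/p, at u = 1/p0. *)
Definition dplus_smoothness (phi0 phi1 : R -> R) (q : \bar R)
    (f : (R -> R[i]) -> R[i]) (p0 : \bar R) : \bar R :=
  right_derivative (smoothness_of_inv phi0 phi1 q f) (fine (p0^-1)%E).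

Definition dminus_smoothness (phi0 phi1 : R -> R) (q : \bar R)
    (f : (R -> R[i]) -> R[i]) (p0 : \bar R) : \bar R :=
  left_derivative (smoothness_of_inv phi0 phi1 q f) (fine (p0^-1)%E).

End smoothness_derivatives.

(* Main.v *)
Require Import Defs.
From HB Require Import structures.
From mathcomp Require Import all_boot all_order all_algebra.
From mathcomp Require Import complex.
From mathcomp Require Import all_classical all_reals all_analysis.
From mathcomp Require Import measurable_realfun ess_sup_inf ring lra zify.

(** Write [sigma u] for the critical smoothness of [f] at the exponent
    [p = 1 / u], [u >= 0]. Everything about derivatives follows from three facts:
    [sigma] is finite, it is concave on the half-line, and
    [sigma 0 <= sigma u <= sigma 0 + u]. Indeed the slopes of such a function are
    monotone and lie between 0 and 1. Hence one-sided derivatives exist, the left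
    one dominating the right one; at the points where they differ they bound
    pairwise disjoint nonempty open intervals, of which there are countably many.
    If the left derivative at [u] is 1, all slopes to the left of [u] equal 1; if
    the right derivative is 0, all slopes to the right vanish. In both cases
    [sigma] is affine on the corresponding side
    ([affine_of_slope_ge1], [constant_of_slope_le0]).

    The exponent [q] does not matter: membership in a Besov space is governed, up
    to an arbitrarily small loss of smoothness, by the growth in [j] of the [L_p]
    norms of the Littlewood-Paley blocks ([critical_smoothnessE]). The blocks are
    trigonometric polynomials with of the order of [2 ^ j] frequencies. Hoelder's
    inequality on each block gives concavity on the open half-line
    ([Lpow_hoelder], [besov_exps_interp]), the inclusion of [L_oo] in [L_p] gives
    [sigma 0 <= sigma u], and Nikolskii's inequality gives
    [sigma u <= sigma 0 + u] ([nikolskii], [besov_exps_bernstein]). These two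
    bounds make [sigma] continuous at zero, so that concavity extends to the
    closed half-line.

    For finiteness, a distribution has finite order, so its Fourier coefficients
    grow at most polynomially and [sigma] is not [-oo]
    ([besov_exps_nonempty]). If it were [+oo], the coefficients would decrease
    rapidly, and [f] would be the smooth function with these coefficients
    ([besov_exps_unbounded_smooth]). This last point rests on the convergence
    of Fourier series in the space of test functions, obtained from
    a telescoping proof of pointwise Fourier inversion ([fourier_inversion],
    [distribution_series]).

    The Sobolev operator multiplies the block of index [j + 1] by [2 ^ (j * gamma)]
    times a smooth function of [2 ^- j * k] whose derivatives are bounded
    independently of [j]. Expanding this function in a Fourier series in the
    frequency writes its action as a superposition of translations with rapidly
    decreasing weights; each translation preserves the [L_p] quasi-norm, and the
    decrease makes up for the missing triangle inequality when [p < 1]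
    ([translation_multiplier], [block_multiplier]). *)

Set Implicit Arguments.
Unset Strict Implicit.
Import Order.TTheory GRing.Theory Num.Theory.
Import numFieldNormedType.Exports.
Local Open Scope classical_set_scope.
Local Open Scope ring_scope.
Local Open Scope complex_scope.

(** * The modulus of complex numbers *)

Section modulus.
Context {R : realType}.
Implicit Types z w : R[i].
Local Notation Re := complex.Re.
Local Notation Im := complex.Im.

Lemma le_of_eq (x y : R) : x = y -> x <= y.
Proof. by move=> ->. Qed.

Lemma cReD z w : Re (z + w) = Re z + Re w.
Proof. by case: z w => [a b] [c d]. Qed.

Lemma cImD z w : Im (z + w) = Im z + Im w.
Proof. by case: z w => [a b] [c d]. Qed.

Lemma cReN z : Re (- z) = - Re z.
Proof. by case: z. Qed.

Lemma cImN z : Im (- z) = - Im z.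
Proof. by case: z. Qed.

Lemma cReM z w : Re (z * w) = Re z * Re w - Im z * Im w.
Proof. by case: z w => [a b] [c d]. Qed.

Lemma cImM z w : Im (z * w) = Re z * Im w + Im z * Re w.
Proof. by case: z w => [a b] [c d]. Qed.

Lemma cplxP z w : Re z = Re w -> Im z = Im w -> z = w.
Proof. by case: z w => [a b] [c d] /= -> ->. Qed.

Lemma cRe_sum (I : Type) (r : seq I) (P : pred I) (F : I -> R[i]) :
  Re (\sum_(i <- r | P i) F i) = \sum_(i <- r | P i) Re (F i).
Proof. exact: (big_morph _ cReD). Qed.

Lemma cIm_sum (I : Type) (r : seq I) (P : pred I) (F : I -> R[i]) :
  Im (\sum_(i <- r | P i) F i) = \sum_(i <- r | P i) Im (F i).
Proof. exact: (big_morph _ cImD). Qed.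

Lemma cmodE z : cmodulus z = Num.sqrt (Re z ^+ 2 + Im z ^+ 2).
Proof. by case: z. Qed.

Lemma cmod_ge0 z : 0 <= cmodulus z.
Proof. by rewrite cmodE sqrtr_ge0. Qed.

Lemma cmod0 : cmodulus (0 : R[i]) = 0.
Proof. exact: ComplexField.Normc.normc0. Qed.

Lemma cmod1 : cmodulus (1 : R[i]) = 1.
Proof. exact: ComplexField.Normc.normc1. Qed.

Lemma cmod_eq0 z : cmodulus z = 0 -> z = 0.
Proof. exact: ComplexField.Normc.eq0_normc. Qed.

Lemma cmodM z w : cmodulus (z * w) = cmodulus z * cmodulus w.
Proof. exact: ComplexField.Normc.normcM. Qed.

Lemma cmodV z : cmodulus (z^-1) = (cmodulus z)^-1.
Proof. exact: ComplexField.Normc.normcV. Qed.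

Lemma cmodN z : cmodulus (- z) = cmodulus z.
Proof. by rewrite !cmodE cReN cImN !sqrrN. Qed.

Lemma cmodX z n : cmodulus (z ^+ n) = cmodulus z ^+ n.
Proof.
by elim: n => [|n IH]; rewrite ?expr0 ?cmod1// !exprS cmodM IH.
Qed.

Lemma cmodD z w : cmodulus (z + w) <= cmodulus z + cmodulus w.
Proof. exact: le_normcD. Qed.

Lemma cmodBC z w : cmodulus (z - w) = cmodulus (w - z).
Proof. by rewrite -cmodN opprB. Qed.

Lemma cmod_triB z w : cmodulus z <= cmodulus w + cmodulus (z - w).
Proof. by apply: le_trans (cmodD _ _); rewrite addrC subrK. Qed.

Lemma cmod_sum (I : Type) (r : seq I) (P : pred I) (F : I -> R[i]) :
  cmodulus (\sum_(i <- r | P i) F i) <= \sum_(i <- r | P i) cmodulus (F i).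
Proof.
elim/big_rec2: _ => [|i x y _ H]; first by rewrite cmod0.
exact: le_trans (cmodD _ _) (lerD _ H).
Qed.

Lemma cmodR (x : R) : cmodulus (x%:C) = `|x|.
Proof. by rewrite cmodE /= expr0n addr0 sqrtr_sqr. Qed.

Lemma Re_le_cmod z : `|Re z| <= cmodulus z.
Proof. by rewrite cmodE -sqrtr_sqr ler_wsqrtr// lerDl sqr_ge0. Qed.

Lemma Im_le_cmod z : `|Im z| <= cmodulus z.
Proof. by rewrite cmodE -sqrtr_sqr ler_wsqrtr// lerDr sqr_ge0. Qed.

Lemma cmod_le_ReIm z : cmodulus z <= `|Re z| + `|Im z|.
Proof.
rewrite cmodE -(ger0_norm (addr_ge0 (normr_ge0 (Re z)) (normr_ge0 (Im z)))).
rewrite -sqrtr_sqr ler_wsqrtr// -(real_normK (num_real (Re z))).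
rewrite -(real_normK (num_real (Im z))).
by have := normr_ge0 (Re z); have := normr_ge0 (Im z); nra.
Qed.

End modulus.

(** * Integration of bounded complex functions over the unit interval *)

Section unit_interval.
Context {R : realType}.
Local Notation Re := complex.Re.
Local Notation Im := complex.Im.
Local Notation mu := (@lebesgue_measure R).
Local Notation I01 := (`[0, 1]%classic : set R).
Implicit Types (u v : R -> R) (g h : R -> R[i]).

Definition rint u : R := \int[mu]_(x in `[0, 1]) u x.

Definition bounded_measurable u :=
  measurable_fun I01 u /\ exists C, forall x, I01 x -> `|u x| <= C.

Lemma bm_integrable u : bounded_measurable u ->
  mu.-integrable I01 (EFin \o u).
Proof.
move=> [mu_ [C hC]]; apply: measurable_bounded_integrable => //.
  by rewrite /= lebesgue_measure_itv /= lte_fin ltr01 sube0 ltry.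
exists C; split; first exact: num_real.
by move=> M CM x /hC /le_trans; apply; exact: ltW.
Qed.

Lemma bm_cst (c : R) : bounded_measurable (fun=> c).
Proof. by split; [exact: measurable_cst|exists `|c|]. Qed.

Lemma bmD u v : bounded_measurable u -> bounded_measurable v ->
  bounded_measurable (fun x => u x + v x).
Proof.
move=> [mu_ [C hC]] [mv [D hD]]; split; first exact: measurable_funD.
exists (C + D) => x xI; apply: le_trans (ler_normD _ _) _.
by rewrite lerD ?hC ?hD.
Qed.

Lemma bmM u v : bounded_measurable u -> bounded_measurable v ->
  bounded_measurable (fun x => u x * v x).
Proof.
move=> [mu_ [C hC]] [mv [D hD]]; split; first exact: measurable_funM.
by exists (C * D) => x xI; rewrite normrM ler_pM ?hC ?hD.
Qed.

Lemma bmN u : bounded_measurable u -> bounded_measurable (fun x => - u x).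
Proof.
move=> bu; rewrite (_ : (fun x => _) = (fun x => -1 * u x)).
  by apply: bmM => //; exact: bm_cst.
by apply/funext => x; rewrite mulN1r.
Qed.

Lemma bmB u v : bounded_measurable u -> bounded_measurable v ->
  bounded_measurable (fun x => u x - v x).
Proof. by move=> bu bv; apply: bmD => //; exact: bmN. Qed.

Lemma bm_norm u : bounded_measurable u -> bounded_measurable (fun x => `|u x|).
Proof.
move=> [mu_ [C hC]]; split; first exact: measurableT_comp.
by exists C => x xI; rewrite normr_id hC.
Qed.

Lemma bm_sum (J : Type) (r : seq J) (F : J -> R -> R) :
  (forall j, bounded_measurable (F j)) ->
  bounded_measurable (fun x => \sum_(j <- r) F j x).
Proof.
move=> bF; elim: r => [|j r IH].
  by rewrite (_ : (fun _ => _) = (fun=> 0));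
    [exact: bm_cst|apply/funext => x; rewrite big_nil].
rewrite (_ : (fun _ => _) = (fun x => F j x + \sum_(j <- r) F j x)).
  exact: bmD.
by apply/funext => x; rewrite big_cons.
Qed.

Lemma continuous_bm u : continuous u -> bounded_measurable u.
Proof.
move=> cu; split.
  by apply: measurable_funTS; exact: continuous_measurable_fun.
have cI : {within `[0, 1], continuous u}.
  exact: continuous_subspaceT.
have [c _ hc] := EVT_max (@ler01 R) cI.
have [d _ hd] := EVT_min (@ler01 R) cI.
exists (`|u c| + `|u d|) => x xI; rewrite ler_norml.
have H1 := hc _ xI; have H2 := hd _ xI.
have H3 := ler_norm (u c); have H4 := ler_norm (- u d).
rewrite normrN in H4.
have := normr_ge0 (u c); have := normr_ge0 (u d).
by move=> *; apply/andP; split; lra.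
Qed.

Lemma rintD u v : bounded_measurable u -> bounded_measurable v ->
  rint (fun x => u x + v x) = rint u + rint v.
Proof. by move=> bu bv; apply: RintegralD => //; exact: bm_integrable. Qed.

Lemma rintB u v : bounded_measurable u -> bounded_measurable v ->
  rint (fun x => u x - v x) = rint u - rint v.
Proof. by move=> bu bv; apply: RintegralB => //; exact: bm_integrable. Qed.

Lemma rintZ (c : R) u : bounded_measurable u ->
  rint (fun x => c * u x) = c * rint u.
Proof. by move=> bu; apply: RintegralZl => //; exact: bm_integrable. Qed.

Lemma rint_cst (c : R) : rint (fun=> c) = c.
Proof.
rewrite /rint Rintegral_cst//= lebesgue_measure_itv /= lte_fin ltr01.
by rewrite sube0 /= mulr1.
Qed.

Lemma rint_le u v : bounded_measurable u -> bounded_measurable v ->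
  (forall x, I01 x -> u x <= v x) -> rint u <= rint v.
Proof. by move=> bu bv uv; apply: le_Rintegral => //; exact: bm_integrable. Qed.

Lemma rint_ge0 u : (forall x, 0 <= u x) -> 0 <= rint u.
Proof. by move=> u0; apply: Rintegral_ge0. Qed.

Lemma rint_norm u : bounded_measurable u -> `|rint u| <= rint (fun x => `|u x|).
Proof. by move=> bu; apply: le_normr_Rintegral => //; exact: bm_integrable. Qed.

Lemma rint_eq u v : (forall x, I01 x -> u x = v x) -> rint u = rint v.
Proof. by move=> uv; apply: eq_Rintegral => x; rewrite inE; exact: uv. Qed.

Lemma rint_sum (J : Type) (r : seq J) (F : J -> R -> R) :
  (forall j, bounded_measurable (F j)) ->
  rint (fun x => \sum_(j <- r) F j x) = \sum_(j <- r) rint (F j).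
Proof.
move=> bF; elim: r => [|j r IH].
  rewrite big_nil -[RHS](rint_cst 0); congr rint.
  by apply/funext => x; rewrite big_nil.
rewrite big_cons -IH -rintD//; last exact: bm_sum.
by congr rint; apply/funext => x; rewrite big_cons.
Qed.

Lemma rint_derive u v :
  (forall x : R, 0 <= x <= 1 -> is_derive x (1 : R) u (v x)) ->
  {within `[0, 1], continuous v} -> rint v = u 1 - u 0.
Proof.
move=> uv cv.
have cu x : 0 <= x <= 1 -> {for x, continuous u}.
  by move=> x01; apply: differentiable_continuous; apply/derivable1_diffP;
     have [] := uv x x01.
rewrite /rint /Rintegral (@continuous_FTC2 _ v u 0 1)//.
- split.
  + by move=> x /itvP x01; have [] := uv x; rewrite ?x01.
  + by apply: cvg_at_right_filter; apply: cu; rewrite lexx ler01.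
  + by apply: cvg_at_left_filter; apply: cu; rewrite lexx ler01.
- by move=> x /itvP x01; have := uv x; rewrite !x01 derive1E => /(_ isT) ?;
    apply: derive_val.
Qed.

(** ** Complex-valued functions *)

Definition cbm g :=
  bounded_measurable (fun x => Re (g x)) /\ bounded_measurable (fun x => Im (g x)).

Lemma cintE g : cintegral01 g =
  rint (fun x => Re (g x)) +i* rint (fun x => Im (g x)).
Proof. by []. Qed.

Lemma cbm_cst (c : R[i]) : cbm (fun=> c).
Proof. by split; exact: bm_cst. Qed.

Lemma cbmD g h : cbm g -> cbm h -> cbm (fun x => g x + h x).
Proof.
move=> [a b] [c d]; split.
  by under eq_fun do rewrite cReD; exact: bmD.
by under eq_fun do rewrite cImD; exact: bmD.
Qed.

Lemma cbmM g h : cbm g -> cbm h -> cbm (fun x => g x * h x).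
Proof.
move=> [a b] [c d]; split.
  by under eq_fun do rewrite cReM; apply: bmB; exact: bmM.
by under eq_fun do rewrite cImM; apply: bmD; exact: bmM.
Qed.

Lemma cbmN g : cbm g -> cbm (fun x => - g x).
Proof.
move=> bg; rewrite (_ : (fun x => _) = (fun x => -1 * g x)).
  by apply: cbmM => //; exact: cbm_cst.
by apply/funext => x; rewrite mulN1r.
Qed.

Lemma cbm_sum (J : Type) (r : seq J) (F : J -> R -> R[i]) :
  (forall j, cbm (F j)) -> cbm (fun x => \sum_(j <- r) F j x).
Proof.
move=> bF; split.
  by under eq_fun do rewrite cRe_sum; apply: bm_sum => j; have [] := bF j.
by under eq_fun do rewrite cIm_sum; apply: bm_sum => j; have [] := bF j.
Qed.

Lemma cintD g h : cbm g -> cbm h ->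
  cintegral01 (fun x => g x + h x) = cintegral01 g + cintegral01 h.
Proof.
move=> [a b] [c d]; rewrite !cintE; apply: cplxP => /=.
  by under eq_fun do rewrite cReD; exact: rintD.
by under eq_fun do rewrite cImD; exact: rintD.
Qed.

Lemma cintZ (c : R[i]) g : cbm g ->
  cintegral01 (fun x => c * g x) = c * cintegral01 g.
Proof.
move=> [a b]; rewrite !cintE; apply: cplxP; rewrite /= ?cReM ?cImM /=.
  under eq_fun do rewrite cReM.
  by rewrite rintB ?rintZ//; apply: bmM => //; exact: bm_cst.
under eq_fun do rewrite cImM.
by rewrite rintD ?rintZ//; apply: bmM => //; exact: bm_cst.
Qed.

Lemma cint_sum (J : Type) (r : seq J) (F : J -> R -> R[i]) :
  (forall j, cbm (F j)) ->
  cintegral01 (fun x => \sum_(j <- r) F j x) = \sum_(j <- r) cintegral01 (F j).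
Proof.
move=> bF; elim: r => [|j r IH].
  rewrite big_nil (_ : (fun x => _) = (fun=> 0)).
    by rewrite cintE /= !rint_cst.
  by apply/funext => x; rewrite big_nil.
rewrite big_cons -IH -cintD//; last exact: cbm_sum.
by congr cintegral01; apply/funext => x; rewrite big_cons.
Qed.

Lemma cint_eq g h : (forall x, I01 x -> g x = h x) ->
  cintegral01 g = cintegral01 h.
Proof.
by move=> gh; rewrite !cintE; congr (_ +i* _); apply: rint_eq => x /gh ->.
Qed.

Lemma bm_cmod g : cbm g -> bounded_measurable (fun x => cmodulus (g x)).
Proof.
move=> [[m1 [C hC]] [m2 [D hD]]]; split.
  rewrite (_ : (fun x => _) =
      fun x => Num.sqrt (Re (g x) ^+ 2 + Im (g x) ^+ 2)); last first.
    by apply/funext => x; rewrite cmodE.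
  have ms : measurable_fun setT (@Num.sqrt R).
    by apply: continuous_measurable_fun => x; exact: sqrt_continuous.
  apply: (measurableT_comp ms); apply: measurable_funD.
    exact: measurable_funX.
  exact: measurable_funX.
exists (C + D) => x xI; rewrite ger0_norm ?cmod_ge0//.
by apply: le_trans (cmod_le_ReIm _) _; rewrite lerD ?hC ?hD.
Qed.

(** The factor 2 comes from estimating the real and imaginary parts
    separately; every later estimate is up to a constant, so nothing is lost. *)
Lemma cmod_cint g : cbm g ->
  cmodulus (cintegral01 g) <= 2 * rint (fun x => cmodulus (g x)).
Proof.
move=> bg; have bm := bm_cmod bg; case: (bg) => [a b].
rewrite cintE; apply: le_trans (cmod_le_ReIm _) _ => /=.
rewrite mulr2n mulrDl mul1r; apply: lerD.
  apply: le_trans (rint_norm a) _; apply: rint_le => //; first exact: bm_norm.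
  by move=> x _; exact: Re_le_cmod.
apply: le_trans (rint_norm b) _; apply: rint_le => //; first exact: bm_norm.
by move=> x _; exact: Im_le_cmod.
Qed.

Lemma cmod_cint_bound g (C : R) : cbm g ->
  (forall x, cmodulus (g x) <= C) -> cmodulus (cintegral01 g) <= 2 * C.
Proof.
move=> bg gC; apply: le_trans (cmod_cint bg) _.
rewrite ler_pM2l// -[leRHS](rint_cst C).
by apply: rint_le => //; [exact: bm_cmod|exact: bm_cst].
Qed.

(** ** Differentiable complex-valued functions *)

Definition is_cderive g h := forall x : R,
  is_derive x (1 : R) (fun y => Re (g y)) (Re (h x)) /\
  is_derive x (1 : R) (fun y => Im (g y)) (Im (h x)).

Definition ccontinuous g :=
  continuous (fun y => Re (g y)) /\ continuous (fun y => Im (g y)).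

Lemma is_derive_continuous u v : (forall x : R, is_derive x (1 : R) u (v x)) ->
  continuous u.
Proof.
by move=> uv x; apply: differentiable_continuous; apply/derivable1_diffP;
  have [] := uv x.
Qed.

Lemma is_cderive_continuous g h : is_cderive g h -> ccontinuous g.
Proof.
move=> gh; split; apply: is_derive_continuous => x; first exact: (gh x).1.
exact: (gh x).2.
Qed.

Lemma ccontinuous_cbm g : ccontinuous g -> cbm g.
Proof. by move=> [a b]; split; exact: continuous_bm. Qed.

Lemma ccontinuousM g h : ccontinuous g -> ccontinuous h ->
  ccontinuous (fun x => g x * h x).
Proof.
move=> [a b] [c d]; split.
  under eq_fun do rewrite cReM.
  by move=> x; apply: cvgB; apply: cvgM; [exact: a|exact: c|exact: b|exact: d].
under eq_fun do rewrite cImM.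
by move=> x; apply: cvgD; apply: cvgM; [exact: a|exact: d|exact: b|exact: c].
Qed.

Lemma ccontinuousD g h : ccontinuous g -> ccontinuous h ->
  ccontinuous (fun x => g x + h x).
Proof.
move=> [a b] [c d]; split.
  by under eq_fun do rewrite cReD; move=> x; apply: cvgD; [exact: a|exact: c].
by under eq_fun do rewrite cImD; move=> x; apply: cvgD; [exact: b|exact: d].
Qed.

Lemma ccontinuous_cst (c : R[i]) : ccontinuous (fun=> c).
Proof. by split=> x; exact: cvg_cst. Qed.

Lemma is_derive_eqR (x : R) u d d' : is_derive x (1 : R) u d -> d = d' ->
  is_derive x (1 : R) u d'.
Proof. by move=> H <-. Qed.

Lemma is_derive_mul (x : R) u v du dv :
  is_derive x (1 : R) u du -> is_derive x (1 : R) v dv ->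
  is_derive x (1 : R) (fun y => u y * v y) (du * v x + u x * dv).
Proof.
move=> hu hv; apply: is_derive_eqR (is_deriveM hu hv) _.
by rewrite /GRing.scale /= addrC; congr (_ + _); rewrite mulrC.
Qed.

Lemma is_derive_add (x : R) u v du dv :
  is_derive x (1 : R) u du -> is_derive x (1 : R) v dv ->
  is_derive x (1 : R) (fun y => u y + v y) (du + dv).
Proof. exact: is_deriveD. Qed.

Lemma is_derive_sub (x : R) u v du dv :
  is_derive x (1 : R) u du -> is_derive x (1 : R) v dv ->
  is_derive x (1 : R) (fun y => u y - v y) (du - dv).
Proof. exact: is_deriveB. Qed.

Lemma is_derive_mulc (s x : R) : is_derive x (1 : R) (fun y : R => s * y) s.
Proof.
apply: is_derive_eqR (is_derive_mul (is_derive_cst s x (1 : R))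
  (is_derive_id x (1 : R))) _.
by rewrite mul0r add0r mulr1.
Qed.

Lemma is_derive_scale u (s x d : R) : is_derive (s * x) (1 : R) u d ->
  is_derive x (1 : R) (fun y => u (s * y)) (s * d).
Proof.
move=> du; rewrite mulrC.
exact: (@is_derive1_comp _ u (fun y => s * y) x _ _ du (is_derive_mulc s x)).
Qed.

Lemma is_derive_shift u (s x d : R) : is_derive (x + s) (1 : R) u d ->
  is_derive x (1 : R) (fun y => u (y + s)) d.
Proof.
move=> du.
have dl : is_derive x (1 : R) (fun y : R => y + s) 1.
  by apply: is_derive_eqR (is_derive_add (is_derive_id x (1 : R))
    (is_derive_cst s x (1 : R))) _; rewrite addr0.
by have := @is_derive1_comp _ u (fun y => y + s) x _ _ du dl; rewrite mulr1.
Qed.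

Lemma is_cderive_shift g h (s : R) : is_cderive g h ->
  is_cderive (fun x => g (x + s)) (fun x => h (x + s)).
Proof.
move=> gh x; have [a b] := gh (x + s); split.
  exact: (is_derive_shift a).
exact: (is_derive_shift b).
Qed.

Lemma is_cderive_cst (c : R[i]) : is_cderive (fun=> c) (fun=> 0).
Proof. by move=> x; split; exact: is_derive_cst. Qed.

Lemma is_cderiveD g h g' h' : is_cderive g g' -> is_cderive h h' ->
  is_cderive (fun x => g x + h x) (fun x => g' x + h' x).
Proof.
move=> G H x; have [a b] := G x; have [c d] := H x; split.
  under eq_fun do rewrite cReD.
  by rewrite cReD; exact: is_deriveD.
under eq_fun do rewrite cImD.
by rewrite cImD; exact: is_deriveD.
Qed.

Lemma is_cderiveM g h g' h' : is_cderive g g' -> is_cderive h h' ->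
  is_cderive (fun x => g x * h x) (fun x => g' x * h x + g x * h' x).
Proof.
move=> G H x; have [a b] := G x; have [c d] := H x; split.
  under eq_fun do rewrite cReM.
  apply: is_derive_eqR (is_derive_sub (is_derive_mul a c) (is_derive_mul b d)) _.
  by rewrite cReD !cReM; ring.
under eq_fun do rewrite cImM.
apply: is_derive_eqR (is_derive_add (is_derive_mul a d) (is_derive_mul b c)) _.
by rewrite cImD !cImM; ring.
Qed.

Lemma is_cderiveZ (c : R[i]) g g' : is_cderive g g' ->
  is_cderive (fun x => c * g x) (fun x => c * g' x).
Proof.
move=> G; have := is_cderiveM (is_cderive_cst c) G.
by under [X in is_cderive _ X]eq_fun do rewrite mul0r add0r.
Qed.

Lemma cint_derive g g' : is_cderive g g' -> ccontinuous g' ->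
  cintegral01 g' = g 1 - g 0.
Proof.
move=> G [c d]; rewrite cintE; apply: cplxP; rewrite /= ?cReD ?cImD ?cReN ?cImN.
  apply: (@rint_derive (fun x => Re (g x))); last exact: continuous_subspaceT.
  by move=> x _; have [] := G x.
apply: (@rint_derive (fun x => Im (g x))); last exact: continuous_subspaceT.
by move=> x _; have [] := G x.
Qed.

End unit_interval.

(** * The characters of the torus *)

Section characters.
Context {R : realType}.
Local Notation Re := complex.Re.
Local Notation Im := complex.Im.
Implicit Types (k l : int) (x y : R).

Lemma expkD k l x : expk (k + l) x = expk k x * expk l x.
Proof.
rewrite /expk intrD; apply: cplxP; rewrite /= ?cReM ?cImM /= mulrDr mulrDl.
  by rewrite cosD.
by rewrite sinD addrC; congr (_ + _).
Qed.

Lemma expkDx k x y : expk k (x + y) = expk k x * expk k y.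
Proof.
rewrite /expk; apply: cplxP; rewrite /= ?cReM ?cImM /= mulrDr.
  by rewrite cosD.
by rewrite sinD addrC; congr (_ + _).
Qed.

Lemma expk0 x : expk 0 x = 1.
Proof. by rewrite /expk mulr0 mul0r cos0 sin0. Qed.

Lemma expk_0 k : expk k (0 : R) = 1.
Proof. by rewrite /expk mulr0 cos0 sin0. Qed.

Lemma cmod_expk k x : cmodulus (expk k x) = 1.
Proof. by rewrite cmodE /= cos2Dsin2 sqrtr1. Qed.

Lemma expkN k x : expk (- k) x = expk k (- x).
Proof. by rewrite /expk intrN mulrN mulNr mulrN. Qed.

Lemma expkNK k x : expk (- k) x * expk k x = 1.
Proof. by rewrite -expkD addNr expk0. Qed.

Lemma expkKN k x : expk k x * expk (- k) x = 1.
Proof. by rewrite mulrC expkNK. Qed.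

Lemma expk_nat (n : nat) x : expk n x = expk 1 x ^+ n.
Proof.
elim: n => [|n IH]; first by rewrite expk0 expr0.
by rewrite -addn1 PoszD expkD IH addn1 exprSr.
Qed.

Lemma expk_1 k : expk k (1 : R) = 1.
Proof.
have e11 : expk 1 (1 : R) = 1.
  have E : 2 * pi * (1 : int)%:~R * 1 = pi *+ 2 :> R.
    by rewrite /intmul /= !mulr1 mulr_natl.
  by rewrite /expk E cos2pi sin2pi.
have en (n : nat) : expk n (1 : R) = 1 by rewrite expk_nat e11 expr1n.
case: k => n; first exact: en.
by rewrite NegzE; have := expkKN n.+1 (1 : R); rewrite en mul1r.
Qed.

Lemma expk_periodic k x : expk k (x + 1) = expk k x.
Proof. by rewrite expkDx expk_1 mulr1. Qed.

(** The eigenvalue of differentiation on the character [expk k]. *)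
Definition freq k : R[i] := 0 +i* (2 * pi * k%:~R).

Lemma expk_cderive k : is_cderive (expk k) (fun x => freq k * expk k x).
Proof.
move=> x.
have dl := is_derive_mulc (2 * pi * k%:~R) x.
split; rewrite /= ?cReM ?cImM /= ?mul0r ?sub0r ?addr0 ?add0r.
  apply: is_derive_eqR (is_derive1_comp (is_derive_cos _) dl) _.
  by rewrite mulNr mulrC.
apply: is_derive_eqR (is_derive1_comp (is_derive_sin _) dl) _.
exact: mulrC.
Qed.

Lemma cmod_freq k : cmodulus (freq k) = 2 * pi * `|k%:~R|.
Proof.
rewrite cmodE /= expr0n add0r sqrtr_sqr normrM ger0_norm//.
by rewrite mulr_ge0// pi_ge0.
Qed.

Lemma expk_continuous k : ccontinuous (@expk R k).
Proof. exact: is_cderive_continuous (expk_cderive k). Qed.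

Lemma cbm_expk k : cbm (@expk R k).
Proof. exact/ccontinuous_cbm/expk_continuous. Qed.

Lemma freq_neq0 k : k != 0 -> freq k != 0.
Proof.
move=> k0; apply/eqP => /(congr1 cmodulus); rewrite cmod_freq cmod0 => /eqP.
by rewrite mulf_eq0 normr_eq0 intr_eq0 (negPf k0) orbF gt_eqF// mulr_gt0// pi_gt0.
Qed.

Lemma cint_expk k : cintegral01 (@expk R k) = (k == 0)%:R.
Proof.
have [->|k0] := eqVneq k 0.
  rewrite (_ : expk 0 = fun=> 1); last by apply/funext => x; rewrite expk0.
  by rewrite cintE /= !rint_cst.
have : cintegral01 (fun x : R => freq k * expk k x) = 0.
  rewrite (cint_derive (expk_cderive k)) ?expk_1 ?expk_0 ?subrr//.
  by apply: ccontinuousM; [exact: ccontinuous_cst|exact: expk_continuous].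
rewrite cintZ; last exact: cbm_expk.
by move/eqP; rewrite mulf_eq0 (negPf (freq_neq0 k0)) /= => /eqP.
Qed.

End characters.

(** * Fourier coefficients *)

Section fourier.
Context {R : realType}.
Local Notation Re := complex.Re.
Local Notation Im := complex.Im.
Local Notation I01 := (`[0, 1]%classic : set R).
Implicit Types (k l : int) (x y : R) (g h : R -> R[i]).

Definition hat h k : R[i] := cintegral01 (fun x => expk (- k) x * h x).

Lemma hat_bound h (C : R) k : cbm h -> (forall x, cmodulus (h x) <= C) ->
  cmodulus (hat h k) <= 2 * C.
Proof.
move=> bh hC; apply: cmod_cint_bound; first by apply: cbmM => //; exact: cbm_expk.
by move=> x; rewrite cmodM cmod_expk mul1r.
Qed.

(** Integration by parts; the boundary terms cancel by periodicity. *)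
Lemma hat_derive h h' k : is_cderive h h' -> ccontinuous h' -> h 1 = h 0 ->
  hat h' k = freq k * hat h k.
Proof.
move=> dh ch' h10.
have ch := is_cderive_continuous dh.
have d := is_cderiveM (expk_cderive (- k)) dh.
have ce : ccontinuous (@expk R (- k)) by exact: expk_continuous.
have : cintegral01 (fun x => freq (- k) * expk (- k) x * h x +
                             expk (- k) x * h' x) = 0.
  rewrite (cint_derive d); first by rewrite expk_1 expk_0 h10 subrr.
  by apply: ccontinuousD; apply: ccontinuousM => //; apply: ccontinuousM => //;
    exact: ccontinuous_cst.
rewrite cintD; last 2 first.
- by apply: ccontinuous_cbm; apply: ccontinuousM => //; apply: ccontinuousM => //;
    exact: ccontinuous_cst.
- by apply: ccontinuous_cbm; apply: ccontinuousM.
under [X in cintegral01 X + _]eq_fun do rewrite -mulrA.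
rewrite cintZ; last by apply: ccontinuous_cbm; apply: ccontinuousM.
rewrite -/(hat h k) -/(hat h' k) => /eqP; rewrite addrC addr_eq0 => /eqP ->.
rewrite -mulNr; congr (_ * _).
by rewrite /freq intrN; apply: cplxP; rewrite /= ?mulrN ?opprK ?oppr0.
Qed.

(** The sum over the frequencies of modulus at most [n], taken in increasing
    order of modulus: symmetric partial sums are the ones that telescope in
    the proof of Fourier inversion. *)
Definition zsum {V : zmodType} (F : int -> V) (n : nat) : V :=
  F 0 + \sum_(i < n) (F i.+1%:Z + F (- i.+1%:Z)).

Lemma zsumS {V : zmodType} (F : int -> V) n :
  zsum F n.+1 = zsum F n + (F n.+1%:Z + F (- n.+1%:Z)).
Proof. by rewrite /zsum big_ord_recr /= addrA. Qed.

Lemma zsum0 {V : zmodType} (F : int -> V) : zsum F 0 = F 0.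
Proof. by rewrite /zsum big_ord0 addr0. Qed.

Lemma zsum_telescope {K : comNzRingType} (A : int -> K) n :
  zsum (fun k => A (k - 1) - A k) n = A (- n.+1%:Z) - A n.
Proof.
elim: n => [|n IH]; first by rewrite zsum0 sub0r.
rewrite zsumS IH.
have -> : n.+1%:Z - 1 = n by lia.
have -> : - n.+1%:Z - 1 = - n.+2%:Z by lia.
ring.
Qed.

Lemma eq_zsum {V : zmodType} (F G : int -> V) n :
  F =1 G -> zsum F n = zsum G n.
Proof. by move=> FG; rewrite /zsum FG; under eq_bigr do rewrite !FG. Qed.

Lemma zsumD {V : zmodType} (F G : int -> V) n :
  zsum (fun k => F k + G k) n = zsum F n + zsum G n.
Proof.
elim: n => [|n IH]; first by rewrite !zsum0.
rewrite !zsumS IH /= (addrACA (F n.+1%:Z)); exact: addrACA.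
Qed.

Lemma zsumZ (K : pzRingType) (c : K) (F : int -> K) n :
  zsum (fun k => c * F k) n = c * zsum F n.
Proof.
elim: n => [|n IH]; first by rewrite !zsum0.
by rewrite !zsumS IH !mulrDr.
Qed.

(** Subtracting from [u] its projection on [e n] lowers the integral of the
    square by [c * b n ^+ 2], where [b n] is the [n]-th coefficient of [u].
    These integrals decrease and are non-negative, hence converge, and the
    decrements tend to zero. This is what remains of Bessel's inequality once
    only the decay of the coefficients is asked for. *)
Lemma bessel_cvg0 (u : R -> R) (e : nat -> R -> R) (c : R) : 0 < c ->
  bounded_measurable u -> (forall n, bounded_measurable (e n)) ->
  (forall i j, rint (fun x => e i x * e j x) = if i == j then c else 0) ->
  (fun n => rint (fun x => u x * e n x)) @ \oo --> (0 : R).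
Proof.
move=> c0 bu be oe.
pose b n := rint (fun x => u x * e n x) / c.
pose U n x := u x - \sum_(i < n) b i * e i x.
have bbe i : bounded_measurable (fun x => b i * e i x).
  by apply: bmM => //; exact: bm_cst.
have bU n : bounded_measurable (U n).
  by apply: bmB => //; apply: bm_sum => i; exact: bbe.
pose A n := rint (fun x => U n x * U n x).
have Ue n : rint (fun x => U n x * e n x) = c * b n.
  rewrite /U; under eq_fun do rewrite mulrBl mulr_suml.
  rewrite rintB; last 2 first.
  - exact: bmM.
  - by apply: bm_sum => i; exact: bmM.
  rewrite rint_sum; last by move=> i; exact: bmM.
  rewrite big1 ?subr0; first by rewrite /b mulrC divfK// gt_eqF.
  move=> i _; under eq_fun do rewrite -mulrA.
  rewrite rintZ; last exact: bmM.
  by rewrite oe ltn_eqF// mulr0.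
have AS n : A n.+1 = A n - c * b n ^+ 2.
  have US x : U n.+1 x = U n x - b n * e n x.
    by rewrite /U big_ord_recr /= opprD addrA.
  rewrite /A; under eq_fun do rewrite US.
  rewrite (_ : (fun x => _) = (fun x => U n x * U n x -
     (2 * b n * (U n x * e n x) - b n ^+ 2 * (e n x * e n x)))); last first.
    by apply/funext => x; ring.
  have bUe : bounded_measurable (fun x => U n x * e n x) by exact: bmM.
  have bee : bounded_measurable (fun x => e n x * e n x) by exact: bmM.
  have b1 : bounded_measurable (fun x => 2 * b n * (U n x * e n x)).
    by apply: bmM => //; exact: bm_cst.
  have b2 : bounded_measurable (fun x => b n ^+ 2 * (e n x * e n x)).
    by apply: bmM => //; exact: bm_cst.
  rewrite rintB//; [|exact: bmM|exact: bmB].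
  by rewrite rintB// !rintZ// Ue oe eqxx; ring.
have A0 n : 0 <= A n by apply: rint_ge0 => x; rewrite -expr2 sqr_ge0.
have Acvg : cvgn A.
  apply: nonincreasing_is_cvgn.
    apply/nonincreasing_seqP => n; rewrite AS gerBl.
    by rewrite mulr_ge0 ?sqr_ge0// ltW.
  by exists 0 => _ [n _ <-].
have dA : (fun n => A n - A n.+1) @ \oo --> (0 : R).
  rewrite -(subrr (limn A)); apply: cvgB => //.
  by rewrite (cvg_shiftS A).
apply/cvgr0Pnorm_lt => eps eps0.
have ec0 : 0 < eps ^+ 2 / c by rewrite divr_gt0// exprn_gt0.
near=> n.
have : `|A n - A n.+1| < eps ^+ 2 / c by near: n; apply: (cvgr0Pnorm_lt _).1.
rewrite AS opprB addrCA subrr addr0 => /(le_lt_trans (ler_norm _)).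
rewrite ltr_pdivlMr// => H.
have -> : rint (fun x => u x * e n x) = c * b n.
  by rewrite /b mulrC divfK// gt_eqF.
rewrite -(@ltr_pXn2r _ 2)// ?nnegrE ?ltW// real_normK ?num_real//.
by rewrite (_ : (c * b n) ^+ 2 = c * b n ^+ 2 * c)//; ring.
Unshelve. all: by end_near. Qed.

End fourier.

(** * Pointwise Fourier inversion *)

Section inversion.
Context {R : realType}.
Local Notation Re := complex.Re.
Local Notation Im := complex.Im.
Local Notation I01 := (`[0, 1]%classic : set R).
Implicit Types (k l : int) (x y : R) (g h : R -> R[i]).

Lemma continuous_cos2pi (c : R) : continuous (fun x : R => cos (c * x)).
Proof.
move=> x; apply: continuous_comp; last exact: continuous_cos.
exact: mulrl_continuous.
Qed.

Lemma continuous_sin2pi (c : R) : continuous (fun x : R => sin (c * x)).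
Proof.
move=> x; apply: continuous_comp; last exact: continuous_sin.
exact: mulrl_continuous.
Qed.

Lemma rint_cos k :
  rint (fun x : R => cos (2 * pi * k%:~R * x)) = if k == 0 then 1 else 0.
Proof.
have := congr1 (@complex.Re R) (cint_expk (R := R) k); rewrite cintE /= => ->.
by case: eqP.
Qed.

Lemma bm_cosk k : bounded_measurable (fun x : R => cos (2 * pi * k%:~R * x)).
Proof. by apply: continuous_bm; exact: continuous_cos2pi. Qed.

Lemma bm_sink k : bounded_measurable (fun x : R => sin (2 * pi * k%:~R * x)).
Proof. by apply: continuous_bm; exact: continuous_sin2pi. Qed.

Lemma orthogonal_cos (i j : nat) :
  rint (fun x : R => cos (2 * pi * i.+1%:~R * x) * cos (2 * pi * j.+1%:~R * x)) =
  if i == j then 2^-1 else 0.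
Proof.
rewrite (_ : (fun x => _) = (fun x =>
  2^-1 * cos (2 * pi * (i.+1%:Z - j.+1%:Z)%:~R * x) +
  2^-1 * cos (2 * pi * (i.+1%:Z + j.+1%:Z)%:~R * x))); last first.
  apply/funext => x; rewrite intrB intrD.
  have -> : forall a b : R, 2 * pi * (a - b) * x = 2 * pi * a * x - 2 * pi * b * x.
    by move=> a b; ring.
  have -> : forall a b : R, 2 * pi * (a + b) * x = 2 * pi * a * x + 2 * pi * b * x.
    by move=> a b; ring.
  by rewrite cosB cosD; field.
rewrite rintD; try by apply: bmM; [exact: bm_cst|exact: bm_cosk].
rewrite !rintZ; try exact: bm_cosk.
rewrite !rint_cos subr_eq0 eqz_nat eqSS -PoszD eqz_nat addSn /=.
by case: ifP => _; rewrite !mulr0 addr0 ?mulr1.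
Qed.

Lemma orthogonal_sin (i j : nat) :
  rint (fun x : R => sin (2 * pi * i.+1%:~R * x) * sin (2 * pi * j.+1%:~R * x)) =
  if i == j then 2^-1 else 0.
Proof.
rewrite (_ : (fun x => _) = (fun x =>
  2^-1 * cos (2 * pi * (i.+1%:Z - j.+1%:Z)%:~R * x) -
  2^-1 * cos (2 * pi * (i.+1%:Z + j.+1%:Z)%:~R * x))); last first.
  apply/funext => x; rewrite intrB intrD.
  have -> : forall a b : R, 2 * pi * (a - b) * x = 2 * pi * a * x - 2 * pi * b * x.
    by move=> a b; ring.
  have -> : forall a b : R, 2 * pi * (a + b) * x = 2 * pi * a * x + 2 * pi * b * x.
    by move=> a b; ring.
  by rewrite cosB cosD; field.
rewrite rintB; try by apply: bmM; [exact: bm_cst|exact: bm_cosk].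
rewrite !rintZ; try exact: bm_cosk.
rewrite !rint_cos subr_eq0 eqz_nat eqSS -PoszD eqz_nat addSn /=.
by case: ifP => _; rewrite !mulr0 subr0 ?mulr1.
Qed.

(** Cosines and sines of positive frequency are two orthogonal families with
    common squared norm one half, so the decay of the four real integrals that
    make up a Fourier coefficient is Bessel's inequality. *)
Lemma riemann_lebesgue g : cbm g ->
  (fun n : nat => cmodulus (hat g n)) @ \oo --> (0 : R) /\
  (fun n : nat => cmodulus (hat g (- n%:Z))) @ \oo --> (0 : R).
Proof.
move=> [b1 b2].
have h2 : 0 < 2^-1 :> R by rewrite invr_gt0.
have cR u : bounded_measurable u ->
    (fun n : nat => rint (fun x : R => u x * cos (2 * pi * n.+1%:~R * x)))
      @ \oo --> (0 : R).
  move=> bu; apply: (bessel_cvg0 h2) => //; last exact: orthogonal_cos.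
  by move=> n; exact: bm_cosk.
have sR u : bounded_measurable u ->
    (fun n : nat => rint (fun x : R => u x * sin (2 * pi * n.+1%:~R * x)))
      @ \oo --> (0 : R).
  move=> bu; apply: (bessel_cvg0 h2) => //; last exact: orthogonal_sin.
  by move=> n; exact: bm_sink.
have key k (a : R) : (forall x : R, expk k x =
    cos (2 * pi * `|k|%:~R * x) +i* (a * sin (2 * pi * `|k|%:~R * x))) ->
    `|a| = 1 -> cmodulus (cintegral01 (fun x => expk k x * g x)) <=
    `|rint (fun x => Re (g x) * cos (2 * pi * `|k|%:~R * x))| +
    `|rint (fun x => Im (g x) * sin (2 * pi * `|k|%:~R * x))| +
    (`|rint (fun x => Im (g x) * cos (2 * pi * `|k|%:~R * x))| +
    `|rint (fun x => Re (g x) * sin (2 * pi * `|k|%:~R * x))|).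
  move=> E a1; rewrite cintE; apply: le_trans (cmod_le_ReIm _) _ => /=.
  set c := fun x : R => cos (2 * pi * `|k|%:~R * x).
  set s := fun x : R => sin (2 * pi * `|k|%:~R * x).
  have bc : bounded_measurable c by exact: bm_cosk.
  have bs : bounded_measurable s by exact: bm_sink.
  have b11 : bounded_measurable (fun x => Re (g x) * c x) by exact: bmM.
  have b12 : bounded_measurable (fun x => Re (g x) * s x) by exact: bmM.
  have b21 : bounded_measurable (fun x => Im (g x) * c x) by exact: bmM.
  have b22 : bounded_measurable (fun x => Im (g x) * s x) by exact: bmM.
  apply: lerD.
    rewrite (_ : (fun x => _) = fun x => Re (g x) * c x - a * (Im (g x) * s x)).
      rewrite rintB//; last by apply: bmM => //; exact: bm_cst.
      by rewrite rintZ//; apply: le_trans (ler_normB _ _) _; rewrite normrM a1 mul1r.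
    by apply/funext => x; rewrite E cReM /= /c /s; ring.
  rewrite (_ : (fun x => _) = fun x => Im (g x) * c x + a * (Re (g x) * s x)).
    rewrite rintD//; last by apply: bmM => //; exact: bm_cst.
    by rewrite rintZ//; apply: le_trans (ler_normD _ _) _; rewrite normrM a1 mul1r.
  by apply/funext => x; rewrite E cImM /= /c /s; ring.
pose B n := `|rint (fun x => Re (g x) * cos (2 * pi * n.+1%:~R * x))| +
    `|rint (fun x => Im (g x) * sin (2 * pi * n.+1%:~R * x))| +
    (`|rint (fun x => Im (g x) * cos (2 * pi * n.+1%:~R * x))| +
    `|rint (fun x => Re (g x) * sin (2 * pi * n.+1%:~R * x))|).
have B0 : B @ \oo --> (0 : R).
  rewrite (_ : 0 = `|0 : R| + `|0 : R| + (`|0 : R| + `|0 : R|)); last first.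
    by rewrite normr0 !addr0.
  by apply: cvgD; apply: cvgD; apply: cvg_norm; [exact: cR|exact: sR|exact: cR|exact: sR].
split; rewrite -(cvg_shiftS _ (nbhs (0 : R))).
  apply: (@squeeze_cvgr _ _ _ _ (cst 0) B) => //; last exact: cvg_cst.
  apply: nearW => n; rewrite cmod_ge0 /=; apply: (key (- n.+1%:Z) (-1)) => //.
    by move=> x; rewrite normrN ger0_norm// /expk intrN mulrN mulNr cosN sinN mulN1r.
  by rewrite normrN1.
apply: (@squeeze_cvgr _ _ _ _ (cst 0) B) => //; last exact: cvg_cst.
apply: nearW => n; rewrite cmod_ge0 /= /hat opprK; apply: (key n.+1%:Z 1) => //.
  by move=> x; rewrite ger0_norm// /expk mul1r.
by rewrite normr1.
Qed.

(** The inverse is discontinuous at zero, where it takes the value 0; the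
    regularisations used as approximants converge to it there too. *)
Lemma measurable_inv : measurable_fun [set: R] (fun x : R => x^-1).
Proof.
apply: (@measurable_fun_cvg _ _ _ _ (fun n (x : R) => x * (x ^+ 2 + n.+1%:R^-1)^-1)).
  move=> n; apply: continuous_measurable_fun => x.
  apply: cvgM; first exact: cvg_id.
  apply: cvgV; first by rewrite gt_eqF// ltr_wpDl ?sqr_ge0// invr_gt0.
  by apply: cvgD; [exact: exprn_continuous|exact: cvg_cst].
move=> x _; have [->|x0] := eqVneq x 0.
  by rewrite invr0; under eq_fun do rewrite mul0r; exact: cvg_cst.
rewrite (_ : x^-1 = x * (x ^+ 2 + 0)^-1); last first.
  by rewrite addr0 expr2 invfM mulrA divff// mul1r.
apply: cvgM; first exact: cvg_cst.
apply: cvgV; first by rewrite addr0 expf_neq0.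
by apply: cvgD; [exact: cvg_cst|exact: cvg_harmonic].
Qed.

Lemma le_cos x y : 0 <= x -> x <= y -> y <= pi -> cos y <= cos x.
Proof.
move=> x0 xy yp; rewrite leNgt ltr_cos -?leNgt// in_itv /=.
  by rewrite (le_trans x0 xy).
by rewrite x0 (le_trans xy yp).
Qed.

(** Keeps [expk 1 (x - x0) - 1] comparable to [x - x0] as long as [x - x0]
    stays away from the other zeros -1 and 1. *)
Lemma sin_lower y : `|y| <= 3 / 4 -> cos (pi / 4) * `|y| <= `|sin (pi * y)|.
Proof.
have p0 := pi_gt0 R; have p2 := pi_ge2 R.
have k0 : 0 <= cos (pi / 4 : R) by apply: cos_ge0_pihalf; apply/andP; split; lra.
have k1 : cos (pi / 4 : R) <= 1 by exact: cos_le1.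
wlog y0 : y / 0 <= y => [H|].
  have [/H//|y0 yM] := leP 0 y.
  have := H (- y); rewrite oppr_ge0 ltW// normrN => /(_ isT yM).
  by rewrite mulrN sinN normrN.
rewrite (ger0_norm y0) => y34.
have [y4|y4] := leP y (1 / 4).
  have [c /itvP cI E] : exists2 c, c \in `[0, y]%R &
      sin (pi * y) - sin (pi * 0) = (cos (pi * c) * pi) * (y - 0).
    apply: (@MVT_segment _ (fun t => sin (pi * t)) (fun t => cos (pi * t) * pi)) => //.
      move=> t _.
      exact: is_derive1_comp (is_derive_sin _) (is_derive_mulc pi t).
    by apply: continuous_subspaceT; exact: continuous_sin2pi.
  move: E; rewrite mulr0 sin0 !subr0 => ->.
  apply: le_trans (ler_norm _); rewrite ler_wpM2r//.
  have c0 : 0 <= c by rewrite cI.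
  have cy : c <= y by rewrite cI.
  have : cos (pi / 4) <= cos (pi * c).
    by apply: le_cos; nra.
  by move=> H; rewrite -[leLHS]mulr1 ler_pM//; lra.
apply: le_trans (ler_norm _).
have -> : sin (pi * y) = cos (`|pi * y - pi / 2|) by rewrite cos_norm cosBpihalf.
apply: (@le_trans _ _ (cos (pi / 4))); first by rewrite ler_piMr//; lra.
have H : `|pi * y - pi / 2| <= pi / 4 by rewrite ler_norml; apply/andP; split; nra.
by apply: le_cos => //; lra.
Qed.

Lemma cmod_expk1B1 y : cmodulus (expk 1 y - 1) = 2 * `|sin (pi * y)|.
Proof.
have -> : 2 = `|2 : R| by rewrite ger0_norm.
rewrite -normrM -sqrtr_sqr cmodE; congr Num.sqrt.
have E : 2 * pi * (1 : int)%:~R * y = (pi * y) *+ 2.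
  by rewrite /intmul /= mulr1 -mulrA mulr_natl.
have c2 := cos2sin2 (pi * y).
rewrite cReD cImD cReN cImN /= E cos_mulr2n sin_mulr2n oppr0 addr0.
move: c2; set c := cos _; set s := sin _ => c2.
rewrite (_ : (c ^+ 2 *+ 2 - 1 - 1) ^+ 2 + (c * s *+ 2) ^+ 2 =
  (c ^+ 2 * 2 - 2) ^+ 2 + 4 * c ^+ 2 * s ^+ 2); last by ring.
by rewrite c2; ring.
Qed.

(** As [h] is Lipschitz at [x0], the quotient [G] of [h - h x0] by [expk 1 (x
    - x0) - 1] is bounded. The relation between [h] and [G] makes the partial
    sums at [x0] telescope to a difference of two Fourier coefficients of [G],
    which vanish at infinity by the Riemann-Lebesgue lemma. The point [x0] is
    kept in the middle of the interval, so that it is the only zero of the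
    denominator there. *)
Lemma fourier_inversion h x0 (L : R) : cbm h -> 1 / 4 <= x0 <= 3 / 4 ->
  (forall x, I01 x -> cmodulus (h x - h x0) <= L * `|x - x0|) ->
  (fun n => cmodulus (zsum (fun k => hat h k * expk k x0) n - h x0))
    @ \oo --> (0 : R).
Proof.
move=> bh /andP[x04 x034] hL.
pose kap : R := cos (pi / 4).
have kap0 : 0 < kap.
  by have := pi_gt0 R; move=> ?; apply: cos_gt0_pihalf; apply/andP; split; lra.
pose e x : R[i] := expk 1 (x - x0) - 1.
have elow x : I01 x -> 2 * kap * `|x - x0| <= cmodulus (e x).
  move=> xI; have /andP[x0' x1'] : 0 <= x <= 1 by move: xI; rewrite /= in_itv.
  rewrite /e cmod_expk1B1 -mulrA ler_pM2l//; apply: sin_lower.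
  by rewrite ler_norml; apply/andP; split; lra.
pose G x := (h x - h x0) / e x.
have be : cbm e.
  apply: ccontinuous_cbm; apply: ccontinuousD; last exact: ccontinuous_cst.
  rewrite (_ : (fun x => _) = fun x => expk 1 x * expk 1 (- x0)).
    by apply: ccontinuousM; [exact: expk_continuous|exact: ccontinuous_cst].
  by apply/funext => x; rewrite -expkDx.
have bhx0 : cbm (fun x => h x - h x0) by apply: cbmD => //; exact: cbm_cst.
have GE x : I01 x -> h x - h x0 = G x * e x.
  move=> xI; rewrite /G; have [->|xx0] := eqVneq x x0.
    by rewrite subrr !mul0r.
  rewrite divfK//; apply/eqP => /(congr1 cmodulus); rewrite cmod0 => H.
  have := elow _ xI; rewrite H leNgt => /negP; apply.
  by rewrite !mulr_gt0// normr_gt0 subr_eq0.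
have L0 : 0 <= L.
  have I0 : I01 0 by rewrite /= in_itv /= lexx ler01.
  have := le_trans (cmod_ge0 _) (hL _ I0).
  by rewrite pmulr_lge0// normr_gt0 sub0r oppr_eq0 gt_eqF//; lra.
have Gb x : I01 x -> cmodulus (G x) <= L / (2 * kap).
  move=> xI; have [xx0|xx0] := eqVneq x x0.
    rewrite /G xx0 subrr mul0r cmod0 divr_ge0//.
    by rewrite mulr_ge0// ltW.
  rewrite /G cmodM cmodV ler_pdivrMr; last first.
    by apply: lt_le_trans (elow _ xI); rewrite !mulr_gt0// normr_gt0 subr_eq0.
  apply: le_trans (hL _ xI) _.
  rewrite -mulrA ler_wpM2l// mulrC ler_pdivlMr ?mulr_gt0//.
  by rewrite mulrC elow.
have bG : cbm G.
  have mRe : measurable_fun I01 (fun x => Re (h x - h x0)) by have [[]] := bhx0.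
  have mIm : measurable_fun I01 (fun x => Im (h x - h x0)) by have [_ []] := bhx0.
  have meR : measurable_fun I01 (fun x => Re (e x)) by have [[]] := be.
  have meI : measurable_fun I01 (fun x => Im (e x)) by have [_ []] := be.
  have minv : measurable_fun I01 (fun x => (Re (e x) ^+ 2 + Im (e x) ^+ 2)^-1).
    apply: (measurableT_comp measurable_inv).
    by apply: measurable_funD; exact: measurable_funX.
  have Vre (z : R[i]) : Re z^-1 = Re z * (Re z ^+ 2 + Im z ^+ 2)^-1.
    by case: z => a b.
  have Vim (z : R[i]) : Im z^-1 = - (Im z * (Re z ^+ 2 + Im z ^+ 2)^-1).
    by case: z.
  split; split.
  - rewrite (_ : (fun x => _) = (fun x => Re (h x - h x0) *
       (Re (e x) * (Re (e x) ^+ 2 + Im (e x) ^+ 2)^-1) +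
       Im (h x - h x0) * (Im (e x) * (Re (e x) ^+ 2 + Im (e x) ^+ 2)^-1))).
      by apply: measurable_funD; apply: measurable_funM => //; exact: measurable_funM.
    by apply/funext => x; rewrite /G cReM Vre Vim mulrN opprK.
  - exists (L / (2 * kap)) => x xI; apply: le_trans (Gb _ xI); exact: Re_le_cmod.
  - rewrite (_ : (fun x => _) = (fun x => Im (h x - h x0) *
       (Re (e x) * (Re (e x) ^+ 2 + Im (e x) ^+ 2)^-1) -
       Re (h x - h x0) * (Im (e x) * (Re (e x) ^+ 2 + Im (e x) ^+ 2)^-1))).
      by apply: measurable_funB; apply: measurable_funM => //; exact: measurable_funM.
    by apply/funext => x; rewrite /G cImM Vre Vim mulrN addrC.
  - exists (L / (2 * kap)) => x xI; apply: le_trans (Gb _ xI); exact: Im_le_cmod.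
(* The terms of the Fourier series at [x0] are the increments of [A], up to the
   term of frequency zero. *)
pose A k := expk k x0 * hat G k.
have bk k : cbm (fun x => expk (- k) x * G x) by apply: cbmM => //; exact: cbm_expk.
have hatE k : hat h k * expk k x0 = h x0 * (k == 0)%:R + (A (k - 1) - A k).
  have -> : hat h k = h x0 * (k == 0)%:R +
      (expk 1 (- x0) * hat G (k - 1) - hat G k).
    rewrite {1}/hat (@cint_eq _ _ (fun x => h x0 * expk (- k) x +
      (expk 1 (- x0) * (expk (- (k - 1)) x * G x) + (-1) * (expk (- k) x * G x)))).
      have bk1 := bk (k - 1).
      have b1 : cbm (fun x => expk 1 (- x0) * (expk (- (k - 1)) x * G x)).
        by apply: cbmM => //; exact: cbm_cst.
      have b2 : cbm (fun x => -1 * (expk (- k) x * G x)).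
        by apply: cbmM => //; exact: cbm_cst.
      have b0 : cbm (fun x => h x0 * expk (- k) x).
        by apply: cbmM; [exact: cbm_cst|exact: cbm_expk].
      rewrite cintD//; last exact: cbmD.
      rewrite cintZ ?cint_expk ?oppr_eq0; last exact: cbm_expk.
      by rewrite cintD// !cintZ// mulN1r.
    move=> x xI; rewrite -[in LHS](subrK (h x0) (h x)) (GE _ xI) /e.
    by rewrite opprB addrC (expkD 1 (- k)) (expkDx 1 x); ring.
  have K1 : expk 1 (- x0) * expk k x0 = expk (k - 1) x0.
    by rewrite -expkN -expkD addrC.
  rewrite /A -K1.
  by have [->|k0] := eqVneq k 0; rewrite ?expk0 ?mulr1 /=; ring.
have SE n : zsum (fun k => hat h k * expk k x0) n - h x0 = A (- n.+1%:Z) - A n.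
  rewrite (eq_zsum _ hatE) zsumD zsum_telescope zsumZ.
  rewrite (_ : zsum (fun k : int => (k == 0)%:R : R[i]) n = 1).
    by rewrite mulr1 addrC addKr.
  by rewrite /zsum big1 ?addr0// => i _; rewrite addr0.
have [rl1 rl2] := riemann_lebesgue bG.
have sq : (fun n : nat => cmodulus (hat G (- n.+1%:Z)) + cmodulus (hat G n))
   @ \oo --> (0 : R).
  rewrite -[0 : R]addr0; apply: cvgD => //.
  by rewrite (cvg_shiftS (fun n : nat => cmodulus (hat G (- n%:Z))) (nbhs (0 : R))).
apply: (squeeze_cvgr _ (cvg_cst 0) sq).
apply: nearW => n; rewrite cmod_ge0 /= SE.
apply: le_trans (cmodD _ _) _; rewrite cmodN.
by rewrite /A !cmodM !cmod_expk !mul1r.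
Qed.

End inversion.

(** * Smooth periodic functions *)

Section periodic.
Context {R : realType}.
Local Notation Re := complex.Re.
Local Notation Im := complex.Im.
Implicit Types (k l : int) (x y : R) (g h : R -> R[i]).

Lemma periodic_intz (T : Type) (u : R -> T) (n : int) x :
  (forall x, u (x + 1) = u x) -> u (x + n%:~R) = u x.
Proof.
move=> pu.
have pn (m : nat) y : u (y + m%:R) = u y.
  elim: m => [|m IH] in y *; first by rewrite addr0.
  by rewrite -natr1 addrA pu IH.
case: n => n; first exact: pn.
by rewrite NegzE intrN -[in RHS](subrK (n.+1%:~R) x) pn.
Qed.

Lemma periodic_reduce (T : Type) (u : R -> T) x :
  (forall x, u (x + 1) = u x) -> exists2 t : R, 0 <= t <= 1 & forall y, u (y + t) = u (y + x).
Proof.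
move=> pu; exists (x - (Num.floor x)%:~R).
  have := floor_itv x => /andP[a b].
  by rewrite subr_ge0 a lerBlDl -intrD1 ltW.
move=> y; rewrite -[RHS](periodic_intz (- Num.floor x) (y + x) pu).
by rewrite intrN addrA.
Qed.

Lemma continuous_translate (u : R -> R) t : continuous u ->
  continuous (fun x => u (x + t)).
Proof.
move=> cu x; apply: (@continuous_comp _ _ _ (fun y => y + t) u); last exact: cu.
by apply: cvgD; [exact: cvg_id|exact: cvg_cst].
Qed.

(** In terms of a primitive [U], the left-hand side is [U (1 + t) - U t],
    whose derivative in [t] vanishes by periodicity. *)
Lemma rint_translate (u : R -> R) t : continuous u ->
  (forall x, u (x + 1) = u x) -> rint (fun x => u (x + t)) = rint u.
Proof.
move=> cu pu.
have [s /andP[s0 s1] Es] := periodic_reduce t pu.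
transitivity (rint (fun x => u (x + s))).
  by congr rint; apply/funext => x; rewrite Es.
pose U x := \int[@lebesgue_measure R]_(y in `[-1, x]) u y.
have dU x : -1 < x -> is_derive x (1 : R) U (u x).
  move=> x1.
  have iu : (@lebesgue_measure R).-integrable `[-1, x + 1] (EFin \o u).
    by apply: continuous_compact_integrable;
      [exact: segment_compact|exact: continuous_subspaceT].
  have xx1 : x < x + 1 by rewrite ltrDl.
  have [d1 d2] := continuous_FTC1_closed xx1 iu x1 (cu x).
  by rewrite -d2 derive1E; exact: (@derivableP _ _ _ U x 1).
have WE (r : R) : 0 <= r -> rint (fun x => u (x + r)) = U (1 + r) - U r.
  move=> r0; have -> : U (1 + r) - U r = (fun x => U (x + r)) 1 - (fun x => U (x + r)) 0.
    by rewrite add0r.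
  apply: (@rint_derive _ (fun x => U (x + r))).
    move=> x /andP[x0 _].
    by apply: is_derive_shift; apply: dU; lra.
  by apply: continuous_subspaceT; exact: continuous_translate.
have u0 : (fun x => u (x + 0)) = u by apply/funext => x; rewrite addr0.
rewrite -[in RHS]u0 !WE//; apply/eqP; rewrite -subr_eq0; apply/eqP.
have dW (c : R) : 0 <= c -> is_derive c (1 : R) (fun r => U (1 + r) - U r) 0.
  move=> c0.
  have dl : is_derive c (1 : R) (fun y : R => 1 + y) 1.
    by apply: is_derive_eqR (is_derive_add (is_derive_cst (1 : R) c (1 : R))
        (is_derive_id c (1 : R))) _; rewrite add0r.
  apply: is_derive_eqR (is_derive_sub
     (@is_derive1_comp _ U _ _ _ _ (dU _ _) dl) (dU _ _)) _; try lra.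
  by rewrite mulr1 (addrC 1 c) pu subrr.
have [c _ ->] : exists2 c, c \in `[0, s]%R &
    (U (1 + s) - U s) - (U (1 + 0) - U 0) = 0 * (s - 0).
  apply: (@MVT_segment _ (fun r => U (1 + r) - U r) (fun=> 0) 0 s s0).
    by move=> c /itvP cs; apply: dW; rewrite cs.
  apply/continuous_in_subspaceT => c; rewrite inE /= in_itv /= => /andP[c0 _].
  apply: differentiable_continuous; apply/derivable1_diffP.
  by have [] := dW c c0.
by rewrite mul0r.
Qed.

Lemma cint_translate g t : ccontinuous g -> (forall x, g (x + 1) = g x) ->
  cintegral01 (fun x => g (x + t)) = cintegral01 g.
Proof.
move=> [c1 c2] pg; rewrite !cintE; congr (_ +i* _).
  by apply: (@rint_translate (fun x => Re (g x))) => // x; rewrite pg.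
by apply: (@rint_translate (fun x => Im (g x))) => // x; rewrite pg.
Qed.

Lemma hat_translate h k t : ccontinuous h -> (forall x, h (x + 1) = h x) ->
  hat (fun x => h (x + t)) k = expk k t * hat h k.
Proof.
move=> ch ph; rewrite /hat.
have cc : ccontinuous (fun x => expk (- k) x * h x).
  by apply: ccontinuousM => //; exact: expk_continuous.
rewrite -(@cint_translate _ t cc); last by move=> x; rewrite expk_periodic ph.
rewrite -cintZ; last first.
  apply: ccontinuous_cbm; case: cc => c1 c2; split.
    exact: (continuous_translate c1).
  exact: (continuous_translate c2).
congr cintegral01; apply/funext => x.
by rewrite expkDx -[LHS]mul1r -(expkKN k t); ring.
Qed.

Lemma periodic_bounded g : ccontinuous g -> (forall x, g (x + 1) = g x) ->
  exists2 C : R, 0 < C & forall x, cmodulus (g x) <= C.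
Proof.
move=> cg pg.
have [_ [C hC]] := bm_cmod (ccontinuous_cbm cg).
exists (`|C| + 1) => [|x]; first by rewrite ltr_wpDl.
have [t t01 E] := periodic_reduce x pg.
have := E 0; rewrite !add0r => <-.
have := hC t; rewrite /= in_itv /= => /(_ t01).
rewrite ger0_norm ?cmod_ge0// => /le_trans; apply.
by apply: le_trans (ler_norm _) _; rewrite lerDl.
Qed.

(** ** Smooth functions and their derivatives *)

(** The successive derivatives of [D 0], given as a sequence: linear
    combinations, translations and sums of series are then differentiated by
    exhibiting the sequence, without computing iterated derivatives. *)
Definition smooth_family (D : nat -> R -> R[i]) :=
  forall n, is_cderive (D n) (D n.+1).

Lemma csmooth_family g : csmooth g -> smooth_family (fun n => cderiven n g).
Proof.
move=> sg n x; have [a b] := sg n x; split.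
  by have := derivableP a; rewrite -derive1E -derive1nS.
by have := derivableP b; rewrite -derive1E -derive1nS.
Qed.

Lemma cderiven0 g : cderiven 0 g = g.
Proof. by apply/funext => x; rewrite /cderiven /=; case: (g x). Qed.

Lemma smooth_family_csmooth D : smooth_family D ->
  csmooth (D 0) /\ forall n, cderiven n (D 0) = D n.
Proof.
move=> sD.
have E1 n : derive1n n (fun y => Re (D 0 y)) = fun y => Re (D n y).
  elim: n => [//|n IH]; rewrite derive1nS IH; apply/funext => x.
  by rewrite derive1E; have [H _] := sD n x; apply: derive_val.
have E2 n : derive1n n (fun y => Im (D 0 y)) = fun y => Im (D n y).
  elim: n => [//|n IH]; rewrite derive1nS IH; apply/funext => x.
  by rewrite derive1E; have [_ H] := sD n x; apply: derive_val.
split.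
  move=> n x; rewrite E1 E2; have [[a _] [b _]] := sD n x.
  by split.
move=> n; apply/funext => x; rewrite /cderiven E1 E2.
by case: (D n x).
Qed.

Lemma cderiven_periodic g n x : test_function g ->
  cderiven n g (x + 1) = cderiven n g x.
Proof.
move=> [sg pg].
pose D m y := cderiven m g (y + 1).
have sD : smooth_family D by move=> m; exact: is_cderive_shift (csmooth_family sg m).
have D0 : D 0 = g by apply/funext => y; rewrite /D cderiven0 pg.
have [_ /(_ n)] := smooth_family_csmooth sD.
by rewrite D0 => /(congr1 (fun f => f x)).
Qed.

Lemma test_continuous g n : test_function g -> ccontinuous (cderiven n g).
Proof. by move=> [sg _]; exact: is_cderive_continuous (csmooth_family sg n). Qed.

Lemma test_bounded g n : test_function g ->
  exists2 C : R, 0 < C & forall x, cmodulus (cderiven n g x) <= C.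
Proof.
move=> tg; apply: periodic_bounded; first exact: test_continuous.
by move=> x; exact: cderiven_periodic.
Qed.

Lemma test_bounded_upto g N : test_function g ->
  exists2 C : R, 0 < C &
    forall n x, (n <= N)%N -> cmodulus (cderiven n g x) <= C.
Proof.
move=> tg; elim: N => [|N [C C0 hC]].
  have [C C0 hC] := test_bounded 0 tg.
  by exists C => // n x; rewrite leqn0 => /eqP ->.
have [D D0 hD] := test_bounded N.+1 tg.
exists (C + D) => [|n x]; first exact: addr_gt0.
rewrite leq_eqVlt => /predU1P[->|nN].
  by apply: le_trans (hD x) _; rewrite lerDr ltW.
by apply: le_trans (hC n x nN) _; rewrite lerDl ltW.
Qed.

Lemma test_family D : smooth_family D -> (forall x, D 0%N (x + 1) = D 0%N x) ->
  test_function (D 0).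
Proof. by move=> sD pD; split => //; have [] := smooth_family_csmooth sD. Qed.

Lemma expk_family k :
  smooth_family (fun n x => freq k ^+ n * expk k x : R[i]).
Proof.
move=> n; have := is_cderiveZ (freq k ^+ n) (expk_cderive (R := R) k).
by under [X in is_cderive _ X]eq_fun do rewrite mulrA -exprSr.
Qed.

Lemma test_expk k : test_function (@expk R k).
Proof.
have -> : @expk R k = fun x => freq k ^+ 0 * expk k x.
  by apply/funext => x; rewrite expr0 mul1r.
by apply: (test_family (expk_family k)) => x; rewrite expk_periodic.
Qed.

Lemma cderiven_expk k n : cderiven n (@expk R k) = fun x => freq k ^+ n * expk k x.
Proof.
have [_ /(_ n) /= <-] := smooth_family_csmooth (expk_family k).
by congr cderiven; apply/funext => x; rewrite expr0 mul1r.
Qed.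

Lemma smooth_familyD D E (c : R[i]) : smooth_family D -> smooth_family E ->
  smooth_family (fun n x => c * D n x + E n x).
Proof. by move=> sD sE n; apply: is_cderiveD => //; exact: is_cderiveZ. Qed.

Lemma lin_cderiven g h (c : R[i]) : test_function g -> test_function h ->
  test_function (fun x => c * g x + h x) /\
  forall n, cderiven n (fun x => c * g x + h x) =
            fun x => c * cderiven n g x + cderiven n h x.
Proof.
move=> tg th.
have sD := smooth_familyD c (csmooth_family tg.1) (csmooth_family th.1).
have E : (fun x => c * g x + h x) =
         (fun x => c * cderiven 0 g x + cderiven 0 h x) by rewrite !cderiven0.
split; last by move=> n; rewrite E; have [_ ->] := smooth_family_csmooth sD.
rewrite E; apply: (test_family sD) => x.
by rewrite !cderiven0 tg.2 th.2.
Qed.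

Lemma test0 : test_function (fun=> 0 : R[i]).
Proof.
have sD : smooth_family (fun _ _ => 0) by move=> n; exact: is_cderive_cst.
exact: (test_family sD).
Qed.

Lemma cderiven_0 n : cderiven n (fun=> 0 : R[i]) = fun=> 0.
Proof.
have sD : smooth_family (fun _ _ => 0) by move=> m; exact: is_cderive_cst.
by have [_ ->] := smooth_family_csmooth sD.
Qed.

Lemma test_zsum (c : int -> R[i]) n : let S := fun x => zsum (fun k => c k * expk k x) n in
  test_function S /\
  forall m, cderiven m S = fun x => zsum (fun k => c k * (freq k ^+ m * expk k x)) n.
Proof.
elim: n => [|n [IH1 IH2]] /=.
  have [a b] := lin_cderiven (c 0) (test_expk 0) test0.
  have E : (fun x => zsum (fun k => c k * expk k x) 0) = fun x => c 0 * expk 0 x + 0.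
    by apply/funext => x; rewrite zsum0 addr0.
  rewrite E; split=> // m; rewrite b cderiven_expk cderiven_0.
  by apply/funext => x; rewrite zsum0 addr0.
have [a1 b1] := lin_cderiven (c n.+1%:Z) (test_expk n.+1%:Z) IH1.
have [a2 b2] := lin_cderiven (c (- n.+1%:Z)) (test_expk (- n.+1%:Z)) a1.
have E : (fun x => zsum (fun k => c k * expk k x) n.+1) =
  fun x => c (- n.+1%:Z) * expk (- n.+1%:Z) x +
    (c n.+1%:Z * expk n.+1%:Z x + zsum (fun k => c k * expk k x) n).
  by apply/funext => x; rewrite zsumS; ring.
rewrite E; split=> // m; rewrite b2 b1 IH2 !cderiven_expk.
by apply/funext => x; rewrite zsumS; ring.
Qed.

Lemma hat_family D n k : smooth_family D -> (forall n, D n 1 = D n 0) ->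
  hat (D n) k = freq k ^+ n * hat (D 0) k.
Proof.
move=> sD pD; elim: n => [|n IH]; first by rewrite expr0 mul1r.
rewrite (hat_derive k (sD n)) ?pD//; first by rewrite IH mulrA exprS.
exact: is_cderive_continuous (sD n.+1).
Qed.

Lemma cderiven_10 h n : test_function h -> cderiven n h 1 = cderiven n h 0.
Proof. by move=> th; rewrite -[X in cderiven _ _ X]add0r cderiven_periodic. Qed.

Lemma hat_cderiven h n k : test_function h ->
  hat (cderiven n h) k = freq k ^+ n * hat h k.
Proof.
move=> th; have := hat_family n k (csmooth_family th.1) (fun m => cderiven_10 m th).
by rewrite cderiven0.
Qed.

End periodic.

(** * Absolutely convergent Fourier series *)

Section series.
Context {R : realType}.
Local Notation Re := complex.Re.
Local Notation Im := complex.Im.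
Implicit Types (k l : int) (x y : R) (g h : R -> R[i]) (F G : int -> R[i]).

(** A size of the frequency that does not vanish at zero, so that decay can be
    expressed by negative powers. *)
Definition zabs k : R := 1 + `|k%:~R|.

Lemma zabs_ge1 k : 1 <= zabs k.
Proof. by rewrite lerDl. Qed.

Lemma zabs_gt0 k : 0 < zabs k.
Proof. exact: lt_le_trans (zabs_ge1 k). Qed.

Lemma zabsN k : zabs (- k) = zabs k.
Proof. by rewrite /zabs intrN normrN. Qed.

Lemma zabs_nat (n : nat) : zabs n = n.+1%:R.
Proof. by rewrite /zabs ger0_norm ?ler0z// -natr1 addrC. Qed.

Definition zlim F : R[i] := clim (zsum F).

Lemma cvg_divn (K : R) : (fun n : nat => K / n.+1%:R) @ \oo --> (0 : R).
Proof. by rewrite -(mulr0 K); apply: cvgM; [exact: cvg_cst|exact: cvg_harmonic]. Qed.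

Lemma clim_eq (u : nat -> R[i]) (L : R[i]) (K : R) :
  (forall n, cmodulus (u n - L) <= K / n.+1%:R) -> clim u = L.
Proof.
move=> uL.
have K0 := cvg_divn K.
have cv (v : nat -> R) (l : R) : (forall n, `|v n - l| <= K / n.+1%:R) ->
    lim (v @ \oo) = l.
  move=> vl; apply: cvg_lim => //; apply/cvgrPdistC_le => e e0; near=> n.
  apply: le_trans (vl n) _; apply: le_trans (ler_norm _) _.
  by near: n; apply: (cvgr0Pnorm_le _).1.
case: L uL => a b uL; rewrite /clim; congr (_ +i* _); apply: cv => n.
  by have := le_trans (Re_le_cmod _) (uL n); rewrite cReD cReN.
by have := le_trans (Im_le_cmod _) (uL n); rewrite cImD cImN.
Unshelve. all: by end_near. Qed.

(** Domination by the increments of the convergent sequence [K / n.+1] gives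
    convergence together with a rate. *)
Lemma telescoping_tail (u : nat -> R) (K : R) : 0 <= K ->
  (forall i, `|u i| <= K / i.+1%:R - K / i.+2%:R) ->
  exists l : R, forall n, `|\sum_(i < n) u i - l| <= K / n.+1%:R.
Proof.
move=> K0 hu.
have tail n m : `|\sum_(i < n + m) u i - \sum_(i < n) u i| <=
    K / n.+1%:R - K / (n + m).+1%:R.
  elim: m => [|m IH]; first by rewrite addn0 !subrr normr0.
  rewrite addnS big_ord_recr /= addrAC; apply: le_trans (ler_normD _ _) _.
  by have := lerD IH (hu (n + m)%N); rewrite [X in _ <= X]addrA subrK.
have tailW n m : (n <= m)%N -> `|\sum_(i < m) u i - \sum_(i < n) u i| <= K / n.+1%:R.
  move=> nm; have := tail n (m - n)%N; rewrite subnKC// => /le_trans; apply.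
  by rewrite gerBl divr_ge0.
have KC := cvg_divn K.
have cu : cvgn (fun n => \sum_(i < n) u i).
  apply/cauchy_cvgP/cauchy_ballP => e e0.
  near \oo => N.
  exists ([set x | exists2 n, (N <= n)%N & x = \sum_(i < n) u i],
     [set x | exists2 n, (N <= n)%N & x = \sum_(i < n) u i]).
    by split; exists N => // n Nn; exists n.
  move=> [x y] [/= [n Nn ->] [m Nm ->]]; rewrite /ball /=.
  have H1 := tailW _ _ Nn; have H2 := tailW _ _ Nm.
  have H3 : `|K / N.+1%:R| < e / 2.
    by near: N; apply: (cvgr0Pnorm_lt _).1 => //; rewrite divr_gt0.
  have H4 := le_lt_trans (ler_norm _) H3.
  have H5 : e / 2 + e / 2 = e by field.
  rewrite -(subrKA (\sum_(i < N) u i)); apply: le_lt_trans (ler_normD _ _) _.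
  rewrite (distrC (\sum_(i < N) u i)) -H5.
  by apply: ltr_leD; [exact: le_lt_trans H1 H4|exact: le_trans H2 (ltW H4)].
exists (limn (fun n => \sum_(i < n) u i)) => n.
rewrite distrC.
have cn : (fun m => `|\sum_(i < m) u i - \sum_(i < n) u i|) @ \oo -->
   `|limn (fun n => \sum_(i < n) u i) - \sum_(i < n) u i|.
  by apply: cvg_norm; apply: cvgB => //; exact: cvg_cst.
apply: (cvgr_to_le cn) => /=.
by near=> m; apply: tailW; near: m; exact: nbhs_infty_ge.
Unshelve. all: by end_near. Qed.

(** One fixed summable majorant is enough here, since all the series met have
    rapidly decreasing terms; it gives explicit remainders. *)
Definition summableZ F := exists2 K : R, 0 <= K &
  forall k, cmodulus (F k) <= K / zabs k ^+ 2.

(** The majorant telescopes: [1 / (i + 2) ^ 2] is at most [1 / (i + 1) - 1 /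
    (i + 2)]. *)
Lemma zlimP F (K : R) : 0 <= K -> (forall k, cmodulus (F k) <= K / zabs k ^+ 2) ->
  forall n, cmodulus (zsum F n - zlim F) <= 4 * K / n.+1%:R.
Proof.
move=> K0 hF.
pose c i := F i.+1%:Z + F (- i.+1%:Z).
have hc i : cmodulus (c i) <= 2 * K / i.+1%:R - 2 * K / i.+2%:R.
  apply: le_trans (cmodD _ _) _.
  apply: (@le_trans _ _ (2 * K / i.+2%:R ^+ 2)).
    have := lerD (hF i.+1%:Z) (hF (- i.+1%:Z)); rewrite zabsN zabs_nat.
    by move=> /le_trans; apply; rewrite mulr2n !mulrDl !mul1r.
  have a0 : 0 < i.+1%:R :> R by [].
  have b0 : 0 < i.+2%:R :> R by [].
  have E : i.+2%:R = i.+1%:R + 1 :> R by rewrite natr1.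
  move: a0 b0; rewrite E; set a := i.+1%:R => a0 b0.
  rewrite -subr_ge0 (_ : _ - _ = 2 * K / (a * (a + 1) ^+ 2)).
    by rewrite divr_ge0 ?mulr_ge0// ?exprn_ge0// ltW.
  by field; rewrite !gt_eqF.
have K2 : 0 <= 2 * K by rewrite mulr_ge0.
have [lr hlr] := @telescoping_tail (fun i => Re (c i)) _ K2
  (fun i => le_trans (Re_le_cmod _) (hc i)).
have [li hli] := @telescoping_tail (fun i => Im (c i)) _ K2
  (fun i => le_trans (Im_le_cmod _) (hc i)).
pose L := F 0 + (lr +i* li).
have H n : cmodulus (zsum F n - L) <= 4 * K / n.+1%:R.
  have -> : zsum F n - L = \sum_(i < n) c i - (lr +i* li).
    by rewrite /zsum /L -/c opprD addrACA subrr add0r.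
  apply: le_trans (cmod_le_ReIm _) _.
  rewrite cReD cImD cReN cImN cRe_sum cIm_sum /=.
  apply: le_trans (lerD (hlr n) (hli n)) _.
  by rewrite -mulrDl -mulrDl (_ : 2 + 2 = 4 :> R)//; ring.
by have := H; rewrite -(clim_eq H).
Qed.

Lemma zlim_le F (K : R) : 0 <= K -> (forall k, cmodulus (F k) <= K / zabs k ^+ 2) ->
  cmodulus (zlim F) <= 5 * K.
Proof.
move=> K0 hF; have := zlimP K0 hF 0; rewrite zsum0 divr1 => H.
have := hF 0; rewrite /zabs normr0 addr0 expr1n divr1 => H0.
by have := cmod_triB (zlim F) (F 0); rewrite cmodBC; lra.
Qed.

Lemma zlim_eq F (L : R[i]) (K : R) :
  (forall n, cmodulus (zsum F n - L) <= K / n.+1%:R) -> zlim F = L.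
Proof. exact: clim_eq. Qed.

Lemma zlim_lin F G (c : R[i]) : summableZ F -> summableZ G ->
  zlim (fun k => c * F k + G k) = c * zlim F + zlim G.
Proof.
move=> [K K0 hF] [K' K'0 hG].
apply: (@zlim_eq _ _ (cmodulus c * (4 * K) + 4 * K')) => n.
rewrite zsumD zsumZ.
rewrite (_ : _ - _ = c * (zsum F n - zlim F) + (zsum G n - zlim G)); last by ring.
apply: le_trans (cmodD _ _) _; rewrite cmodM mulrDl; apply: lerD.
  by rewrite -mulrA ler_wpM2l ?cmod_ge0// zlimP.
exact: zlimP.
Qed.

Lemma zsum_opp (V : zmodType) (F' : int -> V) n :
  zsum (fun k => F' (- k)) n = zsum F' n.
Proof.
by rewrite /zsum oppr0; congr (_ + _); apply: eq_bigr => i _; rewrite opprK addrC.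
Qed.

Lemma zlim_opp F : zlim (fun k => F (- k)) = zlim F.
Proof. by rewrite /zlim; congr clim; apply/funext => n; exact: zsum_opp. Qed.

Lemma summableZ_lin F G (c : R[i]) : summableZ F -> summableZ G ->
  summableZ (fun k => c * F k + G k).
Proof.
move=> [K K0 hF] [K' K'0 hG]; exists (cmodulus c * K + K') => [|k].
  by rewrite addr_ge0// mulr_ge0 ?cmod_ge0.
apply: le_trans (cmodD _ _) _; rewrite cmodM mulrDl -mulrA.
by apply: lerD => //; rewrite ler_wpM2l ?cmod_ge0.
Qed.

Lemma zsum_delta_out (V : zmodType) l (c : V) n : (n < absz l)%N ->
  zsum (fun k => if k == l then c else 0) n = 0.
Proof.
move=> nl; rewrite /zsum ifN; last by apply/eqP; lia.
rewrite add0r big1// => i _.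
by rewrite !ifN ?addr0//; apply/eqP; have := ltn_ord i; lia.
Qed.

Lemma zsum_delta (V : zmodType) l (c : V) n : (absz l <= n)%N ->
  zsum (fun k => if k == l then c else 0) n = c.
Proof.
elim: n => [|n IH] nl.
  by rewrite zsum0 ifT//; apply/eqP; lia.
rewrite zsumS; move: nl; rewrite leq_eqVlt => /predU1P[ln|nl]; last first.
  by rewrite IH// !ifN ?addr0//; apply/eqP; lia.
rewrite zsum_delta_out ?ln// add0r; have [E|E] := eqVneq n.+1%:Z l.
  by rewrite ifN ?addr0//; apply/eqP; lia.
by rewrite ifT ?add0r//; apply/eqP; lia.
Qed.

Lemma zlim_delta l (c : R[i]) : zlim (fun k => if k == l then c else 0) = c.
Proof.
apply: (@zlim_eq _ _ (cmodulus c * (absz l).+1%:R)) => n.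
have [nl|nl] := leqP (absz l) n.
  by rewrite zsum_delta// subrr cmod0 divr_ge0// mulr_ge0 ?cmod_ge0.
rewrite zsum_delta_out// sub0r cmodN.
by rewrite -mulrA ler_peMr ?cmod_ge0// ler_pdivlMr// mul1r ler_nat ltnS ltnW.
Qed.

(** ** Termwise differentiation *)

Lemma MVT_bound (u v : R -> R) (B th : R) :
  (forall x : R, is_derive x (1 : R) u (v x)) ->
  (forall x, `|x| <= `|th| -> `|v x| <= B) -> `|u th - u 0| <= B * `|th|.
Proof.
move=> uv vB; have cu := is_derive_continuous uv.
have [th0|th0] := leP 0 th.
  have [c /itvP cI ->] := @MVT_segment _ u v 0 th th0 (fun x _ => uv x)
     (continuous_subspaceT cu).
  rewrite subr0 normrM ler_wpM2r// vB// !ger0_norm ?cI//.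
have [c /itvP cI E] := @MVT_segment _ u v th 0 (ltW th0) (fun x _ => uv x)
     (continuous_subspaceT cu).
rewrite distrC E sub0r normrM normrN ler_wpM2r// vB//.
by rewrite (ltr0_norm th0) ler0_norm ?lerN2 ?cI.
Qed.

Lemma sin_le (th : R) : `|sin th| <= `|th|.
Proof.
have := @MVT_bound sin cos 1 th (fun x => is_derive_sin x) (fun x _ => cos_max x).
by rewrite sin0 subr0 mul1r.
Qed.

Lemma cos1_le (th : R) : `|cos th - 1| <= `|th|.
Proof.
have := @MVT_bound cos (fun x => - sin x) 1 th (fun x => is_derive_cos x).
by rewrite cos0 mul1r; apply => x _; rewrite normrN sin_max.
Qed.

Lemma cos1_quad (th : R) : `|cos th - 1| <= th ^+ 2.
Proof.
have := @MVT_bound cos (fun x => - sin x) `|th| th (fun x => is_derive_cos x).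
rewrite cos0 -expr2 real_normK ?num_real//; apply=> x xt.
by rewrite normrN (le_trans (sin_le x)).
Qed.

Lemma sin_quad (th : R) : `|sin th - th| <= th ^+ 2.
Proof.
have d (x : R) : is_derive x (1 : R) (fun y => sin y - y) (cos x - 1).
  exact: is_derive_sub (is_derive_sin x) (is_derive_id x (1 : R)).
have := MVT_bound d (B := `|th|) (th := th).
rewrite sin0 !subr0 -expr2 real_normK ?num_real//; apply=> x xt.
by rewrite (le_trans (cos1_le x)).
Qed.

(** Second-order Taylor estimate of a character. Being explicit in the
    frequency it can be summed over all frequencies, which is how series are
    differentiated term by term. *)
Lemma expk_quad k (x t : R) :
  cmodulus (expk k (x + t) - expk k x - t%:C * (freq k * expk k x)) <=
  2 * cmodulus (freq k) ^+ 2 * t ^+ 2.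
Proof.
rewrite (_ : _ - _ = expk k x * (expk k t - 1 - t%:C * freq k)); last first.
  by rewrite expkDx; ring.
rewrite cmodM cmod_expk mul1r cmod_freq; apply: le_trans (cmod_le_ReIm _) _.
rewrite !(cReD, cImD, cReN, cImN, cReM, cImM) /=.
have := cos1_quad (2 * pi * k%:~R * t); have := sin_quad (2 * pi * k%:~R * t).
rewrite !mul0r !mulr0 !subr0 !addr0.
rewrite [t * _]mulrC => h1 h2; apply: le_trans (lerD h2 h1) _.
by rewrite !exprMn real_normK ?num_real//; apply: le_of_eq; ring.
Qed.

Lemma is_derive_quad (u : R -> R) (x d M : R) :
  (forall t, `|u (x + t) - u x - t * d| <= M * t ^+ 2) ->
  is_derive x (1 : R) u d.
Proof.
move=> H.
have M0 : 0 <= M.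
  by have := le_trans (normr_ge0 _) (H 1); rewrite expr1n mulr1.
have cv : (fun h : R => h^-1 *: (u (h *: (1 : R) + x) - u x)) @ 0^' --> d.
  apply/cvgrPdistC_le => e e0; near=> t.
  have t0 : t != 0 by near: t; exact: nbhs_dnbhs_neq.
  rewrite /GRing.scale /= mulr1 (addrC t).
  have -> : t^-1 * (u (x + t) - u x) - d = t^-1 * (u (x + t) - u x - t * d).
    by field.
  rewrite normrM normfV ler_pdivrMl ?normr_gt0//.
  apply: le_trans (H t) _; rewrite -(real_normK (num_real t)) expr2 mulrA.
  rewrite mulrC ler_wpM2l//.
  apply: (@le_trans _ _ ((M + 1) * `|t|)).
    by rewrite ler_wpM2r// lerDl.
  rewrite mulrC -ler_pdivlMr; last by rewrite ltr_wpDl.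
  near: t; apply: dnbhs0_le; rewrite divr_gt0// ltr_wpDl//.
split; first by apply/cvg_ex; exists d.
by apply: cvg_lim.
Unshelve. all: by end_near. Qed.

Lemma is_cderive_quad g (h : R -> R[i]) :
  (forall x, exists M, forall t, cmodulus (g (x + t) - g x - t%:C * h x) <= M * t ^+ 2) ->
  is_cderive g h.
Proof.
move=> H x; have [M hM] := H x.
split; apply: (@is_derive_quad _ _ _ M) => t.
  have := le_trans (Re_le_cmod _) (hM t).
  by rewrite !(cReD, cReN, cReM) /= mul0r subr0.
have := le_trans (Im_le_cmod _) (hM t).
by rewrite !(cImD, cImN, cImM) /= mul0r addr0.
Qed.

Lemma cmod_freq_le k : cmodulus (freq k) <= 2 * pi * zabs k :> R.
Proof.
by rewrite cmod_freq ler_wpM2l ?mulr_ge0 ?pi_ge0// lerDr.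
Qed.

Definition rapid (a : int -> R[i]) :=
  forall m : nat, exists2 K : R, 0 <= K & forall k, cmodulus (a k) <= K / zabs k ^+ m.

Lemma rapid_freq a m : rapid a -> rapid (fun k => a k * freq k ^+ m).
Proof.
move=> ra n; have [K K0 hK] := ra (n + m)%N.
exists (K * (2 * pi) ^+ m) => [|k].
  by rewrite mulr_ge0// exprn_ge0// mulr_ge0 ?pi_ge0.
rewrite cmodM cmodX.
have h1 : cmodulus (freq k) ^+ m <= (2 * pi * zabs k) ^+ m.
  by rewrite lerXn2r ?nnegrE ?cmod_ge0 ?cmod_freq_le// !mulr_ge0 ?pi_ge0// ltW// zabs_gt0.
apply: le_trans (ler_pM (cmod_ge0 _) (exprn_ge0 _ (cmod_ge0 _)) (hK k) h1) _.
rewrite exprMn exprD; apply: le_of_eq.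
by field; rewrite !expf_neq0// gt_eqF// zabs_gt0.
Qed.

Lemma rapid_summable a x : rapid a -> summableZ (fun k => a k * expk k x).
Proof.
by move=> ra; have [K K0 hK] := ra 2%N; exists K => // k; rewrite cmodM cmod_expk mulr1.
Qed.

(** The quadratic Taylor remainders of the characters are summed against the
    coefficients; the factor [freq k ^+ m.+2] is absorbed by the rapid
    decrease. *)
Lemma rapid_family a : rapid a ->
  smooth_family (fun m x => zlim (fun k => a k * freq k ^+ m * expk k x)).
Proof.
move=> ra m; apply: is_cderive_quad => x.
have rm := rapid_freq m ra; have rm1 := rapid_freq m.+1 ra.
have [K K0 hK] := rapid_freq m.+2 ra 2%N.
exists (5 * (2 * K)) => t.
have -> : zlim (fun k => a k * freq k ^+ m * expk k (x + t)) -
    zlim (fun k => a k * freq k ^+ m * expk k x) -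
    t%:C * zlim (fun k => a k * freq k ^+ m.+1 * expk k x) =
    zlim (fun k => a k * freq k ^+ m * (expk k (x + t) - expk k x - t%:C * (freq k * expk k x))).
  have s1 := rapid_summable x rm; have s2 := rapid_summable (x + t) rm.
  have s3 := rapid_summable x rm1.
  have s4 := summableZ_lin (-1) s1 s2.
  have := zlim_lin (- t%:C) s3 s4; rewrite (zlim_lin (-1) s1 s2) => E.
  transitivity (- t%:C * zlim (fun k => a k * freq k ^+ m.+1 * expk k x) +
     (-1 * zlim (fun k => a k * freq k ^+ m * expk k x) +
     zlim (fun k => a k * freq k ^+ m * expk k (x + t)))); first by ring.
  rewrite -E; congr zlim; apply/funext => k.
  by rewrite exprS; ring.
rewrite -mulrA; apply: zlim_le => [|k].
  by apply: mulr_ge0; [exact: mulr_ge0|exact: sqr_ge0].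
rewrite cmodM; apply: le_trans (ler_wpM2l (cmod_ge0 _) (expk_quad k x t)) _.
have H := hK k; rewrite cmodM (cmodX _ m.+2) in H.
rewrite (_ : _ * (_ * _) = cmodulus (a k) * cmodulus (freq k) ^+ m.+2 * (2 * t ^+ 2)).
  rewrite (_ : _ / _ = K / zabs k ^+ 2 * (2 * t ^+ 2)); last by ring.
  by apply: ler_wpM2r => //; apply: mulr_ge0 => //; exact: sqr_ge0.
rewrite (_ : _ ^+ m.+2 = cmodulus (freq k) ^+ m * cmodulus (freq k) ^+ 2).
  by rewrite cmodM cmodX; ring.
by rewrite -exprD addn2.
Qed.

Lemma rapid_test a : rapid a ->
  test_function (fun x => zlim (fun k => a k * expk k x)).
Proof.
move=> ra; have := rapid_family ra => sf.
have -> : (fun x => zlim (fun k => a k * expk k x)) =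
   fun x => zlim (fun k => a k * freq k ^+ 0 * expk k x).
  apply/funext => x; congr zlim; apply/funext => k.
  by rewrite expr0 mulr1.
apply: (test_family sf) => x; congr zlim; apply/funext => k.
by rewrite expk_periodic.
Qed.

End series.

(** * Distributions through their Fourier coefficients *)

Section distributions.
Context {R : realType}.
Local Notation Re := complex.Re.
Local Notation Im := complex.Im.
Implicit Types (k l : int) (x y : R) (g h : R -> R[i]) (F G : int -> R[i]).
Implicit Types (f : (R -> R[i]) -> R[i]).

Lemma test_cbm h : test_function h -> cbm h.
Proof.
by move=> th; rewrite -[h]cderiven0; apply: ccontinuous_cbm; exact: test_continuous.
Qed.

(** [M] integrations by parts. The constant [2 ^+ M] converts [freq k], which
    vanishes at zero, into [zabs k]. *)
Lemma hat_decay_family D M (B : R) k : smooth_family D ->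
  (forall n, D n 1 = D n 0) ->
  (forall n x, (n <= M)%N -> cmodulus (D n x) <= B) ->
  cmodulus (hat (D 0%N) k) <= 2 ^+ M * (2 * B) / zabs k ^+ M.
Proof.
move=> sD pD hB.
have B0 : 0 <= B by apply: le_trans (hB 0%N 0 _); rewrite ?cmod_ge0.
have bc n : cbm (D n) by exact/ccontinuous_cbm/(is_cderive_continuous (sD n)).
have H n : (n <= M)%N -> cmodulus (freq k) ^+ n * cmodulus (hat (D 0%N) k) <= 2 * B.
  move=> nM; rewrite -cmodX -cmodM -hat_family//.
  by apply: hat_bound => // x; exact: hB.
have z0 : 0 < zabs k ^+ M :> R by rewrite exprn_gt0// zabs_gt0.
rewrite ler_pdivlMr//.
have [k0|k0] := eqVneq k 0.
  have := H 0%N (leq0n _).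
  rewrite expr0 mul1r (_ : zabs k = 1) ?expr1n ?mulr1; last first.
    by rewrite /zabs k0 normr0 addr0.
  move=> /le_trans; apply; rewrite ler_peMl ?mulr_ge0//.
  by rewrite exprn_ege1// ler1n.
have k1 : 1 <= `|k%:~R : R|.
  by rewrite -intr_norm ler1z; move: k0; lia.
have zf : zabs k <= 2 * cmodulus (freq k) :> R.
  rewrite cmod_freq /zabs; have := pi_ge2 R; move: k1.
  by set a := `|_|; nra.
apply: (@le_trans _ _ (cmodulus (hat (D 0%N) k) * (2 * cmodulus (freq k)) ^+ M)).
  rewrite ler_wpM2l ?cmod_ge0//.
  by rewrite lerXn2r ?nnegrE ?mulr_ge0 ?cmod_ge0// ltW// zabs_gt0.
rewrite exprMn mulrCA ler_wpM2l ?exprn_ge0//.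
by rewrite mulrC H.
Qed.

Lemma hat_decay h M (B : R) k : test_function h ->
  (forall n x, (n <= M)%N -> cmodulus (cderiven n h x) <= B) ->
  cmodulus (hat h k) <= 2 ^+ M * (2 * B) / zabs k ^+ M.
Proof.
move=> th hB.
have := hat_decay_family k (csmooth_family th.1) (fun n => cderiven_10 n th) hB.
by rewrite cderiven0.
Qed.

Lemma rapid_hat h : test_function h -> rapid (hat h).
Proof.
move=> th m; have [B B0 hB] := test_bounded_upto m th.
exists (2 ^+ m * (2 * B)) => [|k].
  by rewrite !mulr_ge0 ?exprn_ge0// ltW.
by apply: hat_decay => // n x nm; exact: hB.
Qed.

Lemma cvg0_eq (c : R[i]) (u : nat -> R) : u @ \oo --> (0 : R) ->
  (forall n, cmodulus c <= u n) -> c = 0.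
Proof.
move=> u0 cu; apply: cmod_eq0; apply/eqP; rewrite eq_le cmod_ge0 andbT.
by apply: (cvgr_to_ge u0); apply: nearW.
Qed.

Lemma family_lip D (L : R) y z : smooth_family D ->
  (forall x, cmodulus (D 1%N x) <= L) ->
  cmodulus (D 0%N y - D 0%N z) <= 2 * L * `|y - z|.
Proof.
move=> sD hL.
have sh := is_cderive_shift z (sD 0%N).
have b1 := @MVT_bound _ _ _ L (y - z) (fun t => (sh t).1)
  (fun t _ => le_trans (Re_le_cmod _) (hL _)).
have b2 := @MVT_bound _ _ _ L (y - z) (fun t => (sh t).2)
  (fun t _ => le_trans (Im_le_cmod _) (hL _)).
move: b1 b2; rewrite /= subrK add0r => b1 b2.
apply: le_trans (cmod_le_ReIm _) _; rewrite cReD cImD cReN cImN.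
by apply: le_trans (lerD b1 b2) _; rewrite -mulrA mulr2n mulrDl mul1r.
Qed.

(** The derivatives are only required to agree at the two end points of the
    period, and not to be periodic, because this is applied to multipliers,
    which are functions of the frequency supported in the middle of the
    interval. *)
Lemma family_fourier D (L : R) (x : R) : smooth_family D ->
  (forall n, D n 1 = D n 0) ->
  (forall n x, (n <= 2)%N -> cmodulus (D n x) <= L) ->
  1 / 4 <= x <= 3 / 4 ->
  zlim (fun k => hat (D 0%N) k * expk k x) = D 0%N x.
Proof.
move=> sD pD hL x34.
have L0 : 0 <= L by apply: le_trans (hL 0%N 0 isT); exact: cmod_ge0.
have bD : cbm (D 0%N) by exact/ccontinuous_cbm/(is_cderive_continuous (sD 0%N)).
have cv := fourier_inversion bD x34
  (fun y _ => family_lip y x sD (fun z => hL 1%N z isT)).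
have hK k : cmodulus (hat (D 0%N) k * expk k x) <= 2 ^+ 2 * (2 * L) / zabs k ^+ 2.
  by rewrite cmodM cmod_expk mulr1; exact: hat_decay_family.
have K0 : 0 <= 2 ^+ 2 * (2 * L) by rewrite !mulr_ge0.
apply/eqP; rewrite -subr_eq0; apply/eqP.
have cv2 : (fun n : nat => 4 * (2 ^+ 2 * (2 * L)) / n.+1%:R +
    cmodulus (zsum (fun k => hat (D 0%N) k * expk k x) n - D 0%N x)) @ \oo --> (0 : R).
  by rewrite -[0 : R]addr0; apply: cvgD => //; exact: cvg_divn.
apply: (cvg0_eq cv2) => n.
rewrite -[X in cmodulus X](subrKA (zsum (fun k => hat (D 0%N) k * expk k x) n)).
apply: le_trans (cmodD _ _) _; apply: lerD => //.
by rewrite cmodBC; exact: (zlimP K0 hK).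
Qed.

(** Fourier inversion is available in the middle of the period; translation
    brings any point there. *)
Lemma test_fourier h x : test_function h ->
  zlim (fun k => hat h k * expk k x) = h x.
Proof.
move=> th.
pose s := x - 1 / 2.
pose D n y := cderiven n h (y + s).
have D0 y : D 0%N y = h (y + s) by rewrite /D cderiven0.
have sD : smooth_family D by move=> m; exact: is_cderive_shift (csmooth_family th.1 m).
have pD n : D n 1 = D n 0 by rewrite /D add0r addrC cderiven_periodic.
have [L L0 hL] := test_bounded_upto 2 th.
have h12 : ((1 / 4 : R) <= 1 / 2) && ((1 / 2 : R) <= 3 / 4).
  by apply/andP; split; lra.
have := family_fourier sD pD (fun n y => hL n (y + s)) h12.
rewrite D0 /s addrC subrK => <-; congr zlim; apply/funext => k.
rewrite -[x in LHS](subrK (1 / 2)) -/s.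
have -> : D 0%N = fun y => h (y + s) by apply/funext => y; exact: D0.
rewrite hat_translate; [|by rewrite -[h]cderiven0; exact: test_continuous|exact: th.2].
by rewrite expkDx; ring.
Qed.

Lemma test_fourier_rate h m : test_function h -> exists2 K : R, 0 <= K &
  forall x n, cmodulus (zsum (fun k => hat h k * (freq k ^+ m * expk k x)) n - cderiven m h x)
    <= K / n.+1%:R.
Proof.
move=> th.
have [K K0 hK] := rapid_freq m (rapid_hat th) 2%N.
exists (4 * K) => [|x n]; first by rewrite mulr_ge0.
have tm : test_function (cderiven m h).
  have sf : smooth_family (fun n => cderiven (n + m) h).
    by move=> p; exact: csmooth_family th.1 _.
  by apply: (test_family sf) => y; rewrite cderiven_periodic.
rewrite -(test_fourier x tm).
have E : (fun k => hat (cderiven m h) k * expk k x) =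
  fun k => hat h k * (freq k ^+ m * expk k x).
  by apply/funext => k; rewrite hat_cderiven//; ring.
rewrite E; apply: zlimP => // k.
by rewrite mulrA cmodM cmod_expk mulr1.
Qed.

Definition test_linear f := forall (a : R[i]) g h,
  test_function g -> test_function h ->
     f (fun x => a * g x + h x) = a * f g + f h.

Lemma test_linear0 f : test_linear f -> f (fun=> 0) = 0.
Proof.
move=> lf; have := lf (-1) _ _ test0 test0.
under eq_fun do rewrite mulr0 addr0.
by rewrite mulN1r addNr.
Qed.

Lemma test_linearZ f (a : R[i]) g : test_linear f -> test_function g ->
  f (fun x => a * g x) = a * f g.
Proof.
move=> lf tg; have := lf a _ _ tg test0; rewrite (test_linear0 lf) addr0 => <-.
by congr f; apply/funext => x; rewrite addr0.
Qed.

Lemma test_Z g (a : R[i]) : test_function g ->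
  test_function (fun x => a * g x) /\
  forall n, cderiven n (fun x => a * g x) = fun x => a * cderiven n g x.
Proof.
move=> tg; have [H1 H2] := lin_cderiven a tg test0.
have E : (fun x => a * g x + 0) = fun x => a * g x.
  by apply/funext => x; rewrite addr0.
rewrite E in H1 H2; split=> // n; rewrite H2 cderiven_0.
by apply/funext => x; rewrite addr0.
Qed.

Lemma test_B g h : test_function g -> test_function h ->
  test_function (fun x => g x - h x) /\
  forall n, cderiven n (fun x => g x - h x) = fun x => cderiven n g x - cderiven n h x.
Proof.
move=> tg th; have [H1 H2] := lin_cderiven (-1) th tg.
have E : (fun x => -1 * h x + g x) = fun x => g x - h x.
  by apply/funext => x; rewrite mulN1r addrC.
rewrite E in H1 H2; split=> // n; rewrite H2.
by apply/funext => x; rewrite mulN1r addrC.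
Qed.

Lemma test_linearB f g h : test_linear f -> test_function g -> test_function h ->
  f (fun x => g x - h x) = f g - f h.
Proof.
move=> lf tg th; rewrite addrC -mulN1r -lf//; congr f.
by apply/funext => x; rewrite mulN1r addrC.
Qed.

Lemma test_linear_zsum f (c : int -> R[i]) n : test_linear f ->
  f (fun x => zsum (fun k => c k * expk k x) n) = zsum (fun k => c k * f (expk k)) n.
Proof.
move=> lf; elim: n => [|n IH].
  rewrite zsum0 -test_linearZ//; last exact: test_expk.
  by congr f; apply/funext => x; rewrite zsum0.
have E : (fun x => zsum (fun k => c k * expk k x) n.+1) =
  fun x => c (- n.+1%:Z) * expk (- n.+1%:Z) x +
    (c n.+1%:Z * expk n.+1%:Z x + zsum (fun k => c k * expk k x) n).
  by apply/funext => x; rewrite zsumS; ring.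
have [t1 _] := test_zsum c n.
have [t2 _] := lin_cderiven (c n.+1%:Z) (test_expk n.+1%:Z) t1.
rewrite E lf//; last exact: test_expk.
rewrite lf//; last exact: test_expk.
by rewrite IH zsumS; ring.
Qed.

Definition test_bounded_by f (N : nat) (C : R) := forall h (B : R),
  test_function h -> 0 < B ->
  (forall n x, (n <= N)%N -> cmodulus (cderiven n h x) <= B) ->
  cmodulus (f h) <= C * B.

Lemma test_seminormP n g (C : R) :
  (test_seminorm n g <= C%:E)%E <-> forall x, cmodulus (cderiven n g x) <= C.
Proof.
split=> [H x|H].
  by rewrite -lee_fin; apply: le_trans H; apply: ereal_sup_ubound; exists x.
by apply: ge_ereal_sup => _ [x _ <-]; rewrite lee_fin.
Qed.

(** Continuity at zero, applied to a rescaled test function, becomes a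
    homogeneous bound: a distribution has finite order. *)
Lemma distribution_bounded f : distribution_T f ->
  exists N, exists2 C : R, 0 < C & test_bounded_by f N C.
Proof.
move=> [lf cf].
have [N [d [d0 hd]]] := cf _ test0 1 ltr01.
exists N, (2 / d) => [|h B th B0 hB]; first by rewrite divr_gt0.
pose t := d / (2 * B).
have t0 : 0 < t by rewrite divr_gt0// mulr_gt0.
have [tth dth] := test_Z t%:C th.
have := hd _ tth; rewrite (test_linear0 lf) subr0 (test_linearZ _ lf th).
rewrite cmodM cmodR gtr0_norm// => H.
have : t * cmodulus (f h) < 1.
  apply: H => n nN; apply: (@le_lt_trans _ _ (d / 2)%:E).
    apply/test_seminormP => x; under eq_fun do rewrite subr0.
    rewrite dth cmodM cmodR gtr0_norm//.
    apply: le_trans (ler_wpM2l (ltW t0) (hB n x nN)) _.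
    by apply: le_of_eq; rewrite /t; field; rewrite gt_eqF.
  by rewrite lte_fin; lra.
rewrite mulrC -ltr_pdivlMr// => /ltW /le_trans; apply.
by apply: le_of_eq; rewrite /t; field; rewrite !gt_eqF.
Qed.

Lemma bounded_distribution f N (C : R) : test_linear f -> test_bounded_by f N C ->
  distribution_T f.
Proof.
move=> lf bf; split=> // g tg e e0.
pose d := e / (2 * (`|C| + 1)).
have C1 : 0 < `|C| + 1 by rewrite ltr_wpDl.
have d0 : 0 < d by rewrite divr_gt0// mulr_gt0.
exists N, d; split=> // h th hd.
have [tB _] := test_B th tg.
rewrite -(test_linearB lf th tg).
apply: le_lt_trans (bf _ d tB d0 _) _.
  by move=> n x nN; apply/test_seminormP : x; exact/ltW/hd.
apply: (@le_lt_trans _ _ ((`|C| + 1) * d)).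
  by rewrite ler_wpM2r ?(ltW d0)// ler_wpDr// ler_norm.
have -> : (`|C| + 1) * d = e / 2 by rewrite /d; field; rewrite gt_eqF.
by rewrite ltr_pdivrMr// ltr_pMr// ltr1n.
Qed.

Lemma cmod_freq_zabs k n : cmodulus (freq k) ^+ n <= (2 * pi) ^+ n * zabs k ^+ n :> R.
Proof.
rewrite -exprMn lerXn2r ?nnegrE ?cmod_ge0 ?cmod_freq_le//.
by rewrite !mulr_ge0 ?pi_ge0// ltW// zabs_gt0.
Qed.

Lemma coef_growth f : distribution_T f ->
  exists N, exists2 C : R, 0 < C & forall k, cmodulus (f (expk k)) <= C * zabs k ^+ N.
Proof.
move=> df; have [N [C C0 bf]] := distribution_bounded df.
have p1 : 1 <= 2 * pi :> R by have := pi_ge2 R; lra.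
exists N, (C * (2 * pi) ^+ N) => [|k].
  by rewrite mulr_gt0// exprn_gt0// (lt_le_trans ltr01).
rewrite -mulrA; apply: bf; first exact: test_expk.
  by rewrite mulr_gt0// exprn_gt0 ?zabs_gt0// (lt_le_trans ltr01).
move=> n x nN; rewrite cderiven_expk cmodM cmod_expk mulr1 cmodX.
apply: le_trans (cmod_freq_zabs k n) _.
apply: ler_pM; rewrite ?exprn_ge0 ?(ltW (zabs_gt0 _)) ?(le_trans ler01 p1)//.
  by rewrite ler_weXn2l.
by rewrite ler_weXn2l// zabs_ge1.
Qed.

(** The Fourier series of a test function converges to it together with its
    derivatives, uniformly and at rate [1 / n.+1]; since [f] has finite order,
    [f] can be applied term by term. *)
Lemma distribution_series f h : distribution_T f -> test_function h ->
  f h = zlim (fun k => hat h k * f (expk k)).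
Proof.
move=> df th; have [N [C C0 bf]] := distribution_bounded df.
have lf := df.1.
have : exists2 K : R, 0 < K & forall m n x, (m <= N)%N ->
   cmodulus (zsum (fun k => hat h k * (freq k ^+ m * expk k x)) n - cderiven m h x)
    <= K / n.+1%:R.
  elim: N {bf} => [|N [K K0 IH]].
    have [K K0 hK] := test_fourier_rate 0 th.
    exists (K + 1) => [|m n x]; first by rewrite ltr_wpDl.
    rewrite leqn0 => /eqP ->; apply: le_trans (hK x n) _.
    by rewrite ler_pM2r ?invr_gt0// lerDl.
  have [K' K'0 hK] := test_fourier_rate N.+1 th.
  exists (K + K') => [|m n x]; first by rewrite ltr_pwDl.
  rewrite leq_eqVlt => /predU1P[->|mN].
    by apply: le_trans (hK x n) _; rewrite ler_pM2r ?invr_gt0// lerDr ltW.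
  by apply: le_trans (IH m n x mN) _; rewrite ler_pM2r ?invr_gt0// lerDl.
move=> [K K0 hK]; apply/esym/(@zlim_eq _ _ _ (C * K)) => n.
rewrite -(test_linear_zsum _ _ lf).
have [t1 dt1] := test_zsum (hat h) n.
have [t2 dt2] := test_B t1 th.
rewrite -(test_linearB lf t1 th) -mulrA; apply: bf => //.
  by rewrite divr_gt0.
move=> m x mN; rewrite dt2 dt1; exact: hK.
Qed.

Lemma cint_zsum (F' : int -> R -> R[i]) n : (forall k, cbm (F' k)) ->
  cintegral01 (fun x => zsum (fun k => F' k x) n) = zsum (fun k => cintegral01 (F' k)) n.
Proof.
move=> bF.
have bz m : cbm (fun x => zsum (fun k => F' k x) m).
  elim: m => [|m IH].
    by rewrite (_ : (fun x => _) = F' 0)//; apply/funext => x; rewrite zsum0.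
  rewrite (_ : (fun x => _) = fun x => zsum (fun k => F' k x) m +
     (F' m.+1%:Z x + F' (- m.+1%:Z) x)).
    by apply: cbmD => //; exact: cbmD.
  by apply/funext => x; rewrite zsumS.
elim: n => [|n IH].
  by rewrite zsum0; congr cintegral01; apply/funext => x; rewrite zsum0.
rewrite zsumS -IH -!cintD//; first by congr cintegral01; apply/funext => x; rewrite zsumS.
exact: cbmD.
Qed.

(** The density of [f] is the sum of its Fourier series. Both [f] and this
    density are evaluated on a test function as limits of the same partial
    sums. *)
Lemma rapid_smooth f : distribution_T f -> rapid (fourier_coef f) ->
  is_smooth_distribution f.
Proof.
move=> df ra; exists (fun x => zlim (fun k => fourier_coef f k * expk k x)).
  exact: rapid_test.
move=> h th; rewrite (distribution_series df th) -zlim_opp.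
have tg := rapid_test ra.
have [K K0 hK] := ra 2%N.
have [B B0 hB] := test_bounded 0 th; rewrite cderiven0 in hB.
apply: (@zlim_eq _ _ _ (2 * (4 * K * B))) => n.
pose S x := zsum (fun k => fourier_coef f k * expk k x) n.
pose g x := zlim (fun k => fourier_coef f k * expk k x).
have bfk k : cbm (fun x => fourier_coef f k * expk k x * h x).
  by apply: cbmM; [apply: cbmM; [exact: cbm_cst|exact: cbm_expk]|exact: test_cbm].
have -> : zsum (fun k => hat h (- k) * f (expk (- k))) n =
   cintegral01 (fun x => S x * h x).
  transitivity (zsum (fun k => cintegral01 (fun x => fourier_coef f k * expk k x * h x)) n).
    apply: eq_zsum => k; rewrite /hat opprK mulrC -cintZ; last first.
      by apply: cbmM; [exact: cbm_expk|exact: test_cbm].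
    by congr cintegral01; apply/funext => x; rewrite mulrA.
  rewrite -cint_zsum//; congr cintegral01; apply/funext => x.
  by rewrite /S [RHS]mulrC -zsumZ; apply: eq_zsum => k; rewrite mulrC.
have bS : cbm S by apply: test_cbm; have [] := test_zsum (fourier_coef f) n.
have bg : cbm g by exact: test_cbm.
have bh : cbm h by exact: test_cbm.
have -> : cintegral01 (fun x => S x * h x) - cintegral01 (fun x => g x * h x) =
    cintegral01 (fun x => (S x - g x) * h x).
  rewrite (_ : (fun x => (S x - g x) * h x) = fun x => S x * h x + -1 * (g x * h x)).
    rewrite cintD; [|exact: cbmM|by apply: cbmM; [exact: cbm_cst|exact: cbmM]].
    by rewrite cintZ ?mulN1r//; exact: cbmM.
  by apply/funext => x; ring.
rewrite -mulrA mulrAC; apply: cmod_cint_bound.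
  by apply: cbmM => //; apply: cbmD => //; exact: cbmN.
move=> x; rewrite cmodM ler_pM ?cmod_ge0//.
by apply: zlimP => // k; rewrite cmodM cmod_expk mulr1.
Qed.

(** * The Sobolev operators *)

Definition sobolev_weight (gamma : R) k : R := (1 + k%:~R ^+ 2) `^ (gamma / 2).

Lemma sobolev_weight_gt0 gamma k : 0 < sobolev_weight gamma k.
Proof. by rewrite powR_gt0// ltr_pwDl// sqr_ge0. Qed.

Lemma sobolev_weightD gamma delta k :
  sobolev_weight gamma k * sobolev_weight delta k = sobolev_weight (gamma + delta) k.
Proof.
rewrite /sobolev_weight -powRD ?mulrDl//; apply/implyP => _.
by rewrite gt_eqF// ltr_pwDl// sqr_ge0.
Qed.

Lemma sobolev_weight0 k : sobolev_weight 0 k = 1.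
Proof. by rewrite /sobolev_weight mul0r powRr0. Qed.

Lemma sobolev_weight_le gamma : exists M : nat, forall k, sobolev_weight gamma k <= zabs k ^+ M.
Proof.
exists (Num.bound `|gamma|) => k.
have z1 := @zabs_ge1 R k.
have b1 : 1 <= 1 + k%:~R ^+ 2 :> R by rewrite lerDl sqr_ge0.
have b0 : 0 <= 1 + k%:~R ^+ 2 :> R by rewrite (le_trans ler01).
apply: (@le_trans _ _ ((1 + k%:~R ^+ 2) `^ (`|gamma| / 2))).
  by rewrite /sobolev_weight ler_powR// ler_pM2r// ler_norm.
apply: (@le_trans _ _ ((zabs k ^+ 2) `^ (`|gamma| / 2))).
  rewrite ge0_ler_powR ?nnegrE ?divr_ge0 ?sqr_ge0//.
  rewrite /zabs sqrrD expr1n mul1r real_normK ?num_real//.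
  by rewrite lerD2r lerDl mulrn_wge0.
rewrite -powR_mulrn ?(le_trans ler01)// -powRrM mulrC divfK//.
rewrite -powR_mulrn ?(le_trans ler01)// ler_powR//.
by rewrite ltW// archi_boundP.
Qed.

Lemma finite_zball n : finite_set [set k : int | `|k| <= n%:Z].
Proof.
have : finite_set ((fun i : nat => i%:Z - n%:Z) @` `I_(2 * n).+1).
  by apply: finite_image; exact: finite_II.
apply: sub_finite_set => k /= kn; exists (absz (k + n%:Z)); lia.
Qed.

Lemma fsbig_zsum (F : int -> R[i]) n :
  \sum_(k \in [set k : int | `|k| <= n%:Z]) F k = zsum F n.
Proof.
elim: n => [|n IH].
  rewrite zsum0 (_ : [set k : int | `|k| <= 0%:Z] = [set 0]) ?fsbig_set1//.
  by apply/seteqP; split=> k /=; [lia|move=> ->].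
rewrite zsumS -IH.
rewrite (_ : [set k : int | `|k| <= n.+1%:Z] =
  [set k : int | `|k| <= n%:Z] `|` ([set n.+1%:Z] `|` [set - n.+1%:Z])); last first.
  by apply/seteqP; split=> k /=; [lia|case=> [|[|]]; lia].
rewrite fsbigU0; last 3 first.
- exact: finite_zball.
- by rewrite finite_setU; split; exact: finite_set1.
- by move=> k /= []; lia.
rewrite fsbigU0; [by rewrite !fsbig_set1|exact: finite_set1|exact: finite_set1|].
by move=> k /= []; lia.
Qed.

Definition sobolev_term gamma f h k := (sobolev_weight gamma k)%:C * fourier_coef f k * hat h (- k).

Lemma sobolev_opE gamma f h : sobolev_op gamma f h = zlim (sobolev_term gamma f h).
Proof.
rewrite /sobolev_op /zlim; congr clim; apply/funext => n.
rewrite fsbig_zsum; apply: eq_zsum => k.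
by rewrite /sobolev_term /hat opprK.
Qed.

(** The order of decay asked from the Fourier coefficients of the test
    function compensates the growth of the weight and of the coefficients of
    [f], with two more powers for summability. *)
Lemma sobolev_decay gamma f : distribution_T f -> exists N, exists2 C : R, 0 < C &
  forall h (B : R), test_function h -> 0 < B ->
  (forall n x, (n <= N)%N -> cmodulus (cderiven n h x) <= B) ->
  forall k, cmodulus (sobolev_term gamma f h k) <= C * B / zabs k ^+ 2.
Proof.
move=> df; have [N [C C0 hC]] := coef_growth df.
have [M hM] := sobolev_weight_le gamma.
pose P := (M + N + 2)%N.
exists P, (C * (2 ^+ P * 2)) => [|h B th B0 hB k].
  by rewrite !mulr_gt0// exprn_gt0.
rewrite !cmodM cmodR gtr0_norm ?sobolev_weight_gt0//.
have H1 := hM k.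
have := hC (- k); rewrite zabsN => H2.
have := hat_decay (- k) th hB; rewrite zabsN => H3.
have z0 := @zabs_gt0 R k.
have H4 := ler_pM (ltW (sobolev_weight_gt0 gamma k)) (cmod_ge0 _) H1 H2.
have H5 := ler_pM (mulr_ge0 (ltW (sobolev_weight_gt0 gamma k)) (cmod_ge0 _)) (cmod_ge0 _) H4 H3.
apply: le_trans H5 _; apply: le_of_eq.
rewrite /P !exprD; field.
by rewrite !expf_neq0// gt_eqF.
Qed.

Lemma sobolev_summable gamma f h : distribution_T f -> test_function h ->
  summableZ (sobolev_term gamma f h).
Proof.
move=> df th; have [N [C C0 hC]] := sobolev_decay gamma df.
have [B B0 hB] := test_bounded_upto N th.
exists (C * B); first by rewrite mulr_ge0// ltW.
by apply: hC => // n x nN; exact: hB.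
Qed.

Lemma sobolev_distribution gamma f : distribution_T f ->
  distribution_T (sobolev_op gamma f).
Proof.
move=> df; have [N [C C0 hC]] := sobolev_decay gamma df.
apply: (@bounded_distribution _ N (5 * C)).
  move=> a g h tg th; rewrite !sobolev_opE -zlim_lin; try exact: sobolev_summable.
  congr zlim; apply/funext => k.
  have -> : sobolev_term gamma f (fun x => a * g x + h x) k =
     (sobolev_weight gamma k)%:C * fourier_coef f k * (a * hat g (- k) + hat h (- k)).
    rewrite /sobolev_term; congr (_ * _).
    have bgk : cbm (fun x => expk (- - k) x * g x).
      by apply: cbmM; [exact: cbm_expk|exact: test_cbm].
    have bhk : cbm (fun x => expk (- - k) x * h x).
      by apply: cbmM; [exact: cbm_expk|exact: test_cbm].
    rewrite /hat -cintZ// -cintD//; last by apply: cbmM => //; exact: cbm_cst.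
    by congr cintegral01; apply/funext => x; ring.
  by rewrite /sobolev_term; ring.
move=> h B th B0 hB; rewrite sobolev_opE -mulrA.
apply: zlim_le; first by rewrite mulr_ge0// ltW.
exact: hC.
Qed.

Lemma sobolev_coef gamma f k : distribution_T f ->
  fourier_coef (sobolev_op gamma f) k = (sobolev_weight gamma k)%:C * fourier_coef f k.
Proof.
move=> df; rewrite {1}/fourier_coef sobolev_opE.
rewrite -[RHS](zlim_delta k); congr zlim; apply/funext => l.
rewrite /sobolev_term /hat opprK.
under eq_fun do rewrite -expkD.
rewrite cint_expk subr_eq0.
by case: eqP => [->|]; rewrite ?mulr1 ?mulr0.
Qed.

End distributions.

(** * Lebesgue norms of trigonometric polynomials *)

Section lebesgue_norms.
Context {R : realType}.
Local Notation Re := complex.Re.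
Local Notation Im := complex.Im.
Local Notation mu := (@lebesgue_measure R).
Local Notation I01 := (`[0, 1]%classic : set R).
Implicit Types (k l : int) (x y : R) (g h : R -> R[i]) (a : int -> R[i]).

Definition trig a n x : R[i] := zsum (fun k => a k * expk k x) n.

Lemma trig_continuous a n : ccontinuous (trig a n).
Proof.
have [t _] := test_zsum a n.
by rewrite -[trig a n]cderiven0; exact: test_continuous.
Qed.

Lemma trig_periodic a n x : trig a n (x + 1) = trig a n x.
Proof. by apply: eq_zsum => k; rewrite expk_periodic. Qed.

(** Multiplying by a character of modulus one turns a trigonometric polynomial
    into an algebraic polynomial in [expk 1 x], whose powers have a controlled
    number of coefficients. *)
Lemma trig_poly a n : exists2 P : {poly R[i]}, (size P <= 2 * n + 1)%N &
  forall x, expk n x * trig a n x = P.[expk 1 x].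
Proof.
elim: n => [|n [P sP IH]].
  exists (a 0)%:P => [|x]; first by rewrite size_polyC; case: eqP.
  by rewrite /trig zsum0 hornerC !expk0 mul1r mulr1.
exists (P * 'X + (a n.+1%:Z) *: 'X^(2 * n.+1) + (a (- n.+1%:Z))%:P) => [|x].
  apply: leq_trans (size_polyD _ _) _; rewrite geq_max; apply/andP; split.
    apply: leq_trans (size_polyD _ _) _; rewrite geq_max; apply/andP; split.
      apply: leq_trans (size_polyMleq _ _) _; rewrite size_polyX addn2 /=.
      by apply: leq_ltn_trans sP _; lia.
    by apply: leq_trans (size_scale_leq _ _) _; rewrite size_polyXn; lia.
  by rewrite size_polyC; case: eqP => //; lia.
rewrite !hornerE /trig zsumS -/(trig a n x) -IH.
have e1 : expk n.+1%:Z x = expk n%:Z x * expk 1 x.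
  by rewrite -expkD -PoszD addn1.
have e2 : expk 1 x ^+ (2 * n.+1) = expk n.+1%:Z x * expk n.+1%:Z x.
  by rewrite -!expk_nat -expkD -PoszD mul2n addnn.
rewrite e2 !mulrDr.
have -> : expk n.+1%:Z x * (a (- n.+1%:Z) * expk (- n.+1%:Z) x) = a (- n.+1%:Z).
  by rewrite mulrCA expkKN mulr1.
by rewrite [in X in X + _ = _]e1; ring.
Qed.

Lemma poly_coef_int (P : {poly R[i]}) (i : nat) :
  P`_i = cintegral01 (fun x => expk (- i%:Z) x * P.[expk 1 x]).
Proof.
rewrite (_ : (fun x => _) =
  fun x => \sum_(j < size P) P`_j * expk (j%:Z - i%:Z) x); last first.
  apply/funext => x; rewrite horner_coef mulr_sumr; apply: eq_bigr => j _.
  by rewrite expkD expk_nat; ring.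
rewrite cint_sum; last by move=> j; apply: cbmM; [exact: cbm_cst|exact: cbm_expk].
have cE (j : 'I_(size P)) : cintegral01 (fun x => P`_j * expk (j%:Z - i%:Z) x) =
    P`_j * (j%:Z - i%:Z == 0)%:R.
  by rewrite cintZ ?cint_expk//; exact: cbm_expk.
rewrite (eq_bigr _ (fun j _ => cE j)).
have [iP|iP] := ltnP i (size P).
  rewrite (bigD1 (Ordinal iP)) //= subrr eqxx mulr1 big1 ?addr0// => j.
  rewrite -val_eqE /= => ji.
  by rewrite subr_eq0 eqz_nat (negPf ji) mulr0.
rewrite nth_default// big1// => j _.
rewrite subr_eq0 eqz_nat ltn_eqF ?mulr0//.
exact: leq_trans (ltn_ord j) iP.
Qed.

Lemma cbm_horner (P : {poly R[i]}) : cbm (fun x => P.[expk 1 x]).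
Proof.
rewrite (_ : (fun x => _) = fun x => \sum_(j < size P) P`_j * expk (j%:Z) x).
  by apply: cbm_sum => j; apply: cbmM; [exact: cbm_cst|exact: cbm_expk].
by apply/funext => x; rewrite horner_coef; under [RHS]eq_bigr do rewrite expk_nat.
Qed.

Lemma poly_sup_L1 (P : {poly R[i]}) x :
  cmodulus P.[expk 1 x] <=
  2 * (size P)%:R * rint (fun x => cmodulus P.[expk 1 x]).
Proof.
rewrite horner_coef; apply: le_trans (cmod_sum _ _ _) _.
set r := rint _.
apply: (@le_trans _ _ (\sum_(i < size P) 2 * r)).
  apply: ler_sum => i _.
  rewrite cmodM cmodX cmod_expk expr1n mulr1 poly_coef_int.
  apply: le_trans (cmod_cint _) _.
    by apply: cbmM; [exact: cbm_expk|exact: cbm_horner].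
  apply: le_of_eq; congr (_ * rint _).
  by apply/funext => y; rewrite cmodM cmod_expk mul1r.
by rewrite sumr_const card_ord -[leLHS]mulr_natr mulrAC.
Qed.

Lemma bm_powR (u : R -> R) (r : R) : 0 < r -> (forall x, 0 <= u x) ->
  bounded_measurable u -> bounded_measurable (fun x => u x `^ r).
Proof.
move=> r0 u0 [mu_ [C hC]]; split.
  exact: (measurableT_comp (measurable_powR r)).
exists (C `^ r) => x xI; rewrite ger0_norm ?powR_ge0//.
have uC : u x <= C by apply: le_trans (hC x xI); rewrite ler_norm.
by rewrite ge0_ler_powR ?nnegrE ?(ltW r0) ?(le_trans (u0 x) uC)//.
Qed.

(** The [r]-th power of the [L_r] quasi-norm. It is this power, and not the
    quasi-norm, that is subadditive when [r] is less than one. *)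
Definition Lpow (r : R) g : R := rint (fun x => cmodulus (g x) `^ r).

Lemma bm_Lpow r g : 0 < r -> cbm g ->
  bounded_measurable (fun x => cmodulus (g x) `^ r).
Proof. by move=> r0 bg; apply: bm_powR => // [x|]; [exact: cmod_ge0|exact: bm_cmod]. Qed.

Lemma Lpow_ge0 r g : 0 <= Lpow r g.
Proof. by apply: rint_ge0 => x; exact: powR_ge0. Qed.

Lemma cmod_continuous g : ccontinuous g -> continuous (fun x => cmodulus (g x)).
Proof.
move=> [c1 c2]; rewrite (_ : (fun x => _) =
      fun x => Num.sqrt (Re (g x) ^+ 2 + Im (g x) ^+ 2)); last first.
  by apply/funext => x; rewrite cmodE.
move=> x; apply: (@continuous_comp _ _ _
   (fun x => Re (g x) ^+ 2 + Im (g x) ^+ 2) (@Num.sqrt R)); last exact: sqrt_continuous.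
have cX (u : R -> R) : continuous u -> continuous (fun x => u x ^+ 2).
  by move=> cu y; apply: (@continuous_comp _ _ _ u (fun z => z ^+ 2));
    [exact: cu|exact: exprn_continuous].
by apply: cvgD; [exact: (cX _ c1)|exact: (cX _ c2)].
Qed.

Lemma periodic_max g : ccontinuous g -> (forall x, g (x + 1) = g x) ->
  exists c, forall x, cmodulus (g x) <= cmodulus (g c).
Proof.
move=> cg pg.
have cc : {within `[0, 1], continuous (fun x => cmodulus (g x))}.
  by apply: continuous_subspaceT; exact: cmod_continuous.
have [c _ hc] := EVT_max (@ler01 R) cc.
exists c => x; have [t t01 E] := periodic_reduce x pg.
by have := E 0; rewrite !add0r => <-; apply: hc; rewrite in_itv.
Qed.

(** Nikolskii's inequality. Replacing [g] by a power [g ^+ m] with [m >= p]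
    reduces it to the trivial estimate of the supremum by the number of
    coefficients times the integral of the modulus, [m - p] factors of which
    are then bounded by the supremum itself. *)
Lemma nikolskii (p : R) : 0 < p -> exists2 C : R, 0 < C &
  forall a n x, cmodulus (trig a n x) `^ p <= C * n.+1%:R * Lpow p (trig a n).
Proof.
move=> p0.
pose m := (Num.bound p).
have pm : p <= m%:R by rewrite ltW// archi_boundP// ltW.
have m0 : (0 < m)%N by rewrite -(@ltr_nat R) (lt_le_trans p0).
exists (2 * (2 * m + 1)%:R) => [|a n x]; first by rewrite mulr_gt0// addn1.
have [c hc] := periodic_max (trig_continuous a n) (trig_periodic a n).
set M := cmodulus (trig a n c) in hc *.
have M0 : 0 <= M := cmod_ge0 _.
have bt : cbm (trig a n) by exact/ccontinuous_cbm/trig_continuous.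
apply: (@le_trans _ _ (M `^ p)).
  by rewrite ge0_ler_powR ?nnegrE ?cmod_ge0// ltW.
have C0 : 0 <= 2 * (2 * m + 1)%:R * n.+1%:R :> R by rewrite !mulr_ge0.
have [M00|Mn0] := eqVneq M 0.
  by rewrite M00 powR0 ?gt_eqF// mulr_ge0// Lpow_ge0.
have Mp : 0 < M by rewrite lt_neqAle eq_sym Mn0.
have [P sP EP] := trig_poly a n.
have cP y : cmodulus (P ^+ m).[expk 1 y] = cmodulus (trig a n y) ^+ m.
  by rewrite horner_exp cmodX -EP cmodM cmod_expk mul1r.
have := poly_sup_L1 (P ^+ m) c; rewrite cP -/M => H.
have sPm : (size (P ^+ m) <= (2 * m + 1) * n.+1)%N.
  apply: leq_trans (size_poly_exp_leq _ _) _.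
  have : ((size P).-1 <= 2 * n)%N by lia.
  nia.
have E1 : rint (fun y => cmodulus (P ^+ m).[expk 1 y]) <=
    M `^ (m%:R - p) * Lpow p (trig a n).
  rewrite /Lpow -rintZ; last exact: bm_Lpow.
  apply: rint_le.
  - by apply: bm_cmod; exact: cbm_horner.
  - by apply: bmM; [exact: bm_cst|exact: bm_Lpow].
  move=> y _; rewrite cP -powR_mulrn ?cmod_ge0//.
  rewrite -{1}(subrK p m%:R).
  have [->|t0] := eqVneq (cmodulus (trig a n y)) 0.
    rewrite powR0; first by rewrite mulr_ge0 ?powR_ge0.
    by rewrite subrK gt_eqF// ltr0n.
  rewrite powRD; last by apply/implyP => _.
  rewrite ler_wpM2r ?powR_ge0// ge0_ler_powR ?nnegrE ?cmod_ge0//.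
  by rewrite subr_ge0.
have E2 : M ^+ m = M `^ (m%:R - p) * M `^ p.
  by rewrite -powRD ?subrK ?powR_mulrn//; apply/implyP => _.
have Mmp : 0 < M `^ (m%:R - p) by rewrite powR_gt0.
rewrite -(ler_pM2l Mmp) -E2; apply: le_trans H _.
rewrite [leRHS]mulrCA; apply: ler_pM; rewrite ?mulr_ge0//.
  by apply: rint_ge0 => y; exact: cmod_ge0.
by rewrite -mulrA ler_pM2l// -natrM ler_nat.
Qed.

(** ** Integration against the restricted measure *)

Lemma integral_mrestr (D : set R) (mD : measurable D) (f : R -> \bar R) :
  measurable_fun setT f -> (forall x, (0 <= f x)%E) ->
  (\int[mrestr mu mD]_x f x = \int[mu]_(x in D) f x)%E.
Proof.
move=> mf f0; rewrite -(setUv D) ge0_integral_setU//=; last 3 first.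
- exact: measurableC.
- by rewrite setUv.
- by apply/disj_setPS; rewrite setICr.
rewrite (eq_measure_integral mu); last first.
  move=> A mA AD; rewrite -[LHS]/(mu (A `&` D)); congr (mu _).
  by apply/seteqP; split=> [y []//|y Ay]; split=> //; exact: AD.
rewrite [X in (_ + X)%E](eq_measure_integral mzero); last first.
  move=> A mA AD; rewrite -[LHS]/(mu (A `&` D)) (_ : A `&` D = set0) ?measure0//.
  by apply/disjoints_subset.
by rewrite integral_measure_zero adde0.
Qed.

Local Notation mur := (mrestr mu (measurable_itv `[0, 1])).

Lemma mur_setT : mur setT = 1%E.
Proof. by rewrite /mrestr setTI /= lebesgue_measure_itv /= lte_fin ltr01 sube0. Qed.

Lemma measurable_cmod g (r : R) : ccontinuous g ->
  measurable_fun setT (fun x => cmodulus (g x) `^ r).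
Proof.
move=> cg; apply: (measurableT_comp (measurable_powR r)).
by apply: continuous_measurable_fun; exact: cmod_continuous.
Qed.

Lemma cmod_poweR (z : R[i]) (r : R) :
  (`|(cmodulus z)%:E| `^ r = (cmodulus z `^ r)%:E)%E.
Proof. by rewrite gee0_abs ?lee_fin ?cmod_ge0// poweR_EFin. Qed.

Lemma int_Lpow g (r : R) : 0 < r -> ccontinuous g ->
  (\int[mur]_x (`|(cmodulus (g x))%:E| `^ r) = (Lpow r g)%:E)%E.
Proof.
move=> r0 cg; under eq_integral => x _ do rewrite cmod_poweR.
rewrite integral_mrestr.
- rewrite /Lpow /rint /Rintegral fineK//.
  apply: integrable_fin_num => //.
  by apply: (@bm_integrable _ (fun x => cmodulus (g x) `^ r));
    apply: bm_Lpow => //; exact: ccontinuous_cbm.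
- by apply/measurable_EFinP; exact: measurable_cmod.
- by move=> x; rewrite lee_fin powR_ge0.
Qed.

Lemma Lp_torus_fin g (r : R) : 0 < r -> ccontinuous g ->
  Lp_torus r%:E g = (Lpow r g `^ r^-1)%:E.
Proof.
by move=> r0 cg; rewrite /Lp_torus unlock int_Lpow// poweR_EFin.
Qed.

Lemma Lp_torusy g : Lp_torus +oo g =
  ess_sup mur (abse \o (fun x => (cmodulus (g x))%:E)).
Proof.
rewrite /Lp_torus unlock ifT//.
by apply: (@lt_le_trans _ _ 1%E); rewrite ?lte01//; rewrite -mur_setT.
Qed.

Lemma Lp_torus_le_sup g (B : R) : (forall x, cmodulus (g x) <= B) ->
  (Lp_torus +oo g <= B%:E)%E.
Proof.
move=> gB; rewrite Lp_torusy; apply/ess_supP; apply: aeW => x /=.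
by rewrite lee_fin ger0_norm ?cmod_ge0.
Qed.

Lemma Lp_torus_ge0 p g : (0 <= Lp_torus p g)%E.
Proof. exact: Lnorm_ge0. Qed.

Lemma Lp_torus_mono g (r : R) : 0 < r -> ccontinuous g ->
  (Lp_torus r%:E g <= Lp_torus +oo g)%E.
Proof.
move=> r0 cg; rewrite (Lp_torus_fin r0 cg).
have L0 := Lp_torus_ge0 +oo g.
move E : (Lp_torus +oo g) L0 => [l| |] // L0; last by rewrite leey.
rewrite lee_fin in L0 *.
have ae : {ae mur, forall x, (`|(cmodulus (g x))%:E| <= l%:E)%E}.
  by apply/ess_supP; rewrite -E Lp_torusy.
have : ((Lpow r g)%:E <= (l `^ r)%:E)%E.
  rewrite -(int_Lpow r0 cg).
  have -> : ((l `^ r)%:E = \int[mur]_x (l `^ r)%:E)%E.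
    by rewrite integral_cst// -[LHS]mule1; congr (_ * _)%E; exact: esym mur_setT.
  apply: ae_ge0_le_integral => //.
  - by move=> x _; exact: poweR_ge0.
  - apply: (eq_measurable_fun (fun x => (cmodulus (g x) `^ r)%:E)).
      by move=> x _; rewrite cmod_poweR.
    by apply/measurable_EFinP; exact: measurable_cmod.
  - by move=> x _; rewrite lee_fin powR_ge0.
  apply: (@filterS _ _ (ae_filter_ringOfSetsType mur) _ _ _ ae) => x /= H _.
  rewrite -[X in (X <= _)%E]/(`|(cmodulus (g x))%:E| `^ r)%E cmod_poweR.
  move: H; rewrite ger0_norm ?cmod_ge0// !lee_fin => H.
  by rewrite ge0_ler_powR ?nnegrE ?cmod_ge0// ltW.
rewrite lee_fin => H.
have -> : l = (l `^ r) `^ r^-1 by rewrite -powRrM mulfV ?powRr1// gt_eqF.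
rewrite lee_fin ge0_ler_powR ?nnegrE ?Lpow_ge0 ?powR_ge0//.
by rewrite invr_ge0 ltW.
Qed.

End lebesgue_norms.

(** * Inequalities between powers of integrals *)

Section hoelder.
Context {R : realType}.
Local Notation Re := complex.Re.
Local Notation Im := complex.Im.
Implicit Types (k l : int) (x y : R) (g h : R -> R[i]) (a b : int -> R[i]).

Lemma weighted_amgm (x y s t : R) : 0 <= x -> 0 <= y -> 0 < s -> 0 < t -> s + t = 1 ->
  x `^ s * y `^ t <= s * x + t * y.
Proof.
move=> x0 y0 s0 t0 st.
have := @conjugate_powR _ (x `^ s) (y `^ t) s^-1 t^-1 (powR_ge0 _ _) (powR_ge0 _ _).
rewrite !invrK !invr_gt0 => /(_ s0 t0 st).
rewrite -!powRrM !mulfV ?gt_eqF// !powRr1//.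
by rewrite [x * _]mulrC [y * _]mulrC.
Qed.

(** Hoelder's inequality between three exponents. Instead of normalising by
    the integrals, which may vanish, it is stated with positive majorants of
    them: the weighted arithmetic-geometric inequality is applied to [|g| ^ r0
    / X0] and [|g| ^ r1 / X1] and integrated. *)
Lemma Lpow_hoelder g (r r0 r1 t X0 X1 : R) : cbm g ->
  0 < r -> 0 < r0 -> 0 < r1 -> 0 < t < 1 ->
  r^-1 = (1 - t) / r0 + t / r1 -> 0 < X0 -> 0 < X1 ->
  Lpow r0 g <= X0 -> Lpow r1 g <= X1 ->
  Lpow r g <= X0 `^ (r * (1 - t) / r0) * X1 `^ (r * t / r1).
Proof.
move=> bg rp r0p r1p /andP[t0 t1] rE X0p X1p LX0 LX1.
set al := r * (1 - t) / r0; set be := r * t / r1.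
have al0 : 0 < al by rewrite divr_gt0// mulr_gt0// subr_gt0.
have be0 : 0 < be by rewrite divr_gt0// mulr_gt0.
have ab1 : al + be = 1.
  by rewrite /al /be -!mulrA -mulrDr -rE mulfV// gt_eqF.
have pt x : cmodulus (g x) `^ r <= X0 `^ al * X1 `^ be *
    (al / X0 * cmodulus (g x) `^ r0 + be / X1 * cmodulus (g x) `^ r1).
  set c := cmodulus (g x); have c0 : 0 <= c by exact: cmod_ge0.
  have E : c `^ r = (c `^ r0) `^ al * (c `^ r1) `^ be.
    rewrite -!powRrM /al /be !mulrA.
    rewrite -powRD; last first.
      apply/implyP => /eqP H; exfalso.
      have : r0 * r * (1 - t) / r0 + r1 * r * t / r1 = r.
        by field; rewrite !gt_eqF.
      by rewrite H => rr; rewrite -rr ltxx in rp.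
    by congr (_ `^ _); field; rewrite !gt_eqF.
  have := @weighted_amgm (c `^ r0 / X0) (c `^ r1 / X1) al be _ _ al0 be0 ab1.
  move=> /(_ (divr_ge0 (powR_ge0 _ _) (ltW X0p)) (divr_ge0 (powR_ge0 _ _) (ltW X1p))).
  rewrite !powRM ?powR_ge0 ?invr_ge0 ?(ltW X0p) ?(ltW X1p)//.
  rewrite mulrACA -E => H.
  have P0 : 0 < X0 `^ al * X1 `^ be by rewrite mulr_gt0// powR_gt0.
  have V (z e : R) : 0 < z -> z^-1 `^ e = (z `^ e)^-1.
    by move=> z0; rewrite -powR_inv1 ?(ltW z0)// -powRrM mulN1r powRN.
  move: H; rewrite (V _ _ X0p) (V _ _ X1p) -invfM -(ler_pM2l P0).
  rewrite mulrCA mulfV ?gt_eqF// mulr1 => /le_trans; apply.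
  by rewrite ler_pM2l//; apply: le_of_eq; ring.
have b0 := bm_Lpow r0p bg; have b1 := bm_Lpow r1p bg; have b := bm_Lpow rp bg.
have c0 : bounded_measurable (fun x => al / X0 * cmodulus (g x) `^ r0).
  by apply: bmM => //; exact: bm_cst.
have c1 : bounded_measurable (fun x => be / X1 * cmodulus (g x) `^ r1).
  by apply: bmM => //; exact: bm_cst.
apply: (@le_trans _ _ (X0 `^ al * X1 `^ be * (al / X0 * Lpow r0 g + be / X1 * Lpow r1 g))).
  rewrite -!rintZ// -rintD// -rintZ; last exact: bmD.
  apply: rint_le => //; apply: bmM; [exact: bm_cst|exact: bmD].
rewrite ler_piMr ?mulr_ge0 ?powR_ge0// -ab1; apply: lerD.
  by rewrite -mulrA ler_piMr ?(ltW al0)// mulrC ler_pdivrMr// mul1r.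
by rewrite -mulrA ler_piMr ?(ltW be0)// mulrC ler_pdivrMr// mul1r.
Qed.

Lemma powRK (p x : R) : 0 < p -> 0 <= x -> (x `^ p) `^ p^-1 = x.
Proof. by move=> p0 x0; rewrite -powRrM mulfV ?powRr1// gt_eqF. Qed.

Lemma powRVK (p x : R) : 0 < p -> 0 <= x -> (x `^ p^-1) `^ p = x.
Proof. by move=> p0 x0; rewrite -powRrM mulVf ?powRr1// gt_eqF. Qed.

Lemma continuous_powR_comp (u : R -> R) (p : R) : 0 < p -> continuous u ->
  (forall x, 0 <= u x) -> continuous (fun x => u x `^ p).
Proof.
move=> p0 cu u0 x; have := u0 x; rewrite le_eqVlt => /predU1P[ux|ux]; last first.
  apply: (@continuous_comp _ _ _ u (fun z => z `^ p)); first exact: cu.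
  apply: differentiable_continuous; apply/derivable1_diffP.
  by apply: derivable_powR; rewrite in_itv /= ux.
have E : u x `^ p = 0 by rewrite -ux powR0// gt_eqF.
apply/cvgrPdistC_lt => e e0; near=> y.
rewrite E subr0 ger0_norm ?powR_ge0//.
have e1 : e = (e `^ p^-1) `^ p by rewrite -powRrM mulVf ?powRr1 ?ltW// gt_eqF.
rewrite e1 gt0_ltr_powR ?nnegrE ?powR_ge0//.
have H : `|u y - u x| < e `^ p^-1.
  by near: y; apply: (@cvgr_distC_lt _ _ _ _ _ u (u x)); [exact: cu|exact: powR_gt0].
by apply: le_lt_trans H; rewrite -ux subr0 ler_norm.
Unshelve. all: by end_near. Qed.

Lemma Lpow_translate g (p t : R) : 0 < p -> ccontinuous g ->
  (forall x, g (x + 1) = g x) -> Lpow p (fun x => g (x + t)) = Lpow p g.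
Proof.
move=> p0 cg pg; apply: (@rint_translate _ (fun x => cmodulus (g x) `^ p)).
  apply: continuous_powR_comp => //; first exact: cmod_continuous.
  by move=> x; exact: cmod_ge0.
by move=> x; rewrite pg.
Qed.

Lemma zsum_ge0 (F : int -> R) n : (forall k, 0 <= F k) -> 0 <= zsum F n.
Proof. by move=> F0; rewrite addr_ge0// sumr_ge0// => i _; rewrite addr_ge0. Qed.

Lemma zsum_term (F : int -> R) n k : (forall k, 0 <= F k) -> (absz k <= n)%N ->
  F k <= zsum F n.
Proof.
move=> F0; elim: n => [|n IH] kn.
  by rewrite zsum0; have -> : k = 0 by lia.
rewrite zsumS; move: kn; rewrite leq_eqVlt => /predU1P[kn|kn]; last first.
  by apply: le_trans (IH kn) _; rewrite lerDl addr_ge0.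
have [->|->] : k = n.+1%:Z \/ k = - n.+1%:Z by lia.
  by rewrite addrCA lerDl addr_ge0// zsum_ge0.
by rewrite addrA lerDr addr_ge0// zsum_ge0.
Qed.

Lemma zsum_le (F G : int -> R) n : (forall k, (absz k <= n)%N -> F k <= G k) ->
  zsum F n <= zsum G n.
Proof.
move=> FG; rewrite lerD ?FG//; apply: ler_sum => i _.
by rewrite lerD// FG//; have := ltn_ord i; lia.
Qed.

Lemma cmod_zsum (F : int -> R[i]) n : cmodulus (zsum F n) <= zsum (fun k => cmodulus (F k)) n.
Proof.
elim: n => [|n IH]; first by rewrite !zsum0.
rewrite !zsumS; apply: le_trans (cmodD _ _) _; apply: lerD => //.
exact: cmodD.
Qed.

Lemma zsum_zabs n : zsum (fun k => (zabs k ^+ 2)^-1) n <= 3 - 2 / n.+1%:R :> R.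
Proof.
elim: n => [|n IH].
  by rewrite zsum0 /zabs normr0 addr0 expr1n invr1; lra.
rewrite zsumS zabsN zabs_nat; apply: le_trans (lerD IH (lexx _)) _.
have a0 : 0 < n.+1%:R :> R by [].
have E : n.+2%:R = n.+1%:R + 1 :> R by rewrite natr1.
rewrite E; move: a0; set c := n.+1%:R => c0.
have c1 : 0 < c + 1 by rewrite addr_gt0.
rewrite -subr_ge0 (_ : _ - _ = 2 / (c * (c + 1) ^+ 2)).
  by rewrite divr_ge0// mulr_ge0 ?exprn_ge0// ltW.
by field; rewrite !gt_eqF.
Qed.

Lemma zsum_zabs3 n : zsum (fun k => (zabs k ^+ 2)^-1) n <= 3 :> R.
Proof. by apply: le_trans (zsum_zabs n) _; rewrite gerBl divr_ge0. Qed.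

(** A triangle inequality valid for every positive exponent, at the price of
    summable weights. *)
Lemma powR_zsum (p : R) (F : int -> R[i]) n : 0 < p ->
  cmodulus (zsum F n) `^ p <=
  zsum (fun k => (3 * zabs k ^+ 2 * cmodulus (F k)) `^ p) n.
Proof.
move=> p0; set T := (leRHS).
have T0 : 0 <= T by apply: zsum_ge0 => k; exact: powR_ge0.
have z0 k : 0 < zabs k ^+ 2 :> R by rewrite exprn_gt0// zabs_gt0.
have key : cmodulus (zsum F n) <= T `^ p^-1.
  apply: le_trans (cmod_zsum F n) _.
  apply: (@le_trans _ _ (zsum (fun k => T `^ p^-1 / 3 * (zabs k ^+ 2)^-1) n)).
    apply: zsum_le => k kn.
    have H : (3 * zabs k ^+ 2 * cmodulus (F k)) `^ p <= T.
      by apply: (zsum_term (F := fun k => (3 * zabs k ^+ 2 * cmodulus (F k)) `^ p)) => // l;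
        exact: powR_ge0.
    have : (3 * zabs k ^+ 2 * cmodulus (F k)) <= T `^ p^-1.
      have q0 : 0 <= 3 * zabs k ^+ 2 * cmodulus (F k).
        by apply: mulr_ge0; [apply: mulr_ge0 => //; exact: ltW|exact: cmod_ge0].
      rewrite -[leLHS](powRK p0 q0).
      by rewrite ge0_ler_powR ?nnegrE ?powR_ge0// invr_ge0 ltW.
    move=> H'; rewrite -mulrA -invfM ler_pdivlMr; last first.
      by apply: mulr_gt0.
    by rewrite mulrC.
  rewrite zsumZ -mulrA.
  rewrite ler_piMr ?powR_ge0//.
  by rewrite mulrC ler_pdivrMr// mul1r zsum_zabs3.
rewrite -[leRHS](powRVK p0 T0).
by rewrite ge0_ler_powR ?nnegrE ?powR_ge0 ?cmod_ge0// ltW.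
Qed.

Lemma powR_add (p x y : R) : 0 < p -> 0 <= x -> 0 <= y ->
  (x + y) `^ p <= (2 * x) `^ p + (2 * y) `^ p.
Proof.
move=> p0; wlog xy : x y / x <= y => [H x0 y0|x0 y0].
  have [/H|/ltW/H] := leP x y; first exact.
  by move=> /(_ y0 x0); rewrite addrC [leRHS]addrC.
apply: (@le_trans _ _ ((2 * y) `^ p)); last by rewrite lerDr powR_ge0.
by rewrite ge0_ler_powR ?nnegrE ?(ltW p0) ?addr_ge0 ?mulr_ge0//; lra.
Qed.

End hoelder.

(** * Fourier multipliers as superpositions of translations *)

Section multipliers.
Context {R : realType}.
Local Notation Re := complex.Re.
Local Notation Im := complex.Im.
Implicit Types (k l : int) (x y : R) (g h : R -> R[i]) (a b : int -> R[i]).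

Lemma bm_zsum (F : int -> R -> R) n : (forall k, bounded_measurable (F k)) ->
  bounded_measurable (fun x => zsum (fun k => F k x) n).
Proof.
move=> bF; apply: bmD => //.
by apply: (@bm_sum _ _ _ (fun (i : 'I_n) x => F i.+1%:Z x + F (- i.+1%:Z) x)) => i;
  exact: bmD.
Qed.

Lemma rint_zsum (F : int -> R -> R) n : (forall k, bounded_measurable (F k)) ->
  rint (fun x => zsum (fun k => F k x) n) = zsum (fun k => rint (F k)) n.
Proof.
move=> bF; elim: n => [|n IH].
  by rewrite zsum0; congr rint; apply/funext => x; rewrite zsum0.
rewrite zsumS -IH -rintD// -rintD//; [|exact: bm_zsum|exact: bmD].
by congr rint; apply/funext => x; rewrite zsumS.
Qed.

Lemma trig_lin a b (c : R[i]) n x :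
  trig (fun k => c * a k + b k) n x = c * trig a n x + trig b n x.
Proof.
rewrite /trig -zsumZ -zsumD; apply: eq_zsum => k.
by ring.
Qed.

Lemma trig_shift a n x (t : R) :
  trig a n (x + t) = trig (fun k => a k * expk k t) n x.
Proof. by apply: eq_zsum => k; rewrite expkDx; ring. Qed.

(** Translating by [l * tau] multiplies the [k]-th coefficient by [expk k (l *
    tau)], that is, by the [l]-th character at the point [k * tau]. *)
Lemma trig_filter a (c : int -> R[i]) (tau : R) n L x :
  trig (fun k => a k * zsum (fun l => c l * expk k (l%:~R * tau)) L) n x =
  zsum (fun l => c l * trig a n (x + l%:~R * tau)) L.
Proof.
elim: L => [|L IH].
  rewrite zsum0 trig_shift /trig -zsumZ; apply: eq_zsum => k.
  by rewrite zsum0; ring.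
rewrite zsumS -IH !trig_shift /trig -!zsumZ -!zsumD; apply: eq_zsum => k.
by rewrite zsumS; ring.
Qed.

Lemma trig_close a (c d : int -> R[i]) (e : R) n x :
  (forall k, a k != 0 -> cmodulus (c k - d k) <= e) ->
  cmodulus (trig (fun k => a k * c k) n x - trig (fun k => a k * d k) n x) <=
  e * zsum (fun k => cmodulus (a k)) n.
Proof.
move=> cd.
have -> : trig (fun k => a k * c k) n x - trig (fun k => a k * d k) n x =
    trig (fun k => a k * (c k - d k)) n x.
  rewrite addrC -mulN1r -trig_lin; apply: eq_zsum => k; ring.
apply: le_trans (cmod_zsum _ _) _; rewrite -zsumZ; apply: zsum_le => k _.
rewrite !cmodM cmod_expk mulr1 mulrC.
have [->|a0] := eqVneq (a k) 0; first by rewrite cmod0 !mulr0.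
by rewrite ler_wpM2r ?cmod_ge0// cd.
Qed.

Lemma Lpow_zsum (p : R) (F : int -> R -> R[i]) n : 0 < p -> (forall k, cbm (F k)) ->
  Lpow p (fun x => zsum (fun k => F k x) n) <=
  zsum (fun k => (3 * zabs k ^+ 2) `^ p * Lpow p (F k)) n.
Proof.
move=> p0 bF.
have bz : cbm (fun x => zsum (fun k => F k x) n).
  apply: cbmD => //.
  by apply: (@cbm_sum _ _ _ (fun (i : 'I_n) x => F i.+1%:Z x + F (- i.+1%:Z) x)) => i;
    exact: cbmD.
have bFk k : bounded_measurable (fun x => (3 * zabs k ^+ 2) `^ p * cmodulus (F k x) `^ p).
  by apply: bmM; [exact: bm_cst|exact: bm_Lpow].
have -> : zsum (fun k => (3 * zabs k ^+ 2) `^ p * Lpow p (F k)) n =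
   rint (fun x => zsum (fun k => (3 * zabs k ^+ 2) `^ p * cmodulus (F k x) `^ p) n).
  by rewrite rint_zsum//; apply: eq_zsum => k; rewrite rintZ//; exact: bm_Lpow.
apply: rint_le => [||x _]; first exact: bm_Lpow.
  exact: bm_zsum.
apply: le_trans (powR_zsum _ _ p0) _; apply: le_of_eq.
apply: eq_zsum => k; rewrite powRM ?cmod_ge0//.
by rewrite mulr_ge0// exprn_ge0// ltW// zabs_gt0.
Qed.

(** A smooth multiplier acts on a trigonometric polynomial as a superposition
    of translations, whose weights are the Fourier coefficients of the
    multiplier as a function of the frequency. Hence it is bounded in every
    [L_p], [p > 0], with a bound involving only the derivatives of the
    multiplier in units of the frequency scale [tau^-1]. *)
Lemma translation_multiplier (p : R) : 0 < p -> exists (M : nat), exists2 C : R, 0 < C &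
  forall (D : nat -> R -> R[i]) (B : R), smooth_family D ->
  (forall n, D n 1 = D n 0) ->
  (forall n x, (n <= M)%N -> cmodulus (D n x) <= B) ->
  forall a n (tau : R), (forall k, a k != 0 -> `|k%:~R * tau| <= 1 / 4) ->
  Lpow p (trig (fun k => a k * D 0%N (1 / 2 + k%:~R * tau)) n) <=
  C * B `^ p * Lpow p (trig a n).
Proof.
move=> p0.
(* [p * M0] exceeds 2, so that the [p]-th powers of the weights are summable;
   two more derivatives pay for the quasi-triangle inequality. *)
pose M0 := Num.bound (2 / p).
pose M := (M0 + 2)%N.
pose C1 : R := 3 * (6 * 2 ^+ M) `^ p.
have C10 : 0 < C1 by rewrite mulr_gt0// powR_gt0// mulr_gt0// exprn_gt0.
exists M, (2 `^ p * C1); first by rewrite mulr_gt0// powR_gt0.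
move=> D B sD pD hB a n tau ha.
have B0 : 0 <= B by apply: le_trans (hB 0%N 0 isT); exact: cmod_ge0.
pose c l := hat (D 0%N) l * expk l (1 / 2).
have hc l : cmodulus (c l) <= 2 ^+ M * (2 * B) / zabs l ^+ M.
  by rewrite cmodM cmod_expk mulr1; exact: hat_decay_family.
(* [S L] is the superposition of the translations by [l * tau], [|l| <= L]; it
   is bounded independently of [L] and converges uniformly to [T]. *)
pose T := trig (fun k => a k * D 0%N (1 / 2 + k%:~R * tau)) n.
pose cL L k := zsum (fun l => c l * expk k (l%:~R * tau)) L.
pose S L := trig (fun k => a k * cL L k) n.
have bt b : cbm (trig b n) by exact/ccontinuous_cbm/trig_continuous.
have LS L : Lpow p (S L) <= C1 * B `^ p * Lpow p (trig a n).
  have -> : S L = fun x => zsum (fun l => c l * trig a n (x + l%:~R * tau)) L.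
    by apply/funext => x; exact: trig_filter.
  have bs l : cbm (fun x => trig a n (x + l%:~R * tau)).
    have -> : (fun x => trig a n (x + l%:~R * tau)) =
      trig (fun k => a k * expk k (l%:~R * tau)) n by apply/funext => x; exact: trig_shift.
    exact: bt.
  apply: le_trans (Lpow_zsum _ p0 _) _.
    by move=> l; apply: cbmM => //; exact: cbm_cst.
  apply: (@le_trans _ _ (zsum (fun l => (6 * 2 ^+ M) `^ p * B `^ p * Lpow p (trig a n)
       * (zabs l ^+ 2)^-1) L)); last first.
    rewrite zsumZ; apply: (@le_trans _ _
      ((6 * 2 ^+ M) `^ p * B `^ p * Lpow p (trig a n) * 3)).
      by rewrite ler_wpM2l ?zsum_zabs3// !mulr_ge0 ?powR_ge0 ?Lpow_ge0.
    by rewrite le_eqVlt /C1; apply/orP; left; apply/eqP; ring.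
  apply: zsum_le => l _.
  have zl : 0 < zabs l :> R := zabs_gt0 l.
  have Lt : Lpow p (fun x => c l * trig a n (x + l%:~R * tau)) =
      cmodulus (c l) `^ p * Lpow p (trig a n).
    rewrite -(Lpow_translate (l%:~R * tau) p0 (trig_continuous a n) (trig_periodic a n)).
    rewrite /Lpow -rintZ; last exact: bm_Lpow.
    by congr rint; apply/funext => x; rewrite cmodM powRM ?cmod_ge0.
  rewrite Lt mulrA -powRM ?cmod_ge0//; last by rewrite mulr_ge0// exprn_ge0// ltW.
  rewrite [leRHS]mulrAC ler_wpM2r ?Lpow_ge0//.
  apply: (@le_trans _ _ ((6 * 2 ^+ M * B * (zabs l ^+ M0)^-1) `^ p)).
    rewrite ge0_ler_powR ?nnegrE ?(ltW p0)//.
    - by rewrite !mulr_ge0 ?cmod_ge0// ?exprn_ge0// ltW.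
    - by rewrite !mulr_ge0 ?invr_ge0// ?exprn_ge0// ltW.
    apply: le_trans (ler_wpM2l _ (hc l)) _.
      by rewrite mulr_ge0// exprn_ge0// ltW.
    apply: le_of_eq; rewrite /M !exprD; field.
    by rewrite expf_neq0 gt_eqF.
  rewrite powRM; [|by rewrite !mulr_ge0// exprn_ge0|by rewrite invr_ge0 exprn_ge0// ltW].
  rewrite powRM ?mulr_ge0 ?exprn_ge0//.
  rewrite ler_wpM2l ?mulr_ge0 ?powR_ge0//.
  rewrite -powR_mulrn ?(ltW zl)// -powRN -powRrM -powR_invn ?(ltW zl)//.
  rewrite ler_powR ?zabs_ge1// mulNr lerN2.
  rewrite -ler_pdivrMr//.
  by rewrite ltW// archi_boundP// divr_ge0// ltW.
pose K : R := 2 ^+ 2 * (2 * B).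
have K0 : 0 <= K by rewrite !mulr_ge0.
have hB2 m x : (m <= 2)%N -> cmodulus (D m x) <= B.
  by move=> m2; apply: hB; rewrite (leq_trans m2)// leq_addl.
have close L x : cmodulus (T x - S L x) <=
    4 * K / L.+1%:R * zsum (fun k => cmodulus (a k)) n.
  apply: trig_close => k ak; have := ha k ak; rewrite ler_norml => /andP[k1 k2].
  have h34 : (1 / 4 <= 1 / 2 + k%:~R * tau) && (1 / 2 + k%:~R * tau <= 3 / 4).
    by apply/andP; split; lra.
  rewrite -(family_fourier sD pD hB2 h34) cmodBC.
  have -> : cL L k = zsum (fun l => hat (D 0%N) l * expk l (1 / 2 + k%:~R * tau)) L.
    apply: eq_zsum => l; rewrite /c expkDx -mulrA; congr (_ * (_ * _)).
    by rewrite /expk; congr (cos _ +i* sin _); ring.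
  apply: (@zlimP _ _ K) => // l.
  by rewrite cmodM cmod_expk mulr1; exact: hat_decay_family.
pose Z := zsum (fun k => cmodulus (a k)) n.
have Z0 : 0 <= Z by apply: zsum_ge0 => k; exact: cmod_ge0.
pose d L : R := 4 * K / L.+1%:R * Z.
have d0 L : 0 <= d L by rewrite mulr_ge0// divr_ge0// mulr_ge0.
have H L : Lpow p T <= 2 `^ p * (C1 * B `^ p * Lpow p (trig a n)) + (2 * d L) `^ p.
  have bS : cbm (S L) by exact: bt.
  apply: (@le_trans _ _ (2 `^ p * Lpow p (S L) + (2 * d L) `^ p)); last first.
    by rewrite lerD2r ler_wpM2l// powR_ge0.
  rewrite -(rint_cst ((2 * d L) `^ p)) /Lpow -rintZ; last exact: bm_Lpow.
  rewrite -rintD; [|by apply: bmM; [exact: bm_cst|exact: bm_Lpow]|exact: bm_cst].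
  apply: rint_le => [||x _].
  - by apply: bm_Lpow => //; exact: bt.
  - by apply: bmD; [apply: bmM; [exact: bm_cst|exact: bm_Lpow]|exact: bm_cst].
  rewrite -powRM ?cmod_ge0//.
  apply: le_trans (powR_add p0 (cmod_ge0 _) (d0 L)).
  rewrite ge0_ler_powR ?nnegrE ?cmod_ge0 ?(ltW p0)//.
    by rewrite addr_ge0 ?cmod_ge0.
  by apply: le_trans (cmod_triB (T x) (S L x)) _; rewrite lerD2l close.
apply/ler_addgt0Pr => e e0; near \oo => L.
apply: le_trans (H L) _; rewrite -!mulrA lerD2l.
have dL : `|4 * K * Z / L.+1%:R| < e `^ p^-1 / 2.
  near: L; apply: (@cvgr0Pnorm_lt _ _ _ _ _ (fun L => 4 * K * Z / L.+1%:R)).1.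
    exact: cvg_divn.
  by rewrite divr_gt0// powR_gt0.
have dE : d L = 4 * K * Z / L.+1%:R by rewrite /d mulrAC.
rewrite -dE ger0_norm// in dL.
rewrite -[leRHS](powRVK p0 (ltW e0)) ge0_ler_powR ?nnegrE ?(ltW p0) ?powR_ge0//.
  by rewrite mulr_ge0.
by rewrite mulrC -ler_pdivlMr// ltW.
Unshelve. all: by end_near. Qed.

End multipliers.

(** * Families of functions with uniformly bounded derivatives *)

Section uniform_smoothness.
Context {R : realType}.
Implicit Types (F G Q : R -> R -> R) (e x : R).

(** The parameter [e] is [4 ^- j] for the dyadic block of index [j + 1]: the
    multipliers of all blocks form one such family, and uniformity in [e]
    makes their bounds independent of the block. *)
Fixpoint ubsmooth (n : nat) F : Prop :=
  (exists C, forall e x, 0 < e <= 1 -> `|F e x| <= C) /\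
  if n is n'.+1 then
    exists F', (forall e x, 0 < e <= 1 -> is_derive x (1 : R) (F e) (F' e x)) /\
               ubsmooth n' F'
  else True.

Lemma ubsmooth_bound n F : ubsmooth n F ->
  exists C, forall e x, 0 < e <= 1 -> `|F e x| <= C.
Proof. by case: n => [|n] []. Qed.

Lemma ubsmoothW n F : ubsmooth n.+1 F -> ubsmooth n F.
Proof.
elim: n F => [|n IH] F [bF [F' [dF uF']]]; first by split.
by split=> //; exists F'; split=> //; exact: IH.
Qed.

Lemma ubsmooth_cst n (f : R -> R) : (forall e, 0 < e <= 1 -> `|f e| <= 1) ->
  ubsmooth n (fun e _ => f e).
Proof.
case: n => [|n] hf; (split; first by exists 1 => e _; exact: hf) => //.
exists (fun _ _ => 0); split=> [e x _|]; first exact: is_derive_cst.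
elim: n => [|n IH]; (split; first by exists 0 => *; rewrite normr0) => //.
by exists (fun _ _ => 0); split=> // e x _; exact: is_derive_cst.
Qed.

Lemma ubsmoothD n F G : ubsmooth n F -> ubsmooth n G ->
  ubsmooth n (fun e x => F e x + G e x).
Proof.
elim: n F G => [|n IH] F G [[C bF] uF] [[D bG] uG].
  split=> //; exists (C + D) => e x e1.
  by apply: le_trans (ler_normD _ _) _; rewrite lerD ?bF ?bG.
split.
  exists (C + D) => e x e1.
  by apply: le_trans (ler_normD _ _) _; rewrite lerD ?bF ?bG.
have [F' [dF uF']] := uF; have [G' [dG uG']] := uG.
exists (fun e x => F' e x + G' e x); split; last exact: IH.
by move=> e x e1; apply: is_derive_add; [exact: dF|exact: dG].
Qed.

Lemma ubsmoothM n F G : ubsmooth n F -> ubsmooth n G ->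
  ubsmooth n (fun e x => F e x * G e x).
Proof.
elim: n F G => [|n IH] F G uF uG.
  have [C bF] := ubsmooth_bound uF; have [D bG] := ubsmooth_bound uG.
  split=> //; exists (C * D) => e x e1.
  by rewrite normrM ler_pM ?bF ?bG.
have [C bF] := ubsmooth_bound uF; have [D bG] := ubsmooth_bound uG.
split.
  by exists (C * D) => e x e1; rewrite normrM ler_pM ?bF ?bG.
have [_ [F' [dF uF']]] := uF; have [_ [G' [dG uG']]] := uG.
exists (fun e x => F' e x * G e x + F e x * G' e x); split.
  by move=> e x e1; apply: is_derive_mul; [exact: dF|exact: dG].
by apply: ubsmoothD; apply: IH => //; exact: ubsmoothW.
Qed.

Lemma ubsmooth_real n (c : R) : ubsmooth n (fun _ _ => c).
Proof.
case: n => [|n]; (split; first by exists `|c|) => //.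
exists (fun _ _ => 0); split=> [e x _|]; first exact: is_derive_cst.
by apply: ubsmooth_cst => e _; rewrite normr0.
Qed.

(** The lower bound [c] keeps negative powers bounded; differentiating lowers
    the exponent by one, whence the induction over all exponents. *)
Lemma ubsmooth_powR n Q (c a : R) : 0 < c ->
  (forall e x, 0 < e <= 1 -> c <= Q e x) -> ubsmooth n Q ->
  ubsmooth n (fun e x => Q e x `^ a).
Proof.
move=> c0 cQ; elim: n a => [|n IH] a uQ; have [C bQ] := ubsmooth_bound uQ.
- split=> //; exists (c `^ a + C `^ a) => e x e1.
  rewrite ger0_norm ?powR_ge0//.
  have Qc := cQ e x e1; have Q0 := lt_le_trans c0 Qc.
  have QC := le_trans (ler_norm _) (bQ e x e1).
  have [a0|a0] := leP 0 a.
    apply: (@le_trans _ _ (C `^ a)); last by rewrite lerDr powR_ge0.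
    by rewrite ge0_ler_powR ?nnegrE ?(ltW Q0)// (le_trans (ltW Q0)).
  apply: (@le_trans _ _ (c `^ a)); last by rewrite lerDl powR_ge0.
  rewrite -[a]opprK powRN [leRHS]powRN lef_pV2 ?posrE ?powR_gt0//.
  by rewrite ge0_ler_powR ?nnegrE ?(ltW Q0) ?(ltW c0)// oppr_ge0 ltW.
split.
  by apply: (ubsmooth_bound (n := n)); apply: IH; exact: ubsmoothW.
have [_ [Q' [dQ uQ']]] := uQ.
exists (fun e x => a * Q e x `^ (a - 1) * Q' e x); split.
  move=> e x e1.
  have Qx : 0 < Q e x := lt_le_trans c0 (cQ e x e1).
  exact: is_derive1_comp (is_derive1_powR a Qx) (dQ e x e1).
apply: ubsmoothM => //; apply: ubsmoothM; first exact: ubsmooth_real.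
by apply: IH; exact: ubsmoothW.
Qed.

Lemma schwartz_derive (phi : R -> R) m x : schwartz phi ->
  is_derive x (1 : R) (derive1n m phi) (derive1n m.+1 phi x).
Proof.
by move=> [d _]; have := derivableP (d m x); rewrite -derive1E -derive1nS.
Qed.

Lemma schwartz_bound (phi : R -> R) (s : R) i m : s != 0 -> schwartz phi ->
  exists C, forall x, `|x ^+ i * derive1n m phi (s * x)| <= C.
Proof.
move=> s0 sp; have [C hC] := sp.2 i m.
exists (`|s| ^- i * C) => x; have := hC (s * x).
rewrite exprMn -mulrA normrM [`|s ^+ i|]normrX => H.
by rewrite ler_pdivlMl ?exprn_gt0 ?normr_gt0.
Qed.

Lemma is_derive_exprn i x : is_derive x (1 : R) (fun y => y ^+ i) (i%:R * x ^+ i.-1).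
Proof.
elim: i => [|i IH]; first by rewrite mul0r; exact: is_derive_cst.
under eq_fun do rewrite exprS.
apply: is_derive_eqR (is_derive_mul (is_derive_id x (1 : R)) IH) _.
by case: i {IH} => [|i] /=; rewrite ?expr0 -natr1 ?exprS; ring.
Qed.

(** Powers of [x] are absorbed by the decay of the derivatives of [phi]. *)
Lemma ubsmooth_schwartz n i m (phi : R -> R) (s : R) : s != 0 -> schwartz phi ->
  ubsmooth n (fun _ x => x ^+ i * derive1n m phi (s * x)).
Proof.
move=> s0 sp.
have B i' k : exists C, forall e x, 0 < e <= 1 -> `|x ^+ i' * derive1n k phi (s * x)| <= C.
  by have [C hC] := schwartz_bound i' k s0 sp; exists C => e x _; exact: hC.
elim: n i m => [|n IH] i m; split=> //.
exists (fun _ x => i%:R * x ^+ i.-1 * derive1n m phi (s * x) +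
   x ^+ i * (s * derive1n m.+1 phi (s * x))); split.
  move=> e x _; apply: is_derive_mul; first exact: is_derive_exprn.
  by apply: is_derive_scale; exact: schwartz_derive.
rewrite (_ : (fun _ _ => _) = fun (_ : R) x =>
   i%:R * (x ^+ i.-1 * derive1n m phi (s * x)) +
   s * (x ^+ i * derive1n m.+1 phi (s * x))); last first.
  by apply/funext => e; apply/funext => x; ring.
by apply: ubsmoothD; apply: ubsmoothM => //; exact: ubsmooth_real.
Qed.

Lemma ubsmooth_sum n (I : Type) (r : seq I) (F : I -> R -> R -> R) :
  (forall i, ubsmooth n (F i)) -> ubsmooth n (fun e x => \sum_(i <- r) F i e x).
Proof.
move=> uF; elim: r => [|i r IH].
  rewrite (_ : (fun _ _ => _) = fun _ _ => 0); first exact: ubsmooth_real.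
  by apply/funext => e; apply/funext => x; rewrite big_nil.
rewrite (_ : (fun _ _ => _) = fun e x => F i e x + \sum_(i <- r) F i e x).
  exact: ubsmoothD.
by apply/funext => e; apply/funext => x; rewrite big_cons.
Qed.

Lemma ubsmooth_derive n F m : ubsmooth n F -> (m <= n)%N ->
  exists C, forall e x, 0 < e <= 1 -> `|derive1n m (F e) x| <= C.
Proof.
elim: n F m => [|n IH] F m uF mn.
  by move: mn; rewrite leqn0 => /eqP ->; exact: ubsmooth_bound uF.
case: m mn => [_|m mn]; first exact: ubsmooth_bound uF.
have [_ [F' [dF uF']]] := uF.
have [C hC] := IH _ _ uF' mn; exists C => e x e1.
rewrite derive1Sn (_ : derive1 (F e) = F' e); first exact: hC.
by apply/funext => y; rewrite derive1E; have := dF e y e1 => ?; exact: derive_val.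
Qed.

Lemma ubsmooth_derivable F m e x : (forall n, ubsmooth n F) -> 0 < e <= 1 ->
  derivable (derive1n m (F e)) x 1.
Proof.
move=> uF e1.
have : ubsmooth m.+1 F by exact: uF.
elim: m F {uF} => [|m IH] F [_ [F' [dF uF']]].
  by have [] := dF e x e1.
rewrite derive1Sn (_ : derive1 (F e) = F' e); first exact: IH.
by apply/funext => y; rewrite derive1E; have := dF e y e1 => ?; exact: derive_val.
Qed.

Lemma ubsmooth_upto F M : (forall n, ubsmooth n F) ->
  exists2 C : R, 0 <= C & forall m e x, (m <= M)%N -> 0 < e <= 1 -> `|derive1n m (F e) x| <= C.
Proof.
move=> uF; elim: M => [|M [C C0 hC]].
  have [C hC] := ubsmooth_derive (uF 0%N) (leqnn 0).
  exists `|C| => // m e x; rewrite leqn0 => /eqP -> e1.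
  by apply: le_trans (hC e x e1) _; exact: ler_norm.
have [D hD] := ubsmooth_derive (uF M.+1) (leqnn _).
exists (C + `|D|) => [|m e x]; first by rewrite addr_ge0.
rewrite leq_eqVlt => /predU1P[->|mM] e1.
  apply: le_trans (hD e x e1) _; apply: le_trans (ler_norm _) _.
  by rewrite lerDr.
by apply: le_trans (hC _ _ _ mM e1) _; rewrite lerDl.
Qed.

Lemma derive1n_support (u : R -> R) (U : set R) m x : open U ->
  (forall y, U y -> u y = 0) -> U x -> derive1n m u x = 0.
Proof.
move=> oU; elim: m u x => [|m IH] u x u0 Ux; first exact: u0.
rewrite derive1Sn; apply: IH => // y Uy.
rewrite derive1E (@near_eq_derive _ _ _ u (fun=> 0) y 1) ?derive_cst//.
by have := open_nbhs_nbhs (conj oU Uy); apply: filterS => z /u0 ->.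
Qed.

End uniform_smoothness.

(** * Littlewood-Paley blocks *)

Section blocks.
Context {R : realType} (phi0 phi1 : R -> R).
Hypothesis hphi : littlewood_paley phi0 phi1.
Local Notation Re := complex.Re.
Local Notation Im := complex.Im.
Local Notation dy := (dyadic phi0 phi1).
Implicit Types (k l : int) (x y e : R) (f : (R -> R[i]) -> R[i]).

Lemma dyadic_ge0 j x : 0 <= dy j x.
Proof. by have [_ [h0 h1] _ _ _] := hphi; case: j => [|j] /=. Qed.

Lemma phi0_support x : 2 < `|x| -> phi0 x = 0.
Proof.
move=> x2; have [_ _ s0 _ _] := hphi; apply/eqP; apply: contraTT x2 => x0.
by rewrite -leNgt; apply: s0; exact: subset_closure.
Qed.

Lemma phi1_support x : phi1 x != 0 -> 1 <= `|x| <= 4.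
Proof.
by move=> x0; have [_ _ _ s1 _] := hphi; apply: s1; exact: subset_closure.
Qed.

Lemma phi1_0 x : ~~ (1 <= `|x| <= 4) -> phi1 x = 0.
Proof. by move=> x2; apply/eqP; apply: contraNT x2; exact: phi1_support. Qed.

Lemma dyadic_partial_le x n : \sum_(j < n) dy j x <= 1.
Proof.
have [_ _ _ _ /(_ x) cv] := hphi.
have sE m : series (fun j => dy j x) m = \sum_(j < m) dy j x.
  by rewrite /series /= big_mkord.
rewrite -sE -(cvg_lim _ cv)//; apply: nondecreasing_cvgn_le.
  by apply/nondecreasing_seqP => m; rewrite !sE big_ord_recr /= lerDl dyadic_ge0.
by apply/cvg_ex; exists 1.
Qed.

Lemma dyadic_le1 j x : dy j x <= 1.
Proof.
apply: le_trans (dyadic_partial_le x j.+1).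
by rewrite big_ord_recr /= lerDr sumr_ge0// => i _; exact: dyadic_ge0.
Qed.

Lemma dyadic_support j k : dy j k%:~R != 0 -> `|k%:~R : R| <= 2 ^+ j.+1.
Proof.
case: j => [|j] /=.
  by apply: contraR; rewrite -ltNge expr1 => /phi0_support ->.
move=> /phi1_support /andP[_].
rewrite normrM ger0_norm ?invr_ge0 ?exprn_ge0// ler_pdivrMl ?exprn_gt0//.
by move=> /le_trans; apply; rewrite !exprS; lra.
Qed.

Lemma dyadic_support_low j k : dy j.+1 k%:~R != 0 -> 2 ^+ j <= `|k%:~R : R|.
Proof.
move=> /= /phi1_support /andP[+ _].
by rewrite normrM ger0_norm ?invr_ge0 ?exprn_ge0// ler_pdivlMl ?exprn_gt0// mulr1.
Qed.

Lemma dyadic_partial_eq x n : (forall j, (n <= j)%N -> dy j x = 0) ->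
  \sum_(j < n) dy j x = 1.
Proof.
move=> hx; have [_ _ _ _ /(_ x) cv] := hphi.
have E m : series (fun j => dy j x) (n + m)%N = \sum_(j < n) dy j x.
  rewrite /series /= big_mkord; elim: m => [|m IH]; first by rewrite addn0.
  by rewrite addnS big_ord_recr /= IH hx ?addr0// leq_addr.
have := cv; rewrite -(cvg_shiftn n) => cv'.
have : (fun m => series (fun j => dy j x) (m + n)%N) @ \oo --> \sum_(j < n) dy j x.
  by under eq_fun do rewrite addnC E; exact: cvg_cst.
by move=> cv2; apply: (cvg_unique _ cv2 cv').
Qed.

(** A cut-off equal to one on the support of [phi1]. The dyadic sum of the
    [phi1 (2 ^- i * x)] is one wherever enough of its terms are present, so
    five of them, rescaled, provide one; its smoothness is that of [phi1]. *)
Definition chi x : R := \sum_(i < 5) phi1 (2 ^- i * (4 * x)).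

Lemma chi_ge0 x : 0 <= chi x.
Proof. by apply: sumr_ge0 => i _; exact: (dyadic_ge0 i.+1). Qed.

Lemma chi_le1 x : chi x <= 1.
Proof.
have := dyadic_partial_le (4 * x) 6; rewrite big_ord_recl /= => H.
by apply: le_trans H; rewrite lerDr (dyadic_ge0 0).
Qed.

Lemma chi_1 x : 1 <= `|x| <= 4 -> chi x = 1.
Proof.
move=> /andP[x1 x4].
have := @dyadic_partial_eq (4 * x) 6; rewrite big_ord_recl /=.
rewrite phi0_support; last by rewrite normrM ger0_norm//; lra.
rewrite add0r; apply => -[//|j] j6 /=; apply: phi1_0.
rewrite negb_and -ltNge normrM ger0_norm ?invr_ge0 ?exprn_ge0//.
rewrite ltr_pdivrMl ?exprn_gt0// mulr1 normrM ger0_norm//.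
have : 2 ^+ 5 <= 2 ^+ j :> R by rewrite ler_weXn2l// ler1n.
by move=> H; apply/orP; left; apply: lt_le_trans H; lra.
Qed.

Lemma chi_support x : chi x != 0 -> 1 / 4 <= `|x| <= 16.
Proof.
move=> c0; have [i Hi] : exists i : 'I_5, phi1 (2 ^- i * (4 * x)) != 0.
  apply: contrapT => H; move/eqP: c0; apply; apply: big1 => i _.
  by apply/eqP; apply: contrapT => /negP Hj; apply: H; exists i.
move: Hi => /phi1_support.
have i0 : 0 <= 2 ^- i :> R by rewrite invr_ge0 exprn_ge0.
rewrite !normrM (ger0_norm i0) (@ger0_norm _ 4)//.
rewrite ler_pdivlMl ?exprn_gt0// ler_pdivrMl ?exprn_gt0// mulr1 => /andP[a b].
have a1 : 1 <= 2 ^+ i :> R by rewrite exprn_ege1// ler1n.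
have b1 : 2 ^+ i <= 2 ^+ 4 :> R.
  by rewrite ler_weXn2l ?ler1n// -ltnS.
apply/andP; split; first by lra.
have : 2 ^+ 4 = 16 :> R by rewrite -natrX.
by move=> E; rewrite E in b1; lra.
Qed.

Section multiplier.
Variable gamma : R.

(** Equal to [e + x ^+ 2] where [chi] is one, and bounded below by a positive
    constant everywhere, so that all its real powers are smooth. *)
Definition sobolev_quad e x : R := e + 1 + (chi x * x ^+ 2 - chi x).

Definition sobolev_mult e x : R := sobolev_quad e x `^ (gamma / 2) * chi x.

Lemma sobolev_quad_low e x : 0 < e <= 1 -> 1 / 16 <= sobolev_quad e x.
Proof.
move=> /andP[e0 _]; rewrite /sobolev_quad.
have c0 := chi_ge0 x; have c1 := chi_le1 x.
have [->|cx] := eqVneq (chi x) 0; first by lra.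
have /andP[x1 _] := chi_support cx.
have x2 : 1 / 16 <= x ^+ 2.
  by rewrite -(real_normK (num_real x)) expr2; nra.
nra.
Qed.

Lemma ubsmooth_chi n i : ubsmooth n (fun _ x => chi x * x ^+ i).
Proof.
have [[_ sp] _ _ _ _] := hphi.
rewrite (_ : (fun _ x => _) = fun _ x : R =>
   \sum_(l < 5) x ^+ i * derive1n 0 phi1 ((2 ^- l * 4) * x)); last first.
  apply/funext => e; apply/funext => x; rewrite mulrC /chi mulr_sumr.
  by apply: eq_bigr => l _; rewrite derive1n0 -!mulrA.
apply: ubsmooth_sum => l; apply: ubsmooth_schwartz => //.
Qed.

Lemma ubsmooth_sobolev_mult n : ubsmooth n sobolev_mult.
Proof.
have uchi : ubsmooth n (fun _ x => chi x).
  have := ubsmooth_chi n 0.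
  by under [X in ubsmooth n X]eq_fun do under eq_fun do rewrite expr0 mulr1.
apply: ubsmoothM => //.
apply: (@ubsmooth_powR _ n sobolev_quad (1 / 16)); first by lra.
  exact: sobolev_quad_low.
apply: ubsmoothD.
  apply: ubsmoothD; last exact: ubsmooth_real.
  by apply: ubsmooth_cst => e /andP[e0 e1]; rewrite ger0_norm// ltW.
apply: ubsmoothD; first exact: ubsmooth_chi.
rewrite (_ : (fun _ x => _) = fun _ x : R => -1 * chi x).
  by apply: ubsmoothM => //; exact: ubsmooth_real.
by apply/funext => e; apply/funext => x; rewrite mulN1r.
Qed.

Lemma sobolev_mult_phi1 e x : phi1 x != 0 -> sobolev_mult e x = (e + x ^+ 2) `^ (gamma / 2).
Proof.
move=> /phi1_support/chi_1 c1; rewrite /sobolev_mult /sobolev_quad c1 mulr1 mul1r.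
by congr (_ `^ _); ring.
Qed.

(** The change of variable [x = 64 * t - 32] sends the support [|x| <= 16] of
    the multiplier into the middle half of the unit interval. *)
Definition sobolev_multD e (n : nat) (t : R) : R[i] :=
  (64 ^+ n * derive1n n (sobolev_mult e) (64 * t - 32))%:C.

Lemma sobolev_multD_family e : 0 < e <= 1 -> smooth_family (sobolev_multD e).
Proof.
move=> e1 n t; split; last by rewrite /sobolev_multD /=; exact: is_derive_cst.
rewrite /sobolev_multD /=.
have d1 : is_derive (64 * t - 32) (1 : R) (derive1n n (sobolev_mult e))
    (derive1n n.+1 (sobolev_mult e) (64 * t - 32)).
  have := derivableP (@ubsmooth_derivable _ _ n e (64 * t - 32) ubsmooth_sobolev_mult e1).
  by rewrite -derive1E -derive1nS.
have dl : is_derive t (1 : R) (fun y : R => 64 * y - 32) 64.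
  apply: is_derive_eqR (is_derive_sub (is_derive_mulc 64 t)
    (is_derive_cst (32 : R) t (1 : R))) _.
  by rewrite subr0.
have d2 := @is_derive1_comp _ (derive1n n (sobolev_mult e)) (fun y => 64 * y - 32) t _ _ d1 dl.
apply: is_derive_eqR (is_derive_mul (is_derive_cst (64 ^+ n : R) t (1 : R)) d2) _.
rewrite mul0r add0r exprSr /=; ring.
Qed.

Lemma sobolev_multD_boundary e n : 0 < e <= 1 -> sobolev_multD e n 1 = sobolev_multD e n 0.
Proof.
move=> e1; rewrite /sobolev_multD.
have oU : open [set x : R | 16 < `|x|].
  by apply: (@open_comp _ _ (fun x : R => `|x|) [set y | 16 < y]);
    [move=> y _; exact: norm_continuous|exact: open_gt].
have u0 y : [set x : R | 16 < `|x|] y -> sobolev_mult e y = 0.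
  move=> /= y16; rewrite /sobolev_mult; have [->|/chi_support] := eqVneq (chi y) 0.
    by rewrite mulr0.
  by move=> /andP[_]; rewrite leNgt y16.
have Z y : 16 < `|y| -> derive1n n (sobolev_mult e) y = 0.
  by move=> y16; exact: (derive1n_support n oU u0).
rewrite !Z//; first by rewrite mulr0 sub0r normrN ger0_norm//; lra.
by rewrite mulr1 ger0_norm; lra.
Qed.

Lemma sobolev_multD_bound M : exists2 C : R, 0 < C &
  forall e n t, (n <= M)%N -> 0 < e <= 1 -> cmodulus (sobolev_multD e n t) <= C.
Proof.
have [C C0 hC] := @ubsmooth_upto _ sobolev_mult M ubsmooth_sobolev_mult.
have p64 : 0 < 64 ^+ M :> R by rewrite exprn_gt0.
exists (64 ^+ M * (C + 1)) => [|e n t nM e1]; first by rewrite mulr_gt0// ltr_wpDl.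
rewrite cmodR normrM ger0_norm ?exprn_ge0//.
apply: ler_pM; rewrite ?exprn_ge0//.
  by rewrite ler_weXn2l// ler1n.
by apply: le_trans (hC _ _ _ nM e1) _; rewrite lerDl.
Qed.

End multiplier.

Definition bcoef f j k : R[i] := (dy j k%:~R)%:C * fourier_coef f k.

Lemma lp_blockE f j n : (2 ^ j.+1 <= n)%N -> lp_block phi0 phi1 f j = trig (bcoef f j) n.
Proof.
move=> jn; apply/funext => x; rewrite /lp_block /trig -fsbig_zsum.
apply/esym/fsbig_widen => // k [_] /= kn.
have [d0|d0] := eqVneq (dy j k%:~R) 0; last first.
  exfalso; apply: kn; have := dyadic_support d0.
  rewrite -intr_norm -natrX -[X in _ <= X]/((2 ^ j.+1)%N%:Z%:~R) ler_int => /le_trans; apply.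
  by rewrite lez_nat.
have Z : bcoef f j k * expk k x = 0 by rewrite /bcoef d0 !mul0r.
exact: Z.
Qed.

(** On the block of index [j + 1], the weight [(1 + k ^+ 2) `^ (gamma / 2)] is
    [2 ^ (j * gamma)] times a smooth function of [2 ^- j * k], taken from a
    family with uniformly bounded derivatives. Translation superposition then
    bounds its action on the block. *)
Lemma block_multiplier (gamma p : R) : 0 < p -> exists2 C : R, 0 < C &
  forall f j, distribution_T f ->
  Lpow p (lp_block phi0 phi1 (sobolev_op gamma f) j.+1) <=
  C * ((4 ^+ j) `^ (gamma / 2)) `^ p * Lpow p (lp_block phi0 phi1 f j.+1).
Proof.
move=> p0; have [M [C C0 hC]] := translation_multiplier p0.
have [B B0 hB] := sobolev_multD_bound gamma M.
exists (C * B `^ p) => [|f j df]; first by rewrite mulr_gt0// powR_gt0.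
pose n := (2 ^ j.+2)%N.
rewrite !(@lp_blockE _ _ n)//.
pose e : R := 4 ^- j.
have p4 : 0 < 4 ^+ j :> R by rewrite exprn_gt0.
have e1 : 0 < e <= 1.
  by rewrite invr_gt0 p4 /= invf_le1// exprn_ege1// ler1n.
pose tau : R := 2 ^- j / 64.
have p2 : 0 < 2 ^+ j :> R by rewrite exprn_gt0.
pose w : R := (4 ^+ j) `^ (gamma / 2).
have htau k : bcoef f j.+1 k != 0 -> `|k%:~R * tau| <= 1 / 4.
  move=> bk; have d0 : dy j.+1 k%:~R != 0.
    by apply: contraNneq bk => d0; rewrite /bcoef d0 mul0r.
  have /andP[_ H] := phi1_support d0.
  rewrite /tau mulrCA mulrA mulrC normrM [X in X * _]ger0_norm ?invr_ge0//.
  by move: H; rewrite mulrC; set z := `|_|; lra.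
have := hC _ B (sobolev_multD_family gamma e1) (fun m => sobolev_multD_boundary gamma m e1)
  (fun m t mM => hB e m t mM e1) _ n tau htau.
set T := trig _ n => H.
have -> : trig (bcoef (sobolev_op gamma f) j.+1) n = fun x => w%:C * T x.
  apply/funext => x; rewrite /T /trig -zsumZ; apply: eq_zsum => k.
  rewrite /bcoef sobolev_coef//.
  have [d0|d0] := eqVneq (dy j.+1 k%:~R) 0; first by rewrite d0 !(mul0r, mulr0).
  have E : 64 * (1 / 2 + k%:~R * tau) - 32 = 2 ^- j * k%:~R.
    by rewrite /tau; field; rewrite gt_eqF.
  rewrite /sobolev_multD /= expr0 mul1r E sobolev_mult_phi1//.
  have -> : sobolev_weight gamma k = w * (e + (2 ^- j * k%:~R) ^+ 2) `^ (gamma / 2).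
    rewrite /sobolev_weight /w -powRM ?(ltW p4)//; last first.
      by rewrite addr_ge0 ?sqr_ge0// invr_ge0 ltW.
    congr (_ `^ _); rewrite mulrDr mulfV ?gt_eqF// exprMn exprVn -exprM.
    have -> : 2 ^+ (j * 2) = 4 ^+ j :> R by rewrite mulnC exprM -natrX.
    by rewrite mulrA mulfV ?gt_eqF// mul1r.
  by rewrite rmorphM /=; ring.
have bT : cbm T by exact/ccontinuous_cbm/trig_continuous.
rewrite {1}/Lpow (_ : (fun x => _) = fun x => w `^ p * cmodulus (T x) `^ p); last first.
  apply/funext => x; rewrite cmodM cmodR ger0_norm ?powR_ge0//.
  by rewrite powRM ?powR_ge0 ?cmod_ge0.
rewrite rintZ; last exact: bm_Lpow.
rewrite -/(Lpow p T) -/w mulrAC -mulrA [leRHS]mulrC -mulrA.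
have wp : 0 <= w `^ p := powR_ge0 _ _.
apply: le_trans (ler_wpM2l wp H) _; apply: le_of_eq.
by ring.
Qed.

End blocks.

(** * The critical smoothness *)

Section critical.
Context {R : realType} (phi0 phi1 : R -> R).
Hypothesis hphi : littlewood_paley phi0 phi1.
Local Notation dy := (dyadic phi0 phi1).
Local Notation blk := (lp_block phi0 phi1).
Implicit Types (k l : int) (x y s : R) (p q : \bar R) (f : (R -> R[i]) -> R[i]).

Definition dyad s (j : nat) : R := locked (2 `^ (j%:R * s)).

Lemma dyadE s j : dyad s j = 2 `^ (j%:R * s).
Proof. by rewrite /dyad -lock. Qed.

Lemma dyad_gt0 s j : 0 < dyad s j.
Proof. by rewrite dyadE powR_gt0. Qed.

Lemma dyad_ge0 s j : 0 <= dyad s j.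
Proof. exact/ltW/dyad_gt0. Qed.

Lemma dyadD s t j : dyad (s + t) j = dyad s j * dyad t j.
Proof. by rewrite !dyadE mulrDr powRD//; apply/implyP => _; rewrite pnatr_eq0. Qed.

Lemma dyadN s j : dyad (- s) j = (dyad s j)^-1.
Proof. by rewrite !dyadE mulrN powRN. Qed.

Lemma dyad_le s t j : s <= t -> dyad s j <= dyad t j.
Proof. by move=> st; rewrite !dyadE ler_powR ?ler1n// ler_wpM2l. Qed.

Lemma dyadM s r j : dyad (s * r) j = dyad s j `^ r.
Proof. by rewrite !dyadE mulrA powRrM. Qed.

Lemma dyad_nat (n j : nat) : dyad n%:R j = (2 ^+ j) ^+ n.
Proof. by rewrite !dyadE powRrM !powR_mulrn// ?exprn_ge0// powR_ge0. Qed.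

Lemma dyadS s j : dyad s j.+1 = 2 `^ s * dyad s j.
Proof.
rewrite !dyadE -[j.+1%:R]natr1 mulrDl mul1r powRD 1?mulrC//.
by apply/implyP => _; rewrite pnatr_eq0.
Qed.

Lemma blk_trig f j : blk f j = trig (bcoef phi0 phi1 f j) (2 ^ j.+1).
Proof. exact: lp_blockE. Qed.

Lemma blk_continuous f j : ccontinuous (blk f j).
Proof. by rewrite blk_trig; exact: trig_continuous. Qed.

Lemma blk_cbm f j : cbm (blk f j).
Proof. exact/ccontinuous_cbm/blk_continuous. Qed.

Lemma blk_periodic f j x : blk f j (x + 1) = blk f j x.
Proof. by rewrite blk_trig trig_periodic. Qed.

Definition block_norm p f j : R := fine (Lp_torus p (blk f j)).

Lemma block_normE p f j : (0 < p)%E -> Lp_torus p (blk f j) = (block_norm p f j)%:E.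
Proof.
move=> p0; rewrite /block_norm fineK//.
case: p p0 => [r| |]// r0.
  by rewrite Lp_torus_fin//; exact: blk_continuous.
have [B B0 hB] := periodic_bounded (blk_continuous f j) (blk_periodic f j).
rewrite ge0_fin_numE ?Lp_torus_ge0//.
by apply: le_lt_trans (Lp_torus_le_sup hB) _; rewrite ltry.
Qed.

Lemma block_norm_ge0 p f j : 0 <= block_norm p f j.
Proof. by rewrite /block_norm fine_ge0// Lp_torus_ge0. Qed.

Lemma block_norm_fin (r : R) f j : 0 < r -> block_norm r%:E f j = Lpow r (blk f j) `^ r^-1.
Proof. by move=> r0; rewrite /block_norm Lp_torus_fin//; exact: blk_continuous. Qed.

Lemma Lpow_block_norm (r : R) f j : 0 < r -> Lpow r (blk f j) = block_norm r%:E f j `^ r.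
Proof. by move=> r0; rewrite block_norm_fin// powRVK ?Lpow_ge0. Qed.

Lemma Lpow_le_block_norm (r Y : R) f j : 0 < r -> 0 < Y -> block_norm r%:E f j <= Y ->
  Lpow r (blk f j) <= Y `^ r.
Proof.
move=> r0 Y0 nY; rewrite Lpow_block_norm//.
by apply: ge0_ler_powR; rewrite ?nnegrE ?block_norm_ge0 ?(ltW r0) ?(ltW Y0).
Qed.

Lemma block_norm_mono (r : R) f j : 0 < r -> block_norm r%:E f j <= block_norm +oo f j.
Proof.
move=> r0; rewrite -lee_fin -!block_normE//.
by apply: Lp_torus_mono => //; exact: blk_continuous.
Qed.

(** Nikolskii's inequality on a block, which contains of the order of [2 ^ j]
    frequencies. *)
Lemma block_norm_bernstein (r : R) : 0 < r -> exists2 C : R, 0 < C &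
  forall f j, block_norm +oo f j <= C * dyad r^-1 j * block_norm r%:E f j.
Proof.
move=> r0; have [C C0 hC] := nikolskii r0.
exists ((4 * C) `^ r^-1) => [|f j]; first by rewrite powR_gt0// mulr_gt0.
rewrite -lee_fin -block_normE//; apply: Lp_torus_le_sup => x.
have := hC (bcoef phi0 phi1 f j) (2 ^ j.+1)%N x; rewrite -blk_trig => H.
rewrite block_norm_fin// -(powRK r0 (cmod_ge0 (blk f j x))).
have -> : dyad r^-1 j = (2 ^+ j) `^ r^-1 by rewrite dyadE powRrM powR_mulrn.
rewrite -powRM ?mulr_ge0 ?exprn_ge0 ?(ltW C0)// -powRM; last 2 first.
- by rewrite !mulr_ge0 ?exprn_ge0 ?(ltW C0).
- exact: Lpow_ge0.
rewrite ge0_ler_powR ?nnegrE ?powR_ge0 ?invr_ge0 ?(ltW r0)//.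
  by rewrite !mulr_ge0 ?exprn_ge0 ?Lpow_ge0 ?(ltW C0).
apply: le_trans H _; rewrite ler_wpM2r ?Lpow_ge0//.
rewrite [4 * C]mulrC -mulrA ler_pM2l// -[(2 ^ j.+1).+1%:R]natr1 natrX exprS.
have : 1 <= 2 ^+ j :> R by rewrite exprn_ege1// ler1n.
by lra.
Qed.

(** The smoothness exponents for which the Besov norm with [q = +oo] is
    finite. Passing to another [q] costs an arbitrarily small amount of
    smoothness, which the supremum does not see. *)
Definition besov_exps p f : set R := [set s | exists K, forall j, dyad s j * block_norm p f j <= K].

Lemma besov_exps_pos p f s : besov_exps p f s -> exists2 K, 0 < K &
  forall j, dyad s j * block_norm p f j <= K.
Proof.
move=> [K hK]; exists (`|K| + 1); first by rewrite ltr_wpDl.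
by move=> j; apply: le_trans (hK j) _; rewrite ler_wpDr// ler_norm.
Qed.

Lemma besov_exps_le p f s : besov_exps p f s -> forall t, t <= s -> besov_exps p f t.
Proof.
move=> [K hK] t ts; exists K => j; apply: le_trans (hK j).
by rewrite ler_wpM2r ?block_norm_ge0 ?dyad_le.
Qed.

Lemma geometric_bound (r : R) (n : nat) : 0 < r < 1 -> \sum_(0 <= j < n) r ^+ j <= (1 - r)^-1.
Proof.
move=> /andP[r0 r1].
have r10 : 0 < 1 - r by rewrite subr_gt0.
rewrite -[leRHS]mul1r ler_pdivlMr// mulrC big_mkord.
by rewrite -(opprB r 1) mulNr -subrX1 opprB gerBl exprn_ge0// ltW.
Qed.

Lemma in_besov_exps p q f s : (0 < p)%E -> (0 < q)%E ->
  in_besov phi0 phi1 p q s f -> besov_exps p f s.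
Proof.
move=> p0 q0 [_]; rewrite /besov_norm.
have E j : ((2 `^ (j%:R * s))%:E * Lp_torus p (blk f j) = (dyad s j * block_norm p f j)%:E)%E.
  by rewrite dyadE block_normE.
case: q q0 => [r| |]// r0 H.
  rewrite lte_fin in r0.
  have r1 : r^-1 != 0 by rewrite invr_eq0 gt_eqF.
  have {}H := lty_poweRy r1 H.
  have term j : ((2 `^ (j%:R * s * r))%:E * Lp_torus p (blk f j) `^ r =
      ((dyad s j * block_norm p f j) `^ r)%:E)%E.
    rewrite block_normE// poweR_EFin -EFinM powRM ?dyad_ge0 ?block_norm_ge0//.
    by rewrite dyadE powRrM.
  have t0 j : (0 <= (2 `^ (j%:R * s * r))%:E * Lp_torus p (blk f j) `^ r)%E.
    by rewrite term lee_fin powR_ge0.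
  move: H; set S := (\sum_(0 <= j <oo) _)%E => H.
  have S0 : (0 <= S)%E by apply: nneseries_ge0 => j _ _; exact: t0.
  have SE : S = (fine S)%:E by rewrite fineK// ge0_fin_numE.
  exists (fine S `^ r^-1) => j.
  have : (((dyad s j * block_norm p f j) `^ r)%:E <= S)%E.
    apply: le_trans (nneseries_lim_ge (m := 0%N) (P := xpredT) j.+1 (fun n _ _ => t0 n)).
    rewrite big_nat_recr//= term; apply: leeDr.
    by apply: sume_ge0 => i _; exact: t0.
  rewrite SE lee_fin => H2.
  have b0 : 0 <= dyad s j * block_norm p f j by rewrite mulr_ge0 ?dyad_ge0 ?block_norm_ge0.
  rewrite -[leLHS](powRK r0 b0).
  have fS : 0 <= fine S by rewrite fine_ge0.
  by rewrite ge0_ler_powR ?nnegrE ?powR_ge0 ?invr_ge0 ?(ltW r0).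
move: H; set S := ereal_sup _ => H.
have S0 : (0 <= S)%E.
  apply: (@le_trans _ _ (dyad s 0 * block_norm p f 0)%:E).
    by rewrite lee_fin mulr_ge0 ?dyad_ge0 ?block_norm_ge0.
  by apply: ereal_sup_ubound; exists 0%N => //; exact: E.
exists (fine S) => j; rewrite -lee_fin fineK ?ge0_fin_numE//.
by apply: ereal_sup_ubound; exists j => //; exact: E.
Qed.

(** The gap [s - t] provides a convergent geometric series. *)
Lemma exps_in_besov p q f s t : (0 < p)%E -> (0 < q)%E -> distribution_T f ->
  besov_exps p f s -> t < s -> in_besov phi0 phi1 p q t f.
Proof.
move=> p0 q0 df Bs ts; split=> //; rewrite /besov_norm.
have [K K0 hK] := besov_exps_pos Bs.
case: q q0 => [r| |]// r0; last first.
  apply: (@le_lt_trans _ _ K%:E); last exact: ltry.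
  apply: ge_ereal_sup => _ [j _ <-].
  rewrite block_normE// -EFinM lee_fin -dyadE; apply: le_trans (hK j).
  by rewrite ler_wpM2r ?block_norm_ge0// dyad_le// ltW.
rewrite lte_fin in r0.
apply: poweR_lty.
pose rho : R := 2 `^ (- ((s - t) * r)).
have rho01 : 0 < rho < 1.
  rewrite powR_gt0//= /rho powRN invf_lt1 ?powR_gt0//.
  rewrite -[ltLHS](@powRr0 R 2) /powR !pnatr_eq0 /= ltr_expR mul0r.
  by rewrite mulr_gt0 ?mulr_gt0 ?subr_gt0// ln_gt0// ltr1n.
have term j : ((2 `^ (j%:R * t * r))%:E * Lp_torus p (blk f j) `^ r <=
      (K `^ r * rho ^+ j)%:E)%E.
  rewrite block_normE// poweR_EFin -EFinM lee_fin.
  have -> : 2 `^ (j%:R * t * r) = dyad s j `^ r * rho ^+ j.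
    rewrite /rho -powR_mulrn ?powR_ge0// !dyadE -!powRrM -powRD; last first.
      by apply/implyP => _; rewrite pnatr_eq0.
    by congr (_ `^ _); ring.
  rewrite mulrAC ler_wpM2r ?exprn_ge0 ?powR_ge0//.
  rewrite -powRM ?dyad_ge0 ?block_norm_ge0// ge0_ler_powR ?nnegrE ?(ltW r0)// ?(ltW K0)//.
  by rewrite mulr_ge0 ?dyad_ge0 ?block_norm_ge0.
have t0 j : (0 <= (2 `^ (j%:R * t * r))%:E * Lp_torus p (blk f j) `^ r)%E.
  by rewrite block_normE// poweR_EFin -EFinM lee_fin mulr_ge0 ?powR_ge0.
apply: (@le_lt_trans _ _ (K `^ r * (1 - rho)^-1)%:E); last exact: ltry.
apply: lime_le; first by apply: is_cvg_nneseries => j _ _; exact: t0.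
apply: nearW => n.
apply: (@le_trans _ _ (\sum_(0 <= j < n) (K `^ r * rho ^+ j)%:E)%E).
  by apply: lee_sum => j _; exact: term.
rewrite sumEFin lee_fin -mulr_sumr ler_wpM2l ?powR_ge0//.
exact: geometric_bound.
Qed.

Definition crit_exp p f : \bar R := ereal_sup [set s%:E | s in besov_exps p f].

Lemma crit_exp_ub p f s : besov_exps p f s -> (s%:E <= crit_exp p f)%E.
Proof. by move=> Bs; apply: ereal_sup_ubound; exists s. Qed.

Lemma critical_smoothnessE p q f : (0 < p)%E -> (0 < q)%E -> distribution_T f ->
  critical_smoothness phi0 phi1 q f p = crit_exp p f.
Proof.
move=> p0 q0 df; apply/eqP; rewrite eq_le; apply/andP; split.
  apply: ge_ereal_sup => _ [s /= bs <-]; apply: crit_exp_ub.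
  exact: in_besov_exps bs.
apply: ge_ereal_sup => _ [s /= Bs <-].
apply/lee_subgt0Pr => e e0; rewrite -EFinB.
apply: ereal_sup_ubound; exists (s - e) => //=.
by apply: (exps_in_besov p0 q0 df Bs); rewrite ltrBlDr ltrDl.
Qed.

(** ** Interpolation and embeddings *)

(** Interpolation of Lebesgue norms on each block: this is the concavity of
    the critical smoothness in [1 / p]. *)
Lemma besov_exps_interp f (r r0 r1 t s0 s1 : R) : 0 < r -> 0 < r0 -> 0 < r1 -> 0 < t < 1 ->
  r^-1 = (1 - t) / r0 + t / r1 ->
  besov_exps r0%:E f s0 -> besov_exps r1%:E f s1 -> besov_exps r%:E f ((1 - t) * s0 + t * s1).
Proof.
move=> rp r0p r1p t01 rE B0 B1.
have [K0 K00 h0] := besov_exps_pos B0; have [K1 K10 h1] := besov_exps_pos B1.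
exists (K0 `^ (1 - t) * K1 `^ t) => j.
have [Y0 Y0E] : exists Y, Y = K0 / dyad s0 j by eexists.
have [Y1 Y1E] : exists Y, Y = K1 / dyad s1 j by eexists.
have Y00 : 0 < Y0 by rewrite Y0E divr_gt0 ?dyad_gt0.
have Y10 : 0 < Y1 by rewrite Y1E divr_gt0 ?dyad_gt0.
have n0 : block_norm r0%:E f j <= Y0 by rewrite Y0E ler_pdivlMr ?dyad_gt0// mulrC.
have n1 : block_norm r1%:E f j <= Y1 by rewrite Y1E ler_pdivlMr ?dyad_gt0// mulrC.
have L0 : Lpow r0 (blk f j) <= Y0 `^ r0 by exact: Lpow_le_block_norm.
have L1 : Lpow r1 (blk f j) <= Y1 `^ r1 by exact: Lpow_le_block_norm.
have := Lpow_hoelder (blk_cbm f j) rp r0p r1p t01 rE.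
move=> /(_ _ _ (powR_gt0 _ Y00) (powR_gt0 _ Y10) L0 L1) H.
have nr : block_norm r%:E f j <= Y0 `^ (1 - t) * Y1 `^ t.
  rewrite block_norm_fin//.
  rewrite (_ : Y0 `^ (1 - t) * Y1 `^ t = (Y0 `^ r0 `^ (r * (1 - t) / r0) *
      Y1 `^ r1 `^ (r * t / r1)) `^ r^-1).
    rewrite ge0_ler_powR ?nnegrE ?Lpow_ge0 ?invr_ge0 ?(ltW rp)//.
    by rewrite mulr_ge0 ?powR_ge0.
  rewrite (powRM r^-1 (powR_ge0 _ _) (powR_ge0 _ _)).
  rewrite -(powRrM Y0 r0) -(powRrM Y0 _ r^-1) -(powRrM Y1 r1) -(powRrM Y1 _ r^-1).
  by congr (_ `^ _ * _ `^ _); field; rewrite !gt_eqF.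
apply: le_trans (ler_wpM2l (dyad_ge0 _ _) nr) _.
have M0 : dyad s0 j `^ (1 - t) * Y0 `^ (1 - t) = K0 `^ (1 - t).
  rewrite -(powRM (1 - t) (dyad_ge0 s0 j) (ltW Y00)) Y0E mulrC divfK//.
  by rewrite gt_eqF// dyad_gt0.
have M1 : dyad s1 j `^ t * Y1 `^ t = K1 `^ t.
  rewrite -(powRM t (dyad_ge0 s1 j) (ltW Y10)) Y1E mulrC divfK//.
  by rewrite gt_eqF// dyad_gt0.
have -> : dyad ((1 - t) * s0 + t * s1) j = dyad s0 j `^ (1 - t) * dyad s1 j `^ t.
  by rewrite dyadD -(dyadM s0) -(dyadM s1) (mulrC s0) (mulrC s1).
move: (dyad s0 j `^ (1 - t)) (dyad s1 j `^ t) (Y0 `^ (1 - t)) (Y1 `^ t) M0 M1.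
by move=> a b c d M0 M1; rewrite mulrACA M0 M1.
Qed.

Lemma besov_exps_embed f (r s : R) : 0 < r -> besov_exps +oo f s -> besov_exps r%:E f s.
Proof.
move=> r0 [K hK]; exists K => j; apply: le_trans (hK j).
by rewrite ler_wpM2l ?dyad_ge0 ?block_norm_mono.
Qed.

Lemma besov_exps_bernstein f (r s : R) : 0 < r ->
  besov_exps r%:E f s -> besov_exps +oo f (s - r^-1).
Proof.
move=> r0 [K hK]; have [C C0 hC] := block_norm_bernstein r0.
exists (C * K) => j.
apply: le_trans (ler_wpM2l (dyad_ge0 _ _) (hC f j)) _.
rewrite (_ : dyad _ _ * _ = C * (dyad s j * block_norm r%:E f j)).
  by rewrite ler_pM2l.
rewrite dyadD dyadN; field.
by rewrite gt_eqF// dyad_gt0.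
Qed.

Lemma besov_exps_sobolev f (gamma r s : R) : 0 < r -> distribution_T f ->
  besov_exps r%:E f s -> besov_exps r%:E (sobolev_op gamma f) (s - gamma).
Proof.
move=> r0 df Bs; have [K K0 hK] := besov_exps_pos Bs.
have [C C0 hC] := block_multiplier hphi gamma r0.
exists (dyad (s - gamma) 0 * block_norm r%:E (sobolev_op gamma f) 0 +
  2 `^ (- gamma) * C `^ r^-1 * K) => -[|j].
  by rewrite lerDl !mulr_ge0 ?powR_ge0 ?(ltW K0).
have P0 : 0 <= dyad (s - gamma) 0 * block_norm r%:E (sobolev_op gamma f) 0.
  by rewrite mulr_ge0 ?dyad_ge0 ?block_norm_ge0.
apply: ler_wpDl => //.
have H : block_norm r%:E (sobolev_op gamma f) j.+1 <=
    C `^ r^-1 * dyad gamma j * block_norm r%:E f j.+1.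
  rewrite !block_norm_fin//.
  have -> : dyad gamma j = (((4 ^+ j) `^ (gamma / 2)) `^ r) `^ r^-1.
    rewrite powRK ?powR_ge0// dyadE (_ : 4 ^+ j = 2 `^ (j * 2)%:R).
      by rewrite -powRrM; congr (_ `^ _); rewrite natrM; field.
    rewrite powR_mulrn// mulnC exprM; congr (_ ^+ _).
    by rewrite -natrX.
  rewrite -powRM ?powR_ge0 ?(ltW C0)// -powRM ?Lpow_ge0//; last first.
    by rewrite mulr_ge0 ?powR_ge0 ?(ltW C0).
  rewrite ge0_ler_powR ?nnegrE ?Lpow_ge0 ?invr_ge0 ?(ltW r0)//.
    by rewrite !mulr_ge0 ?powR_ge0 ?Lpow_ge0 ?(ltW C0).
  exact: hC.
apply: le_trans (ler_wpM2l (dyad_ge0 _ _) H) _.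
have -> : dyad (s - gamma) j.+1 * (C `^ r^-1 * dyad gamma j * block_norm r%:E f j.+1) =
   2 `^ (- gamma) * C `^ r^-1 * (dyad s j.+1 * block_norm r%:E f j.+1).
  have g2 : 2 `^ gamma != 0 :> R by rewrite gt_eqF// powR_gt0.
  have gj : dyad gamma j != 0 by rewrite gt_eqF// dyad_gt0.
  rewrite dyadD dyadN (dyadS gamma) powRN; field.
  by rewrite ?g2 ?gj.
by rewrite ler_wpM2l ?mulr_ge0 ?powR_ge0.
Qed.

Lemma besov_exps_coef f g p : (forall k, fourier_coef f k = fourier_coef g k) ->
  besov_exps p f = besov_exps p g.
Proof.
move=> fg; have E j : blk f j = blk g j.
  rewrite !blk_trig; congr trig; apply/funext => k.
  by rewrite /bcoef fg.
by rewrite /besov_exps /block_norm; apply/seteqP; split=> s [K hK]; exists K => j;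
  [rewrite -E|rewrite E]; exact: hK.
Qed.

(** For [p = +oo] the multiplier bound is not available directly. Going down
    to the exponent [1 / e] and back costs [e] units of smoothness by
    Bernstein's inequality. *)
Lemma crit_exp_sobolev_ge f (gamma : R) p : (0 < p)%E -> distribution_T f ->
  forall s, besov_exps p f s -> ((s - gamma)%:E <= crit_exp p (sobolev_op gamma f))%E.
Proof.
case: p => [r| |]// r0 df s Bs.
  by apply: crit_exp_ub; apply: besov_exps_sobolev.
apply/lee_subgt0Pr => e e0; rewrite -EFinB; apply: crit_exp_ub.
have e1 : 0 < e^-1 by rewrite invr_gt0.
have := besov_exps_bernstein e1 (besov_exps_sobolev gamma e1 df (besov_exps_embed e1 Bs)).
by rewrite invrK.
Qed.

(** The operators of orders [gamma] and [- gamma] are inverse to each other,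
    so the lower bound for both gives the equality. *)
Lemma crit_exp_sobolev f (gamma : R) p : (0 < p)%E -> distribution_T f ->
  crit_exp p (sobolev_op gamma f) = (crit_exp p f - gamma%:E)%E.
Proof.
move=> p0 df; have dLf := sobolev_distribution gamma df.
have back : besov_exps p (sobolev_op (- gamma) (sobolev_op gamma f)) = besov_exps p f.
  apply: besov_exps_coef => k; rewrite sobolev_coef// sobolev_coef// mulrA.
  by rewrite -rmorphM /= sobolev_weightD addNr sobolev_weight0 mul1r.
have backc : crit_exp p (sobolev_op (- gamma) (sobolev_op gamma f)) = crit_exp p f.
  by rewrite /crit_exp back.
apply/eqP; rewrite eq_le; apply/andP; split.
  apply: ge_ereal_sup => _ [s Bs <-].
  have := crit_exp_sobolev_ge (- gamma) p0 dLf Bs; rewrite backc opprK EFinD.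
  by rewrite leeBrDr.
rewrite leeBlDr//; apply: ge_ereal_sup => _ [s Bs <-].
rewrite -leeBlDr// -EFinB.
exact: crit_exp_sobolev_ge.
Qed.

(** ** Finiteness *)

Lemma hat_trig (a : int -> R[i]) n k : (absz k <= n)%N -> hat (trig a n) k = a k.
Proof.
move=> kn; rewrite /hat.
have -> : (fun x => expk (- k) x * trig a n x) =
   fun x => zsum (fun l => a l * expk (l - k) x) n.
  apply/funext => x; rewrite /trig -zsumZ; apply: eq_zsum => l.
  by rewrite (expkD l (- k)); ring.
rewrite cint_zsum; last by move=> l; apply: cbmM; [exact: cbm_cst|exact: cbm_expk].
have E l : cintegral01 (fun x => a l * expk (l - k) x) = if l == k then a k else 0.
  rewrite cintZ ?cint_expk; last exact: cbm_expk.
  by rewrite subr_eq0; case: eqP => [->|]; rewrite ?mulr1 ?mulr0.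
by rewrite (eq_zsum _ E) zsum_delta.
Qed.

Lemma bcoef_le f j k : cmodulus (bcoef phi0 phi1 f j k) <= 2 * block_norm +oo f j.
Proof.
have [kn|kn] := leqP (absz k) (2 ^ j.+1); last first.
  rewrite /bcoef; have [->|d0] := eqVneq (dy j k%:~R) 0.
    by rewrite mul0r cmod0 mulr_ge0 ?block_norm_ge0.
  exfalso; move: kn; rewrite ltnNge => /negP; apply.
  rewrite -(@ler_nat R) natrX; apply: le_trans (dyadic_support hphi d0).
  by rewrite -intr_norm -abszE.
rewrite -(hat_trig (bcoef phi0 phi1 f j) kn) -blk_trig.
have b1 : cbm (fun x => expk (- k) x * blk f j x).
  by apply: cbmM; [exact: cbm_expk|exact: blk_cbm].
apply: le_trans (cmod_cint b1) _; rewrite ler_pM2l//.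
apply: le_trans (block_norm_mono f j ltr01).
rewrite block_norm_fin// invr1 powRr1 ?Lpow_ge0//.
apply: le_of_eq; congr rint.
by apply/funext => x; rewrite cmodM cmod_expk mul1r powRr1 ?cmod_ge0.
Qed.

(** The Fourier coefficients of a distribution grow at most like a power of
    the frequency, hence the blocks at most like a power of [2 ^ j]. *)
Lemma besov_exps_nonempty f : distribution_T f -> exists s, besov_exps +oo f s.
Proof.
move=> df; have [N [C C0 hC]] := coef_growth df.
have [M ME] : exists M, M = N.+2 by eexists.
exists (- (M%:R)), (C * 9 ^+ M) => j.
pose n := (2 ^ j.+1)%N.
have sup x : cmodulus (blk f j x) <= C * 9 ^+ M * dyad M%:R j.
  rewrite blk_trig; apply: le_trans (cmod_zsum _ _) _.
  apply: (@le_trans _ _ (zsum (fun k => C * n.+1%:R ^+ M * (zabs k ^+ 2)^-1) n)).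
    apply: zsum_le => k kn; rewrite !cmodM cmod_expk mulr1 cmodR.
    rewrite ger0_norm ?dyadic_ge0//.
    have H1 : cmodulus (fourier_coef f k) <= C * zabs k ^+ N.
      by have := hC (- k); rewrite zabsN.
    apply: le_trans (ler_pM (dyadic_ge0 hphi _ _) (cmod_ge0 _) (dyadic_le1 hphi _ _) H1) _.
    have zp := @zabs_gt0 R k.
    rewrite mul1r -mulrA ler_pM2l// ler_pdivlMr ?exprn_gt0// -exprD addn2 -ME.
    rewrite lerXn2r ?nnegrE ?(ltW zp)//.
    by rewrite /zabs -intr_norm -[n.+1%:R]natr1 addrC lerD2r -abszE ler_nat.
  rewrite zsumZ.
  have zn : n.+1%:R <= 2 * 2 ^+ j + 1 :> R by rewrite -[n.+1%:R]natr1 natrX exprS.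
  have j1 : 1 <= 2 ^+ j :> R by rewrite exprn_ege1// ler1n.
  apply: (@le_trans _ _ (C * n.+1%:R ^+ M * 3)).
    by rewrite ler_wpM2l ?zsum_zabs3// mulr_ge0 ?exprn_ge0 ?(ltW C0).
  rewrite -!mulrA ler_pM2l// dyad_nat -(exprMn M 9).
  have n3 : n.+1%:R <= 3 * 2 ^+ j :> R by lra.
  apply: (@le_trans _ _ ((3 * 2 ^+ j) ^+ M * 3)).
    by rewrite ler_wpM2r// lerXn2r ?nnegrE ?mulr_ge0 ?exprn_ge0.
  rewrite !exprMn mulrAC ler_wpM2r ?exprn_ge0//.
  have -> : 9 = 3 * 3 :> R by rewrite -natrM.
  rewrite exprMn ler_pM2l ?exprn_gt0//.
  by rewrite ler_eXnr ?ME// ler1n.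
rewrite dyadN mulrC ler_pdivrMr ?dyad_gt0//.
by rewrite -lee_fin -block_normE//; apply: Lp_torus_le_sup.
Qed.

End critical.

(** * The critical smoothness as a function of the reciprocal exponent *)

Section smooth_exponent.
Context {R : realType} (phi0 phi1 : R -> R).
Hypothesis hphi : littlewood_paley phi0 phi1.
Local Notation dy := (dyadic phi0 phi1).
Local Notation blk := (lp_block phi0 phi1).
Local Notation Bs := (besov_exps phi0 phi1).
Local Notation cr := (crit_exp phi0 phi1).
Implicit Types (k l : int) (x y s u v t : R) (p q : \bar R) (f : (R -> R[i]) -> R[i]).

(** A Fourier coefficient is a sum of coefficients of blocks, each bounded by the
    norm of its block. As the frequencies of the block of index [j] are at most
    of the order of [2 ^ j], decay of the blocks in [j] is decay of the
    coefficients in the frequency. *)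
Lemma besov_exps_unbounded_smooth f : distribution_T f ->
  (forall m : nat, Bs +oo%E f m%:R) -> is_smooth_distribution f.
Proof.
move=> df hB; apply: (rapid_smooth df) => m.
have [K K0 hK] := besov_exps_pos (hB m.+1).
exists (2 * (2 * K * 4 ^+ m)) => [|k].
  by rewrite !mulr_ge0 ?exprn_ge0 ?(ltW K0).
have z0 : 0 < zabs k ^+ m :> R by rewrite exprn_gt0// zabs_gt0.
rewrite ler_pdivlMr//.
pose J := (absz k + 2)%N.
have hJ j : (J <= j)%N -> dy j k%:~R = 0.
  case: j => [|j] Jj; first by exfalso; move: Jj; rewrite /J; lia.
  apply/eqP; apply: contraTT Jj => /(dyadic_support_low hphi) H.
  rewrite -ltnNge /J; move: H; rewrite -intr_norm -natrX -abszE ler_nat => H.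
  by have := leq_trans (ltn_expl j (isT : (1 < 2)%N)) H; lia.
have fE : fourier_coef f k = \sum_(j < J) bcoef phi0 phi1 f j k.
  rewrite /bcoef -mulr_suml.
  have -> : \sum_(j < J) (dy j k%:~R)%:C = (\sum_(j < J) dy j k%:~R)%:C.
    by rewrite rmorph_sum.
  by rewrite (dyadic_partial_eq hphi hJ) mul1r.
rewrite fE; apply: le_trans (ler_wpM2r (ltW z0) (cmod_sum _ _ _)) _.
rewrite mulr_suml.
have term (j : 'I_J) : true -> cmodulus (bcoef phi0 phi1 f j k) * zabs k ^+ m <=
    2 * K * 4 ^+ m * (1 / 2) ^+ j.
  move=> _; have p2 : 0 < 2 ^+ j :> R by rewrite exprn_gt0.
  have j1 : 1 <= 2 ^+ j :> R by rewrite exprn_ege1// ler1n.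
  have [d0|d0] := eqVneq (dy j k%:~R) 0.
    by rewrite /bcoef d0 mul0r cmod0 mul0r !mulr_ge0 ?exprn_ge0 ?(ltW K0)// divr_ge0.
  have zk : zabs k <= 4 * 2 ^+ j :> R.
    by have := dyadic_support hphi d0; rewrite exprS /zabs; lra.
  have zm : zabs k ^+ m <= 4 ^+ m * (2 ^+ j) ^+ m :> R.
    by rewrite -exprMn lerXn2r ?nnegrE ?(ltW (zabs_gt0 _)) ?mulr_ge0 ?exprn_ge0.
  have b1 := bcoef_le hphi f j k.
  have n1 : block_norm phi0 phi1 +oo f j <= K / (2 ^+ j) ^+ m.+1.
    by rewrite ler_pdivlMr ?exprn_gt0// mulrC -dyad_nat.
  have b2 : cmodulus (bcoef phi0 phi1 f j k) <= 2 * (K / (2 ^+ j) ^+ m.+1).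
    by apply: le_trans b1 _; rewrite ler_pM2l.
  apply: le_trans (ler_pM (cmod_ge0 _) (ltW z0) b2 zm) _.
  apply: le_of_eq.
  rewrite (exprS _ m) expr_div_n expr1n; field.
  by rewrite expf_neq0 gt_eqF.
apply: le_trans (ler_sum _ term) _.
rewrite -mulr_sumr mulrC ler_wpM2r//.
  by rewrite !mulr_ge0 ?exprn_ge0 ?(ltW K0).
have h01 : ((0 : R) < 1 / 2) && ((1 / 2 : R) < 1) by apply/andP; split; lra.
have := geometric_bound J h01; rewrite big_mkord => /le_trans; apply.
by rewrite (_ : 1 - 1 / 2 = 2^-1 :> R) ?invrK//; field.
Qed.

(** Taking [fine] loses nothing for a distribution that is not smooth
    ([crit_expE]). *)
Definition smooth_exp f u : R := fine (cr (u%:E^-1)%E f).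

Section nonsmooth.
Variable f : (R -> R[i]) -> R[i].
Hypothesis df : distribution_T f.
Hypothesis hns : ~ is_smooth_distribution f.
Local Notation sg := (smooth_exp f).

Lemma besov_exps_bounded : exists M : R, forall s, Bs +oo%E f s -> s <= M.
Proof.
have [m hm] : exists m : nat, ~ Bs +oo%E f m%:R.
  apply: contrapT => H; apply: hns; apply: (besov_exps_unbounded_smooth df) => m.
  by apply: contrapT => Hm; apply: H; exists m.
exists m%:R => s Bss; rewrite leNgt; apply/negP => ms.
by apply: hm; apply: besov_exps_le Bss _ _; exact: ltW.
Qed.

Lemma inve_pos u : 0 < u -> (u%:E^-1 = (u^-1)%:E)%E.
Proof. by move=> u0; rewrite inver gt_eqF. Qed.

Lemma inve_ge0_gt0 u : 0 <= u -> (0 < (u%:E^-1)%E :> \bar R)%E.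
Proof.
rewrite le_eqVlt => /predU1P[<-|u0]; first by rewrite inve0 ltry.
by rewrite inve_pos// lte_fin invr_gt0.
Qed.

Lemma besov_exps_up u s : 0 <= u -> Bs +oo%E f s -> Bs (u%:E^-1)%E f s.
Proof.
rewrite le_eqVlt => /predU1P[<-|u0]; first by rewrite inve0.
by rewrite inve_pos//; apply: besov_exps_embed => //; rewrite invr_gt0.
Qed.

Lemma besov_exps_down u s : 0 <= u -> Bs (u%:E^-1)%E f s -> Bs +oo%E f (s - u).
Proof.
rewrite le_eqVlt => /predU1P[<-|u0]; first by rewrite inve0 subr0.
have i0 : 0 < u^-1 by rewrite invr_gt0.
by rewrite inve_pos// => /(besov_exps_bernstein hphi i0); rewrite invrK.
Qed.

(** Not [-oo] because a distribution has finite order, not [+oo] because [f]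
    is not smooth. *)
Lemma crit_expE u : 0 <= u -> cr (u%:E^-1)%E f = (sg u)%:E.
Proof.
move=> u0; rewrite /smooth_exp fineK//.
have [M hM] := besov_exps_bounded.
have [s hs] := besov_exps_nonempty hphi df.
rewrite fin_real//; apply/andP; split.
  by apply: lt_le_trans (crit_exp_ub (besov_exps_up u0 hs)); exact: ltNyr.
apply: (@le_lt_trans _ _ (M + u)%:E); last exact: ltry.
apply: ge_ereal_sup => _ [t ht <-]; rewrite lee_fin -lerBlDr.
by apply: hM; exact: besov_exps_down.
Qed.

Lemma smooth_exp_ub u s : 0 <= u -> Bs (u%:E^-1)%E f s -> s <= sg u.
Proof. by move=> u0 hs; rewrite -lee_fin -crit_expE//; exact: crit_exp_ub. Qed.

Lemma smooth_exp_mem u s : 0 <= u -> s < sg u -> Bs (u%:E^-1)%E f s.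
Proof.
move=> u0; rewrite -lte_fin -crit_expE// => /ereal_sup_gt[_ [t ht <-]].
by rewrite lte_fin => st; apply: besov_exps_le ht _ _; exact: ltW.
Qed.

Lemma smooth_exp_lip0 u : 0 <= u -> sg 0 <= sg u <= sg 0 + u.
Proof.
move=> u0; apply/andP; split; apply/ler_addgt0Pr => e e0.
  rewrite -lerBlDr; apply: smooth_exp_ub => //; apply: besov_exps_up => //.
  have := @smooth_exp_mem 0 (sg 0 - e) (lexx 0); rewrite inve0; apply.
  by rewrite ltrBlDr ltrDl.
have H := besov_exps_down u0 (@smooth_exp_mem u (sg u - e) u0 _).
have : sg u - e - u <= sg 0.
  apply: smooth_exp_ub => //; rewrite inve0; apply: H.
  by rewrite ltrBlDr ltrDl.
by lra.
Qed.

Lemma smooth_exp_concave_gt0 u v t : 0 < u -> 0 < v -> 0 < t < 1 ->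
  (1 - t) * sg u + t * sg v <= sg ((1 - t) * u + t * v).
Proof.
move=> u0 v0 t01; have /andP[t0 t1] := t01.
have w0 : 0 < (1 - t) * u + t * v by rewrite addr_gt0// mulr_gt0// subr_gt0.
apply/ler_addgt0Pr => e e0; rewrite -lerBlDr.
have -> : (1 - t) * sg u + t * sg v - e = (1 - t) * (sg u - e) + t * (sg v - e) by ring.
apply: smooth_exp_ub; first exact: ltW.
have Bu : Bs (u%:E^-1)%E f (sg u - e).
  by apply: smooth_exp_mem; [exact: ltW|rewrite ltrBlDr ltrDl].
have Bv : Bs (v%:E^-1)%E f (sg v - e).
  by apply: smooth_exp_mem; [exact: ltW|rewrite ltrBlDr ltrDl].
move: Bu Bv; rewrite !inve_pos// => Bu Bv.
by apply: (@besov_exps_interp _ _ _ hphi f _ u^-1 v^-1 t); rewrite ?invr_gt0// !invrK.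
Qed.

Lemma smooth_exp_concave0 v t : 0 < v -> 0 < t < 1 ->
  (1 - t) * sg 0 + t * sg v <= sg (t * v).
Proof.
move=> v0 /andP[t0 t1]; apply/ler_addgt0Pr => e e0.
have w0 : 0 < t * v by rewrite mulr_gt0.
have wv : t * v < v by rewrite -[ltRHS]mul1r ltr_pM2r.
(* Interpolate between a small [d > 0] and [v]; monotonicity at zero replaces
   [sg d] by [sg 0], and the weight [t'] tends to [t] with [d]. *)
pose d := Num.min (e * (1 - t)) (t * v / 2).
have d0 : 0 < d by rewrite lt_min !mulr_gt0 ?subr_gt0//.
have d1 : d <= e * (1 - t) by rewrite ge_min lexx.
have d2 : d <= t * v / 2 by rewrite ge_min lexx orbT.
have dv : d < t * v by apply: le_lt_trans d2 _; lra.
have vd : 0 < v - d by lra.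
pose t' := (t * v - d) / (v - d).
have t'01 : 0 < t' < 1.
  apply/andP; split; first by rewrite divr_gt0//; lra.
  by rewrite ltr_pdivrMr// mul1r; lra.
have E : (1 - t') * d + t' * v = t * v by rewrite /t'; field; rewrite gt_eqF.
have := smooth_exp_concave_gt0 d0 v0 t'01; rewrite E.
have /andP[s0 _] := smooth_exp_lip0 (ltW d0).
have /andP[sv1 sv2] := smooth_exp_lip0 (ltW v0).
have tt : (t - t') * v <= e.
  have -> : (t - t') * v = d * (1 - t) * v / (v - d) by rewrite /t'; field; rewrite gt_eqF.
  rewrite ler_pdivrMr//.
  apply: (@le_trans _ _ (d * v * (1 - t))); first by rewrite mulrAC.
  apply: (@le_trans _ _ (e * (1 - t) * v * (1 - t))).
    by rewrite ler_wpM2r ?subr_ge0 ?(ltW t1)// ler_wpM2r ?(ltW v0).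
  have : e * ((1 - t) * v) <= e * (v - d) by rewrite ler_pM2l//; lra.
  apply: le_trans; rewrite mulrA ler_piMr ?mulr_ge0 ?(ltW e0) ?(ltW v0) ?subr_ge0 ?(ltW t1)//.
  by lra.
have tpos : 0 <= t - t'.
  have -> : t - t' = d * (1 - t) / (v - d) by rewrite /t'; field; rewrite gt_eqF.
  by rewrite divr_ge0 ?mulr_ge0 ?(ltW d0) ?(ltW vd) ?subr_ge0 ?(ltW t1).
have /andP[t'0 t'1] := t'01.
have A : (1 - t') * sg 0 <= (1 - t') * sg d by rewrite ler_wpM2l// subr_ge0 ltW.
have B : (t - t') * (sg v - sg 0) <= (t - t') * v by rewrite ler_wpM2l//; lra.
by move=> C; nra.
Qed.

Lemma smooth_exp_concave u v t : 0 <= u -> 0 <= v -> 0 < t < 1 ->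
  (1 - t) * sg u + t * sg v <= sg ((1 - t) * u + t * v).
Proof.
move=> + + t01; have /andP[t0 t1] := t01.
rewrite le_eqVlt => /predU1P[<-|u0]; rewrite le_eqVlt => /predU1P[<-|v0].
- by rewrite !mulr0 addr0 -mulrDl subrK mul1r.
- by rewrite mulr0 add0r; exact: smooth_exp_concave0.
- rewrite mulr0 addr0 addrC.
  have t'01 : 0 < 1 - t < 1 by apply/andP; split; lra.
  by have := smooth_exp_concave0 u0 t'01; rewrite subKr.
- exact: smooth_exp_concave_gt0.
Qed.

End nonsmooth.

End smooth_exponent.

(** * Concave functions on the half-line *)

Section concave.
Context {R : realType}.
Implicit Types (u v w h d : R).

Lemma monotone_right_limit (g : R -> R) (delta B : R) : 0 < delta ->
  (forall h k, 0 < h -> h <= k -> k < delta -> g k <= g h) ->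
  (forall h, 0 < h < delta -> g h <= B) ->
  exists d, [/\ g h @[h --> 0^'+] --> d, (forall h, 0 < h < delta -> g h <= d) & d <= B].
Proof.
move=> d0 mg gB.
pose A := g @` `]0, delta[%classic.
have uA : has_ubound A.
  by exists B; move=> _ [h /= hh <-]; apply: gB; move: hh; rewrite in_itv.
have A0 : A !=set0.
  by exists (g (delta / 2)), (delta / 2) => //=; rewrite in_itv /=; apply/andP; split; lra.
exists (sup A); split.
- apply: (@nonincreasing_at_right_cvgr _ g 0 (BLeft delta)) => //.
  move=> h k; rewrite !in_itv /= => /andP[h0 hd] /andP[k0 kd] hk.
  exact: mg.
- by move=> h hh; apply: ub_le_sup => //; exists h => //=; rewrite in_itv.
- by apply: ge_sup => //; move=> _ [h /= hh <-]; apply: gB; move: hh; rewrite in_itv.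
Qed.

Lemma cvg_two_sided (T : topologicalType) (g : R -> T) (l : T) :
  g h @[h --> 0^'+] --> l -> g h @[h --> 0^'-] --> l -> g h @[h --> 0^'] --> l.
Proof.
move=> gr gl A nA; have := gl A nA; have := gr A nA.
apply: (@filterS2 _ (nbhs (0:R)) _ _ _ _ _) => h r l' /=.
by rewrite neq_lt => /orP[]; [exact: l'|exact: r].
Qed.

Variable sg : R -> R.
Hypothesis sg_concave : forall u v t, 0 <= u -> 0 <= v -> 0 < t < 1 ->
  (1 - t) * sg u + t * sg v <= sg ((1 - t) * u + t * v).
Hypothesis sg_lip0 : forall u, 0 <= u -> sg 0 <= sg u <= sg 0 + u.

Definition slope u v := (sg v - sg u) / (v - u).

Lemma three_points u v w : 0 <= u -> u < v -> v < w ->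
  (w - v) * sg u + (v - u) * sg w <= (w - u) * sg v.
Proof.
move=> u0 uv vw; have uw : 0 < w - u by lra.
have t01 : 0 < (v - u) / (w - u) < 1.
  apply/andP; split; first by rewrite divr_gt0//; lra.
  by rewrite ltr_pdivrMr// mul1r; lra.
have w0 : 0 <= w by lra.
have := sg_concave u0 w0 t01.
rewrite (_ : _ * u + _ * w = v); last by field; lra.
rewrite -(ler_pM2l uw) => H; apply: le_trans H.
by apply: le_of_eq; field; lra.
Qed.

Lemma slope_left u v w : 0 <= u -> u < v -> v < w -> slope u w <= slope u v.
Proof.
move=> u0 uv vw; have H := three_points u0 uv vw.
rewrite /slope ler_pdivrMr; last by lra.
rewrite mulrAC ler_pdivlMr; last by lra.
nra.
Qed.

Lemma slope_right u v w : 0 <= u -> u < v -> v < w -> slope v w <= slope u w.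
Proof.
move=> u0 uv vw; have H := three_points u0 uv vw.
rewrite /slope ler_pdivrMr; last by lra.
rewrite mulrAC ler_pdivlMr; last by lra.
nra.
Qed.

Lemma slope_mid u v w : 0 <= u -> u < v -> v < w -> slope v w <= slope u v.
Proof.
by move=> u0 uv vw; apply: le_trans (slope_left u0 uv vw); exact: slope_right.
Qed.

(** A concave function that is bounded below on a half-line is nondecreasing. *)
Lemma slope_ge0 u v : 0 <= u -> u < v -> 0 <= slope u v.
Proof.
move=> u0 uv; rewrite leNgt; apply/negP => s0.
(* A negative slope would persist to the right and drive [sg] below [sg 0]. *)
have u1 := sg_lip0 u0; case/andP: u1 => _ u1.
pose w := v + (u + 1) / (- slope u v).
have ns : 0 < - slope u v by rewrite oppr_gt0.
have vw : v < w by rewrite /w ltrDl divr_gt0//; lra.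
have H := slope_left u0 uv vw.
have w0 : 0 <= w by lra.
have /andP[w1 _] := sg_lip0 w0.
have E : sg w - sg u = slope u w * (w - u) by rewrite /slope divfK// gt_eqF//; lra.
have wu : 0 < w - u by lra.
have H2 : slope u w * (w - u) <= slope u v * (w - u) by rewrite ler_wpM2r// ltW.
have H3 : slope u v * (w - v) = - (u + 1).
  by rewrite /w addrAC subrr add0r invrN mulrN mulrN mulrCA mulfV ?mulr1// lt_eqF.
have H4 : slope u v * (v - u) <= 0.
  by rewrite mulr_le0_ge0 ?ltW//; lra.
have H5 : slope u v * (w - u) = slope u v * (w - v) + slope u v * (v - u) by ring.
by lra.
Qed.

Lemma slope_le1 u v : 0 <= u -> u < v -> slope u v <= 1.
Proof.
rewrite le_eqVlt => /predU1P[<-|u0] uv.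
  rewrite /slope ler_pdivrMr ?subr_gt0// mul1r subr0.
  by have /andP[_] := sg_lip0 (ltW uv); lra.
apply: le_trans (slope_mid (lexx 0) u0 uv) _.
rewrite /slope ler_pdivrMr ?subr_gt0// mul1r subr0.
by have /andP[_] := sg_lip0 (ltW u0); lra.
Qed.

Lemma right_slope_limit u : 0 <= u -> exists d,
  [/\ slope u (u + h) @[h --> 0^'+] --> d, (forall v, u < v -> slope u v <= d) & 0 <= d].
Proof.
move=> u0.
have mono h k : 0 < h -> h <= k -> slope u (u + k) <= slope u (u + h).
  move=> h0; rewrite le_eqVlt => /predU1P[->//|hk].
  by apply: slope_left => //; lra.
have bd h : 0 < h -> slope u (u + h) <= 1.
  by move=> h0; apply: slope_le1 => //; lra.
have [||d [dl ub _]] := @monotone_right_limit (fun h => slope u (u + h)) 1 1 ltr01.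
- by move=> h k h0 hk _; exact: mono.
- by move=> h /andP[h0 _]; exact: bd.
have ub' v : u < v -> slope u v <= d.
  move=> uv; pose h := Num.min (v - u) (1 / 2).
  have h0 : 0 < h by rewrite lt_min subr_gt0 uv; lra.
  have h1 : h <= v - u by rewrite ge_min lexx.
  have h2 : h < 1 by apply: (@le_lt_trans _ _ (1 / 2)); [rewrite ge_min lexx orbT|lra].
  apply: le_trans (ub h _); last by rewrite h0.
  by have := mono h (v - u) h0 h1; rewrite addrC subrK.
exists d; split => //.
have u1 : u < u + 1 by lra.
exact: le_trans (slope_ge0 u0 u1) (ub' _ u1).
Qed.

Lemma slopeC u v : slope u v = slope v u.
Proof. by rewrite /slope -(opprB (sg u)) -(opprB u v) invrN mulrNN. Qed.

Lemma left_slope_limit u : 0 < u -> exists d,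
  [/\ slope u (u + h) @[h --> 0^'-] --> d, (forall v, 0 <= v < u -> d <= slope v u) &
      forall v, u < v -> slope u v <= d].
Proof.
move=> u0.
have mono h k : 0 < h -> h <= k -> k < u -> - slope (u - k) u <= - slope (u - h) u.
  move=> h0; rewrite le_eqVlt => /predU1P[->//|hk] ku.
  by rewrite lerN2; apply: slope_right; lra.
have bd v h : u < v -> 0 < h < u -> - slope (u - h) u <= - slope u v.
  by move=> uv /andP[h0 hu]; rewrite lerN2; apply: slope_mid; lra.
have uu1 : u < u + 1 by lra.
have [||d [dl ub dB]] := @monotone_right_limit (fun h => - slope (u - h) u) u
  (- slope u (u + 1)) u0.
- by move=> h k h0 hk ku; exact: mono.
- by move=> h hh; exact: bd.
exists (- d); split.
- apply/cvg_at_leftNP; rewrite oppr0.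
  rewrite (_ : _ \o _ = fun h => - - slope (u - h) u); first exact: cvgN.
  by apply/funext => h /=; rewrite opprK slopeC.
- move=> v /andP[v0 vu].
  have [v00|v00] := eqVneq v 0; last first.
    have := ub (u - v); rewrite subKr lerNl; apply.
    by rewrite subr_gt0 vu /= gtrBl lt_neqAle eq_sym v00.
  (* At the end point the bound follows from an interior point. *)
  have := ub (u / 2); rewrite lerNl => H.
  apply: le_trans (H _) _; first by apply/andP; split; lra.
  by rewrite v00; apply: slope_right; lra.
- move=> v uv; rewrite lerNr.
  have dv h : 0 < h < u -> - slope (u - h) u <= - slope u v by exact: bd.
  apply: (cvgr_to_le dl); near=> h.
  apply: dv; apply/andP; split; first by near: h; exact: nbhs_right_gt.
  by near: h; exact: nbhs_right_lt.
Unshelve. all: by end_near. Qed.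

(** No slope exceeds one, so when the left derivative at [u] is one, all chords
    ending at [u] have slope exactly one. *)
Lemma affine_of_slope_ge1 u : 0 < u -> (forall w, 0 <= w < u -> 1 <= slope w u) ->
  forall w, 0 <= w <= u -> sg w = sg u + w - u.
Proof.
move=> u0 H w /andP[w0]; rewrite le_eqVlt => /predU1P[->|wu]; first by rewrite addrK.
have wu' : 0 <= w < u by rewrite w0.
have : slope w u = 1.
  by apply/eqP; rewrite eq_le slope_le1// H.
rewrite /slope => /(canRL (divfK _)) E.
have : sg u - sg w = 1 * (u - w) by apply: E; rewrite gt_eqF// subr_gt0.
by rewrite mul1r => E'; lra.
Qed.

(** The other extreme case: slopes are non-negative, and here also
    non-positive. *)
Lemma constant_of_slope_le0 u : 0 <= u -> (forall v, u < v -> slope u v <= 0) ->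
  forall v, u <= v -> sg v = sg u.
Proof.
move=> u0 H v; rewrite le_eqVlt => /predU1P[->//|uv].
have : slope u v = 0 by apply/eqP; rewrite eq_le slope_ge0// H.
move/eqP; rewrite mulf_eq0 invr_eq0 !subr_eq0 => /orP[/eqP//|/eqP vu].
by rewrite vu.
Qed.

(** ** Derivatives of an extended-real valued function equal to [sg] *)

Variable sinv : R -> \bar R.
Hypothesis sinvE : forall u, 0 <= u -> sinv u = (sg u)%:E.

Lemma diff_quotientE u h : 0 <= u -> 0 <= u + h ->
  diff_quotient sinv u h = (slope u (u + h))%:E.
Proof.
move=> u0 uh; rewrite /diff_quotient !sinvE// /slope (addrAC u) subrr add0r.
by [].
Qed.

Definition has_right_derivative u d :=
  diff_quotient sinv u h @[h --> 0^'+] --> d%:E.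

Definition has_left_derivative u d :=
  diff_quotient sinv u h @[h --> 0^'-] --> d%:E.

Lemma right_derivative_slope u d : 0 <= u ->
  slope u (u + h) @[h --> 0^'+] --> d -> has_right_derivative u d.
Proof.
move=> u0 dl.
have E : \forall h \near 0^'+, diff_quotient sinv u h = (slope u (u + h))%:E.
  near=> h; have h0 : 0 < h by near: h; exact: nbhs_right_gt.
  by rewrite diff_quotientE// addr_ge0// ltW.
apply: cvg_EFin; first by apply: filterS E => h ->.
by apply: cvg_trans dl; apply: near_eq_cvg; apply: filterS E => h /= ->.
Unshelve. all: by end_near. Qed.

Lemma right_derivative_exists u : 0 <= u -> exists d,
  [/\ has_right_derivative u d, (forall v, u < v -> slope u v <= d) & 0 <= d].
Proof.
move=> u0; have [d [dl H d0]] := right_slope_limit u0; exists d; split=> //.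
exact: right_derivative_slope.
Qed.

Lemma left_derivative_exists u : 0 < u -> exists d,
  [/\ has_left_derivative u d, (forall v, 0 <= v < u -> d <= slope v u) &
      forall v, u < v -> slope u v <= d].
Proof.
move=> u0; have [d [dl H1 H2]] := left_slope_limit u0; exists d; split=> //.
have E : \forall h \near 0^'-, diff_quotient sinv u h = (slope u (u + h))%:E.
  near=> h; have h0 : - u < h by near: h; apply: nbhs_left_gt; rewrite oppr_lt0.
  by rewrite diff_quotientE//; lra.
apply: cvg_EFin; first by apply: filterS E => h ->.
by apply: cvg_trans dl; apply: near_eq_cvg; apply: filterS E => h /= ->.
Unshelve. all: by end_near. Qed.

Lemma right_derivativeE u d : has_right_derivative u d ->
  right_derivative sinv u = d%:E.
Proof. by move=> H; apply: cvg_lim. Qed.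

Lemma left_derivativeE u d : has_left_derivative u d ->
  left_derivative sinv u = d%:E.
Proof. by move=> H; apply: cvg_lim. Qed.

Lemma left_ge_right u : 0 < u -> (right_derivative sinv u <= left_derivative sinv u)%E.
Proof.
move=> u0; have [d [hd _ _]] := right_derivative_exists (ltW u0).
have [e [he _ ub]] := left_derivative_exists u0.
rewrite (right_derivativeE hd) (left_derivativeE he) lee_fin.
have [d' [dl _ _]] := right_slope_limit (ltW u0).
have dd : d = d'.
  have := right_derivative_slope (ltW u0) dl.
  by move=> /right_derivativeE; rewrite (right_derivativeE hd) => -[].
rewrite dd; apply: (cvgr_to_le dl); near=> h.
by apply: ub; rewrite ltrDl; near: h; exact: nbhs_right_gt.
Unshelve. all: by end_near. Qed.

(** At a point of non-differentiability the two one-sided derivatives bound a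
    nonempty open interval, and these intervals are pairwise disjoint. *)
Lemma countable_nondifferentiable :
  countable [set u : R | 0 < u /\ ~ differentiable_at sinv u].
Proof.
pose dr u := fine (right_derivative sinv u).
pose dl u := fine (left_derivative sinv u).
have drP u : 0 < u -> has_right_derivative u (dr u) /\ forall v, u < v -> slope u v <= dr u.
  move=> u0; have [d [hd H _]] := right_derivative_exists (ltW u0).
  by rewrite /dr (right_derivativeE hd).
have dlP u : 0 < u -> has_left_derivative u (dl u) /\ forall v, 0 <= v < u -> dl u <= slope v u.
  move=> u0; have [d [hd H _]] := left_derivative_exists u0.
  by rewrite /dl (left_derivativeE hd).
have drl u : 0 < u -> dr u <= dl u.
  move=> u0; have := left_ge_right u0.
  by rewrite (right_derivativeE (drP u u0).1) (left_derivativeE (dlP u u0).1) lee_fin.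
pose B u : set R := if dr u < dl u then `]dr u, dl u[%classic else setT.
apply: (@separated_open_countable R R B).
- by move=> u; rewrite /B; case: ifP => _; [exact: interval_open|exact: openT].
- move=> u; rewrite /B; case: ifPn => h; last by exists 0.
  by exists ((dr u + dl u) / 2); rewrite /= in_itv /=; apply/andP; split; lra.
have lt u : 0 < u -> ~ differentiable_at sinv u -> dr u < dl u.
  move=> u0 nd; rewrite lt_neqAle drl// andbT; apply/eqP => E; apply: nd.
  exists (dr u); apply: cvg_two_sided; first exact: (drP u u0).1.
  by rewrite E; exact: (dlP u u0).1.
move=> u v [u0 nu] [v0 nv] [z [Bu Bv]].
move: Bu Bv; rewrite /B !lt//= !in_itv /= => /andP[a b] /andP[c d].
have key x y : 0 < x -> x < y -> dl y <= dr x.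
  move=> x0 xy; have y0 : 0 < y by lra.
  apply: le_trans ((drP x x0).2 _ xy); apply: (dlP y y0).2.
  by rewrite (ltW x0).
by case: (ltgtP u v) => // uv; [have := key u v u0 uv|have := key v u v0 uv]; lra.
Qed.

End concave.

(** * One-sided derivatives of the critical smoothness *)

Section reciprocal.
Context {R : realType}.
Implicit Types (p : \bar R) (u v : R).

Lemma reciprocal_param p : (0 < p)%E -> exists u,
  [/\ 0 <= u, p = (u%:E^-1)%E, (p^-1)%E = u%:E & ((p < +oo)%E -> 0 < u)].
Proof.
case: p => [r| |]// r0; last by exists 0; rewrite inve0 invey ltxx.
rewrite lte_fin in r0.
exists r^-1; rewrite invr_ge0 (ltW r0) !inver !gt_eqF ?invr_gt0// invrK.
by split.
Qed.

Lemma reciprocal_le u v : 0 <= u -> 0 <= v ->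
  (u%:E^-1 <= (v%:E^-1 : \bar R))%E -> v <= u.
Proof.
rewrite le_eqVlt => /predU1P[<-|u0]; rewrite le_eqVlt => /predU1P[<-|v0] //.
- by rewrite inve0 inve_pos// leye_eq => /eqP.
- by move=> _; exact: ltW.
- by rewrite !inve_pos// lee_fin lef_pV2.
Qed.

End reciprocal.

Local Open Scope ereal_scope.

Theorem proposition4p3 (R : realType) (phi0 phi1 : R -> R)
    (hphi : littlewood_paley phi0 phi1) (q : \bar R) (hq : 0 < q)
    (f : (R -> R[i]) -> R[i])
    (hf : distribution_T f) (hns : ~ is_smooth_distribution f) :
  let s_ := critical_smoothness phi0 phi1 q in
  let sinv := smoothness_of_inv phi0 phi1 q f in
  let dplus := dplus_smoothness phi0 phi1 q f in
  let dminus := dminus_smoothness phi0 phi1 q f in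
  (forall (gamma : R) (p : \bar R), 0 < p ->
     s_ (sobolev_op gamma f) p = s_ f p - gamma%:E) /\
  ((forall u : R, (0 <= u)%R -> right_differentiable sinv u) /\
   (forall u : R, (0 < u)%R -> left_differentiable sinv u)) /\
  (forall p : \bar R, 0 < p < +oo -> dminus p >= dplus p) /\
  countable [set u : R | (0 < u)%R /\ ~ differentiable_at sinv u] /\
  (forall p0 : \bar R, 0 < p0 < +oo -> dminus p0 = 1 ->
     forall p : \bar R, p0 <= p -> s_ f p = s_ f p0 + p^-1 - p0^-1) /\
  (forall p0 : \bar R, 0 < p0 -> dplus p0 = 0 ->
     forall p : \bar R, 0 < p <= p0 -> s_ f p = s_ f p0) /\
  (forall p0 : \bar R, 0 < p0 < +oo -> dminus p0 = 1 -> dplus p0 = 0 ->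
     forall p : \bar R, 0 < p ->
       s_ f p = s_ f p0 - p0^-1 + (maxe p p0)^-1 /\
       s_ f p0 - p0^-1 + (maxe p p0)^-1 = s_ f +oo + (maxe p p0)^-1).
Proof.
move=> s_ sinv dplus dminus.
pose sg := smooth_exp phi0 phi1 f.
have conc := smooth_exp_concave hphi hf hns.
have lip := smooth_exp_lip0 hphi hf hns.
have sE u : (0 <= u)%R -> s_ f (u%:E^-1) = (sg u)%:E.
  move=> u0; rewrite /s_ (critical_smoothnessE hphi (inve_ge0_gt0 u0))//.
  exact: crit_expE.
have sinvE u : (0 <= u)%R -> sinv u = (sg u)%:E by exact: sE.
have P5 p0 : 0 < p0 < +oo -> dminus p0 = 1 ->
    forall p, p0 <= p -> s_ f p = s_ f p0 + p^-1 - p0^-1.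
  move=> /andP[p00 p0y] + p p0p; have p1 := lt_le_trans p00 p0p.
  have [u [u0 pu iu /(_ p0y) u1]] := reciprocal_param p00.
  have [v [v0 pv iv _]] := reciprocal_param p1.
  have vu : (v <= u)%R by apply: reciprocal_le => //; rewrite -pu -pv.
  have [d [hd lo _]] := left_derivative_exists conc sinvE u1.
  rewrite /dminus /dminus_smoothness iu /= (left_derivativeE hd) => -[d1].
  rewrite iv pu pv !sE// -!EFinD; congr (_%:E).
  apply: (affine_of_slope_ge1 conc lip u1); last by rewrite v0.
  by move=> w hw; rewrite -d1; exact: lo.
have P6 p0 : 0 < p0 -> dplus p0 = 0 ->
    forall p, 0 < p <= p0 -> s_ f p = s_ f p0.
  move=> p00 + p /andP[p1 pp0].
  have [u [u0 pu iu _]] := reciprocal_param p00.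
  have [v [v0 pv iv _]] := reciprocal_param p1.
  have uv : (u <= v)%R by apply: reciprocal_le => //; rewrite -pu -pv.
  have [d [hd up _]] := right_derivative_exists conc lip sinvE u0.
  rewrite /dplus /dplus_smoothness iu /= (right_derivativeE hd) => -[d0].
  rewrite pu pv !sE//; congr (_%:E).
  apply: (constant_of_slope_le0 conc lip u0) => // w uw; rewrite -d0; exact: up.
split; [|split; [split|split; [|split; [|split; [|split]]]]] => //.
- move=> gamma p p0; rewrite /s_.
  rewrite (critical_smoothnessE hphi p0 hq (sobolev_distribution _ hf)).
  by rewrite crit_exp_sobolev// (critical_smoothnessE hphi p0 hq hf).
- by move=> u u0; have [d [hd _ _]] := right_derivative_exists conc lip sinvE u0; exists d.
- by move=> u u0; have [d [hd _ _]] := left_derivative_exists conc sinvE u0; exists d.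
- move=> p /andP[p0 py]; have [u [_ _ iu /(_ py) u1]] := reciprocal_param p0.
  rewrite /dminus /dplus /dminus_smoothness /dplus_smoothness iu.
  exact: (left_ge_right conc lip sinvE).
- exact: countable_nondifferentiable conc lip _ sinvE.
- move=> p0 hp0 dm dp p p1; have /andP[p00 p0y] := hp0.
  have [u [u0 pu iu _]] := reciprocal_param p00.
  have y0 : s_ f +oo = s_ f p0 - p0^-1.
    by rewrite (P5 p0 hp0 dm +oo) ?leey// invey adde0.
  rewrite y0; split=> //; case: (leP p p0) => pp0.
    rewrite (P6 p0 p00 dp p) ?p1// iu pu sE// -EFinB -EFinD.
    by rewrite subrK.
  rewrite (P5 p0 hp0 dm p (ltW pp0)).
  have [v [v0 pv iv _]] := reciprocal_param p1.
  by rewrite iv iu pu sE// -!EFinD addrAC.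
Qed.
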